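(* Let $d\ge 3$, let $a,b\in\mathbb{R}$ satisfy $a\le b<a+1$ and $a<\frac{d-2}{2}$, and let $q,n,\alpha$ be the numbers determined by $d,a,b$ as in the context. Let $B_R\subset\mathbb{R}^d$ be the ball of radius $R>0$ centered at the origin. Let $f\in C^1([0,+\infty))$ be such that $$\Phi(t):=\frac{f(t)}{t^{\frac{n+2}{n-2}}}\quad\text{is non-increasing on }(0,+\infty).$$ If $$\alpha\le\sqrt{\frac{d-1}{n-1}},$$ then there exist no positive bounded weak solutions $u$ to $$\begin{cases}\mathrm{div}(|x|^{-2a}Du)+|x|^{-bq}f(u)=0 & \text{in }B_R,\\ u_\nu=0 & \text{on }\partial B_R,\end{cases}$$ unless $u$ is constant.
   Context: Parameters: $d\ge3$ is an integer, $a_c:=\frac d2-1$, and $a,b\in\mathbb{R}$ satisfy $a\le b<a+1$, $a<a_c$. Set $$q=\frac{2d}{d-2(1+a-b)},\qquad \alpha=\frac{(1+a-b)(a_c-a)}{a_c-a+b},\qquad n=\frac{d}{1+a-b}$$ (so $n\ge d$ is a real number and $\alpha>0$). $D$ is the Euclidean gradient, $\nu$ the outward unit normal, and $u_\nu$ the normal derivative. Weak solution on a bounded domain $\Omega$ (here $\Omega=B_R$): a function $u$ with $\int_\Omega|x|^{-bq}u^2\,dx+\int_\Omega|x|^{-2a}|Du|^2\,dx<+\infty$ (that is, in the corresponding weighted Sobolev space) such that $\int_\Omega|x|^{-2a}Du\cdot D\psi\,dx=\int_\Omega|x|^{-bq}f(u)\psi\,dx$ for all $\psi\in C^1(\overline\Omega)$.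 Bounded means $u\in L^\infty(\Omega)$; positive means $u>0$ in $\Omega$. *)

(* Defs.v *)
From HB Require Import structures.
From mathcomp Require Import all_boot all_order all_algebra.
From mathcomp Require Import all_classical all_reals all_analysis.

Set Implicit Arguments.
Unset Strict Implicit.
Unset Printing Implicit Defensive.

Import Order.TTheory GRing.Theory Num.Theory.
Import numFieldNormedType.Exports.

Local Open Scope classical_set_scope.
Local Open Scope ring_scope.

(* Borel sigma-algebra on R^n, generated by the coordinate functions. *)
Section borel_rV.
Context (R : realType) (n : nat).

Let coord : 'I_n -> 'rV[R]_n -> R := fun i x => x ord0 i.

Let rV_set0 : g_sigma_preimage coord set0.
Proof. exact: sigma_algebra0. Qed.

Let rV_setC A : g_sigma_preimage coord A -> g_sigma_preimage coord (~` A).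
Proof. exact: sigma_algebraC. Qed.

Let rV_bigcup (F : (set 'rV[R]_n)^nat) :
  (forall i, g_sigma_preimage coord (F i)) ->
  g_sigma_preimage coord (\bigcup_i (F i)).
Proof. exact: sigma_algebra_bigcup. Qed.

HB.instance Definition _ := @isMeasurable.Build default_measure_display
  ('rV[R]_n) (g_sigma_preimage coord) rV_set0 rV_setC rV_bigcup.

Lemma measurable_coord (i : 'I_n) :
  measurable_fun [set: 'rV[R]_n] (fun x : 'rV[R]_n => x ord0 i).
Proof.
move=> _ Y mY; rewrite setTI; apply: sub_sigma_algebra => /=.
rewrite -bigcup_seq/=; exists i => /=; first by rewrite mem_index_enum.
by exists Y => //; rewrite setTI.
Qed.

Lemma measurable_fun_rV d (T : measurableType d) (f : T -> 'rV[R]_n) :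
  (forall i, measurable_fun [set: T] (fun t => f t ord0 i)) ->
  measurable_fun [set: T] f.
Proof.
move=> mf; apply: (@measurability _ _ _ _ _ _
  (\big[setU/set0]_(i < n) preimage_set_system setT (coord i) measurable)) => //.
move=> _ [B + <-]; rewrite -bigcup_seq => -[/= i _ [A mA <-]].
by rewrite !setTI; have := mf i measurableT A mA; rewrite setTI.
Qed.

End borel_rV.

Section lebesgue_rV_step.
Local Open Scope ereal_scope.
Context (R : realType) (n : nat).

Definition cons_rV (p : measurableTypeR R * 'rV[R]_n) : 'rV[R]_n.+1 := row_mx p.1%:M p.2.

Lemma cons_rV0 p : cons_rV p ord0 ord0 = p.1.
Proof.
rewrite (_ : cons_rV p ord0 ord0 = cons_rV p ord0 (@lshift 1 n ord0)); last first.
  by congr (cons_rV p _ _); exact: val_inj.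
by apply: (etrans (row_mxEl _ _ _ _)); rewrite mxE.
Qed.

Lemma cons_rVS p (i : 'I_n) : cons_rV p ord0 (lift ord0 i) = p.2 ord0 i.
Proof.
have -> : lift ord0 i = @rshift 1 n i :> 'I_n.+1 by exact: val_inj.
exact: row_mxEr.
Qed.

Lemma measurable_cons_rV :
  measurable_fun [set: measurableTypeR R * 'rV[R]_n] cons_rV.
Proof.
apply: measurable_fun_rV => i; case: (unliftP ord0 i) => [j|] ->.
- rewrite (funext (cons_rVS ^~ j)).
  exact: (measurableT_comp (measurable_coord j) measurable_snd).
- by rewrite (funext cons_rV0); exact: measurable_fst.
Qed.

Let uncons_rV (x : 'rV[R]_n.+1) : measurableTypeR R * 'rV[R]_n :=
  (x ord0 ord0, rsubmx (x : 'rV[R]_(1 + n))).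

Let measurable_uncons_rV : measurable_fun [set: 'rV[R]_n.+1] uncons_rV.
Proof.
apply/measurable_fun_pairP; split; first exact: measurable_coord.
apply: measurable_fun_rV => i.
rewrite [X in measurable_fun _ X](_ : _ = fun x : 'rV[R]_n.+1 => x ord0 (rshift 1 i)).
  exact: measurable_coord.
by apply/funext => x; rewrite /= mxE.
Qed.

Let cons_rVK : cancel cons_rV uncons_rV.
Proof.
by move=> [a v]; rewrite /uncons_rV cons_rV0 /cons_rV row_mxKr.
Qed.

Variable m : {sigma_finite_measure set 'rV[R]_n -> \bar R}.

Definition lebesgue_rV_step : set 'rV[R]_n.+1 -> \bar R :=
  pushforward (@lebesgue_measure R \x m) cons_rV.

Let pushforward_step : {measure set 'rV[R]_n.+1 -> \bar R} :=
  measure_function_pushforward__canonical__measure_function_Measure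
    (@lebesgue_measure R \x m) measurable_cons_rV.

HB.instance Definition _ := isMeasure.Build _ _ _ lebesgue_rV_step
  (measure0 pushforward_step) (measure_ge0 pushforward_step)
  (@measure_semi_sigma_additive _ _ _ pushforward_step).

Let sigma_finite_step : sigma_finite setT lebesgue_rV_step.
Proof.
have /sigma_finiteP[F [FT ndF Foo]] := sigma_finiteT (@lebesgue_measure R).
have /sigma_finiteP[G [GT ndG Goo]] := sigma_finiteT m.
exists (fun i => uncons_rV @^-1` (F i `*` G i)).
  rewrite -preimage_bigcup -[LHS](preimage_setT uncons_rV); congr (_ @^-1` _).
  rewrite -setXTT FT GT; apply/seteqP; split => [[x y] [/= [i _ Fx] [k _ Gy]]|].
    exists (maxn i k) => //; split.
    - by move: x Fx; exact/subsetPset/ndF/leq_maxl.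
    - by move: y Gy; exact/subsetPset/ndG/leq_maxr.
  by move=> [x y] [i _ [/= Fx Gy]]; split; exists i.
move=> i; have [mF Fi] := Foo i; have [mG Gi] := Goo i; split.
  rewrite -[X in measurable X]setTI; apply: measurable_uncons_rV => //.
  exact: measurableX.
rewrite /lebesgue_rV_step /pushforward -comp_preimage.
rewrite (_ : uncons_rV \o cons_rV = id); last first.
  by apply/funext => p; exact: cons_rVK.
by rewrite preimage_id product_measure1E// lte_mul_pinfty// ge0_fin_numE.
Qed.

HB.instance Definition _ := Measure_isSigmaFinite.Build _ _ _ lebesgue_rV_step
  sigma_finite_step.

End lebesgue_rV_step.

Section lebesgue_rV.
Local Open Scope ereal_scope.
Context (R : realType).

Fixpoint lebesgue_rV (n : nat) :
    {sigma_finite_measure set 'rV[R]_n -> \bar R} :=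
  if n is n'.+1 then lebesgue_rV_step (lebesgue_rV n')
  else dirac (0%R : 'rV[R]_0).

(* The values on boxes characterize n-dimensional Lebesgue
   measure. *)
Lemma lebesgue_rV_box n (A : 'I_n -> set R) : (forall i, measurable (A i)) ->
  lebesgue_rV n [set x | forall i, A i (x ord0 i)] =
  \prod_(i < n) lebesgue_measure (A i).
Proof.
have mbox k (B : 'I_k -> set R) : (forall i, measurable (B i)) ->
    measurable [set x : 'rV[R]_k | forall i, B i (x ord0 i)].
  move=> mB; rewrite (_ : [set _ | _] =
      \big[setI/setT]_(i < k) ((fun x : 'rV[R]_k => x ord0 i) @^-1` B i)).
    apply: bigsetI_measurable => i _.
    by rewrite -[X in measurable X]setTI; exact: measurable_coord.
  rewrite -bigcap_seq; apply/seteqP; split => x Bx i => [_|]; first exact: Bx.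
  by apply: (Bx i); rewrite /= mem_index_enum.
elim: n A => [|n IHn] A mA.
  by rewrite big_ord0 /= diracE mem_set // => -[].
rewrite big_ord_recl -IHn //= /lebesgue_rV_step /pushforward.
rewrite -product_measure1E; [|exact: mA|exact: (mbox _ (fun i => A (lift ord0 i)))].
congr (_ _); apply/seteqP; split => [[a v] Aav|[a v] [/= Aa Av] i].
- split => /= [|i].
  + by have := Aav ord0; rewrite /= cons_rV0.
  + by have := Aav (lift ord0 i); rewrite /= cons_rVS.
- by case: (unliftP ord0 i) => [j|] ->; rewrite ?cons_rV0 ?cons_rVS.
Qed.

End lebesgue_rV.

Section euclidean.
Context (R : realType) (d : nat).
Implicit Types (x y : 'rV[R]_d).

Definition dotp x y : R := \sum_(i < d) x ord0 i * y ord0 i.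

(* The library norm on row vectors is the sup norm. *)
Definition enorm x : R := Num.sqrt (dotp x x).

Definition eball (r : R) : set 'rV[R]_d := [set x | enorm x < r].

Definition evec (i : 'I_d) : 'rV[R]_d := delta_mx ord0 i.

End euclidean.

Section weak_solutions.
Context (R : realType) (d : nat).
Local Notation E := 'rV[R]_d.
Local Notation mu := (lebesgue_rV R d).
Implicit Types (W U : set E) (u psi phi : E -> R) (Du Dpsi Dphi : E -> E).

(* psi is in C^1 of the closure of W, with gradient Dpsi: the gradient on W
   extends continuously to the closure. *)
Definition C1_closure W psi Dpsi : Prop :=
  [/\ {within closure W, continuous psi},
      {within closure W, continuous Dpsi} &
      forall x, W x ->
        forall i, is_derive x (evec R i) psi (Dpsi x ord0 i)].

Definition C1_compact_support U phi Dphi : Prop :=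
  [/\ forall x i, is_derive x (evec R i) phi (Dphi x ord0 i),
      continuous Dphi &
      exists K : set E, [/\ compact K, K `<=` U &
        forall x, ~ K x -> phi x = 0]].

Definition loc_integrable U u : Prop :=
  measurable_fun U u /\
  forall K : set E, compact K -> K `<=` U -> mu.-integrable K (EFin \o u).

Definition weak_gradient U u Du : Prop :=
  [/\ loc_integrable U u,
      forall i, loc_integrable U (fun x => Du x ord0 i) &
      forall phi Dphi, C1_compact_support U phi Dphi ->
        forall i : 'I_d,
          (\int[mu]_(x in U) (u x * Dphi x ord0 i)%:E =
           - \int[mu]_(x in U) (Du x ord0 i * phi x)%:E)%E].

(* Membership in the Sobolev space with weights |x|^(-s) for u and |x|^(-2a)
   for its gradient Du. The weak gradient is taken away from the origin, where
   the weights are smooth and positive: for a <= - d / 2 finiteness of the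
   weighted energy does not make Du locally integrable at 0. *)
Definition weighted_sobolev (a s : R) W u Du : Prop :=
  [/\ measurable_fun W u,
      forall i, measurable_fun W (fun x => Du x ord0 i),
      weak_gradient (W `\ 0) u Du,
      (\int[mu]_(x in W) (enorm x `^ (- s) * u x ^+ 2)%:E < +oo)%E &
      (\int[mu]_(x in W) (enorm x `^ (- (2 * a)) * dotp (Du x) (Du x))%:E
         < +oo)%E].

(* div(|x|^(-2a) Du) + |x|^(-s) f(u) = 0 in W, with u_nu = 0 on the boundary;
   the Neumann condition is encoded by the test functions not having to vanish
   on the boundary. *)
Definition weak_solution (a s : R) (f : R -> R) W u : Prop :=
  exists2 Du : E -> E, weighted_sobolev a s W u Du &
    forall psi Dpsi, C1_closure W psi Dpsi ->
      (\int[mu]_(x in W) (enorm x `^ (- (2 * a)) * dotp (Du x) (Dpsi x))%:E =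
       \int[mu]_(x in W) (enorm x `^ (- s) * f (u x) * psi x)%:E)%E.

Definition ae_positive W u : Prop := {ae mu, forall x, W x -> 0 < u x}.

Definition ae_bounded W u : Prop :=
  exists M : R, {ae mu, forall x, W x -> `|u x| <= M}.

Definition ae_constant W u : Prop :=
  exists c : R, {ae mu, forall x, W x -> u x = c}.

End weak_solutions.

(* f is C^1 on [0, +oo[, the derivative at 0 being one-sided; values of f on
   negative reals are irrelevant. *)
Definition C1_halfline (R : realType) (f : R -> R) : Prop :=
  exists f' : R -> R,
    [/\ forall t : R, 0 < t -> is_derive t 1 f (f' t),
        h^-1 * (f h - f 0) @[h --> 0^'+] --> f' 0 &
        {within `[0, +oo[, continuous f'}].

Section parameters.
Context (R : realType) (d : nat) (a b : R).

Definition a_crit : R := d%:R / 2 - 1.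
Definition q_exp : R := 2 * d%:R / (d%:R - 2 * (1 + a - b)).
Definition alpha_par : R := (1 + a - b) * (a_crit - a) / (a_crit - a + b).
Definition n_dim : R := d%:R / (1 + a - b).

End parameters.

(* Main.v *)
(* Since f(t) / t^k is non-increasing, the sign of f on ]0, M] changes at most once,
   from positive to negative, so there is m with f(t) (t - m) <= 0 on ]0, M]. If
   0 < u <= M, testing the equation with u - m gives
     int |x|^(-2a) |Du|^2 = int |x|^(-bq) f(u) (u - m) <= 0,
   hence Du = 0 and u is constant.

   As u - m need not be C^1, it is replaced by a mollification of u composed with
   a slight dilation towards the origin, which is smooth up to the boundary, times
   a cutoff vanishing near the origin, where the weights are singular. Removing the
   mollification is an L^2 limit. The gradient of the cutoff at scale rho costs half
   of the energy in the ball of radius 2 rho plus a multiple of rho^(d - 2 - 2a), and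
   both tend to 0 because a < (d - 2) / 2. *)
Require Import Defs.
From mathcomp Require Import all_boot all_order all_algebra.
From mathcomp Require Import all_classical all_reals all_analysis.

Import Order.TTheory GRing.Theory Num.Theory.
Import numFieldNormedType.Exports.

Local Open Scope classical_set_scope.
Local Open Scope ring_scope.
From mathcomp Require Import measurable_realfun.
From mathcomp Require Import lra ring.
Set Implicit Arguments.
Unset Strict Implicit.
Unset Printing Implicit Defensive.

(** * Lebesgue measure and affine maps *)

(** The weak gradient is given only on the punctured ball, and near the origin the weighted energy
    need not control [Du] in L^2. So every use of mollification carries a cutoff, and the derivative
    of the mollified [u] is identified only away from 0.

    Weak convergence suffices: a fixed L^2 function is paired with the mollification of another. It
    reduces to the vanishing of the double integral of K_j(x,y) (g(x) - g(y))^2, checked on open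
    boxes and spread to L^2 by a Dynkin argument and density. The dilation makes K_j asymmetric, but
    its second marginal is at most dil^(-d), which tends to 1.

    The exponent d - 2 - 2a adds up -2 from the squared cutoff gradient, -2a from the weight and d
    from the volume. Passing from Du = 0 to constancy meets the origin once more, and there it is
    removable: the cutoff costs rho^(-1) on a volume of order rho^d with d >= 2. The mollifications
    are then constant, and this passes to the limit in the pairing. *)

Section affine1.
Context (R : realType).
Let affine (c v : R) : measurableTypeR R -> measurableTypeR R := fun t => c * t + v.

Let measurable_affine c v : measurable_fun [set: measurableTypeR R] (affine c v).
Proof. by apply: measurable_funD => //; apply: measurable_funM. Qed.

(** Scaled by [c], the pushforward of Lebesgue measure gives every half-open interval its length, so
    uniqueness of Lebesgue measure applies. *)
Lemma lebesgue_measure_affine (c v : R) (A : set R) : 0 < c -> measurable A ->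
  lebesgue_measure ((fun t => c * t + v) @^-1` A) =
  (c^-1%:E * lebesgue_measure A)%E.
Proof.
move=> c0 mA.
pose c' : {nonneg R} := NngNum (ltW c0).
have := @lebesgue_measure_unique R (mscale c' (measure_function_pushforward__canonical__measure_function_Measure
    (@lebesgue_measure R) (measurable_affine c v))).
move=> /(_ _ A mA) /=; rewrite /mscale /= => ->.
  by rewrite muleA -EFinM mulVf ?gt_eqF// mul1e.
move=> X /ocitvP [->|[[x y] /= xy ->]].
  by rewrite /mscale/= /pushforward preimage_set0 !measure0 mule0.
rewrite /pushforward (_ : _ @^-1` _ = `](x - v) / c, (y - v) / c]%classic); last first.
  apply/seteqP; split => t /=; rewrite !in_itv/= /affine => /andP[h1 h2]; apply/andP; split.
  - by rewrite ltr_pdivrMr// mulrC ltrBlDr.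
  - by rewrite ler_pdivlMr// mulrC lerBrDr.
  - by move: h1; rewrite ltr_pdivrMr// mulrC ltrBlDr.
  - by move: h2; rewrite ler_pdivlMr// mulrC lerBrDr.
rewrite !lebesgue_measure_itv/= !lte_fin xy ltr_pM2r ?invr_gt0//.
rewrite ltrBlDr subrK xy -!EFinB -EFinM; congr (_%:E); field.
by rewrite gt_eqF.
Qed.
End affine1.

(** * Open boxes as a generating pi-system *)

Section boxes.
Context (R : realType) (n : nat).
Local Notation E := 'rV[R]_n.
Local Notation mu := (lebesgue_rV R n).

Definition box (A : 'I_n -> set R) : set E := [set x | forall i, A i (x ord0 i)].

(** The factors are open rather than measurable: a kernel of shrinking width around a point of an
    open box ends up inside the box, which is the locality that the approximate identity asks of its
    generators. *)
Definition open_boxes : set (set E) :=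
  [set B | exists2 A, (forall i, open (A i)) & B = box A].

Lemma measurable_box A : (forall i, measurable (A i)) -> measurable (box A).
Proof.
move=> mA; rewrite (_ : box A =
    \big[setI/setT]_(i < n) ((fun x : E => x ord0 i) @^-1` A i)).
  apply: bigsetI_measurable => i _.
  by rewrite -[X in measurable X]setTI; exact: measurable_coord.
rewrite -bigcap_seq; apply/seteqP; split => x Bx i => [_|]; first exact: Bx.
by apply: (Bx i); rewrite /= mem_index_enum.
Qed.

Lemma open_boxes_measurable B : open_boxes B -> measurable B.
Proof. by move=> [A oA ->]; apply: measurable_box => i; exact: open_measurable. Qed.

Lemma open_boxesI : setI_closed open_boxes.
Proof.
move=> _ _ [A oA ->] [B oB ->]; exists (fun i => A i `&` B i).
  by move=> i; exact: openI.
apply/seteqP; split => x /=; first by move=> [xA xB] i; split.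
by move=> xAB; split => i; have [] := xAB i.
Qed.

Lemma measurable_open_boxes : @measurable _ E = <<s open_boxes >>.
Proof.
rewrite eqEsubset; split.
  apply: smallest_sub; first exact: smallest_sigma_algebra.
  move=> B; rewrite -bigcup_seq => -[/= i _ [A mA <-]]; rewrite setTI.
  have {}mA : (@RGenOpens.G R).-sigma.-measurable A by rewrite -RGenOpens.measurableE.
  have H := @g_sigma_preimageE E R setT (fun x : E => x ord0 i) (@RGenOpens.G R).
  have : preimage_set_system setT (fun x : E => x ord0 i)
            ((@RGenOpens.G R).-sigma.-measurable) ((fun x : E => x ord0 i) @^-1` A).
    by exists A => //; rewrite setTI.
  rewrite -H; apply: sub_sigma_algebra2.
  move=> _ [_ [a [b ->]] <-]; rewrite setTI.
  exists (fun j => if j == i then `]a, b[%classic else setT).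
    by move=> j; case: ifP => _; [exact: interval_open|exact: openT].
  apply/seteqP; split => x /=.
    by move=> xab j; case: eqP => // ->.
  by move=> /(_ i); rewrite eqxx.
apply: smallest_sub; first exact: sigma_algebra_measurable.
exact: open_boxes_measurable.
Qed.

(** The open cubes centred at 0 exhaust the space and have finite measure, so agreement on the
    pi-system of open boxes determines the measure. *)
Lemma measure_rV_unique (m1 m2 : {measure set E -> \bar R}) :
  (forall A, (forall i, open (A i)) -> m1 (box A) = m2 (box A)) ->
  (forall M : R, (m1 (box (fun=> `](- M)%R, M[%classic)) < +oo)%E) ->
  forall A, measurable A -> m1 A = m2 A.
Proof.
move=> m12 m1oo A mA.
apply: (measure_unique open_boxes (fun k => box (fun=> `](- k%:R), k%:R[%classic))) => //.
- exact: measurable_open_boxes.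
- exact: open_boxesI.
- by move=> k; exists (fun=> `](- k%:R), k%:R[%classic).
- rewrite -subTset => x _.
  exists (Num.truncn (\sum_(i < n) `|x ord0 i|)).+1 => //= i.
  rewrite /= in_itv/= -ltr_norml (le_lt_trans _ (truncnS_gt _))//.
  by rewrite (bigD1 i)//= lerDl sumr_ge0.
- by move=> _ [B oB ->]; exact: m12.
Qed.

End boxes.

Section affine_rV.
Context (R : realType) (n : nat).
Local Notation E := 'rV[R]_n.
Local Notation mu := (lebesgue_rV R n).

Let affine (c : R) (v : E) : E -> E := fun x => c *: x + v.

Lemma measurable_affine c v : measurable_fun [set: E] (affine c v).
Proof.
apply: measurable_fun_rV => i.
rewrite [X in measurable_fun _ X](_ : _ = fun x : E => c * x ord0 i + v ord0 i).
  apply: measurable_funD => //; apply: measurable_funM => //.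
  exact: measurable_coord.
by apply/funext => x; rewrite /affine !mxE.
Qed.

(** The map acts on each coordinate separately, so a box pulls back to a box and each of the [n]
    factors contributes [c^-1]; uniqueness on boxes does the rest. *)
Lemma lebesgue_rV_affine c v (A : set E) : 0 < c -> measurable A ->
  mu (affine c v @^-1` A) = ((c ^- n)%:E * mu A)%E.
Proof.
move=> c0 mA.
have cn0 : 0 <= c ^- n by rewrite invr_ge0 exprn_ge0// ltW.
pose c' : {nonneg R} := NngNum cn0.
pose m1 := measure_function_pushforward__canonical__measure_function_Measure
    mu (measurable_affine c v).
suff H : forall A, (forall i, open (A i)) -> m1 (box A) = mscale c' mu (box A).
  apply: (@measure_rV_unique R n m1 (mscale c' mu) H _ _ mA) => M.
  rewrite H; last by move=> i; exact: interval_open.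
  rewrite /mscale/= lte_mul_pinfty// lebesgue_rV_box//.
  rewrite ltey_eq; apply/orP; left; apply: (big_ind (fun x => x \is a fin_num)) => //.
    by move=> x y; exact: fin_numM.
  by move=> i _; rewrite lebesgue_measure_itv/=; case: ifP.
move=> {mA} {}A oA; rewrite /m1 /mscale/= /pushforward.
rewrite lebesgue_rV_box; last by move=> i; exact: open_measurable.
rewrite (_ : _ @^-1` _ = box (fun i => (fun t => c * t + v ord0 i) @^-1` A i)); last first.
  by apply/seteqP; split => x /= xA i; have := xA i; rewrite /affine !mxE.
rewrite lebesgue_rV_box; last first.
  move=> i; rewrite -[X in measurable X]setTI.
  have mt : measurable_fun setT (fun t : R => c * t + v ord0 i).
    by apply: measurable_funD => //; exact: measurable_funM.
  by apply: mt => //; exact: open_measurable.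
rewrite (eq_bigr (fun i => (c^-1%:E * lebesgue_measure (A i)))%E); last first.
  by move=> i _; rewrite lebesgue_measure_affine//; exact: open_measurable.
rewrite big_split/=; congr (_ * _)%E.
by rewrite -(big_morph EFin (@EFinM R) erefl) prodr_const card_ord exprVn.
Qed.

Local Open Scope ereal_scope.

Lemma ge0_integral_rV_affine c v (F : E -> \bar R) : (0 < c)%R ->
  measurable_fun [set: E] F -> (forall x, 0 <= F x) ->
  \int[mu]_x F (c *: x + v)%R = (c ^- n)%:E * \int[mu]_x F x.
Proof.
move=> c0 mF F0.
have cn0 : (0 <= c ^- n)%R by rewrite invr_ge0 exprn_ge0// ltW.
pose c' : {nonneg R} := NngNum cn0.
transitivity (\int[pushforward mu (affine c v)]_x F x).
  rewrite ge0_integral_pushforward//.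
  exact: measurable_affine.
pose m1 := measure_function_pushforward__canonical__measure_function_Measure
    mu (measurable_affine c v).
rewrite -[pushforward _ _]/(m1 : set _ -> _).
rewrite (eq_measure_integral (mscale c' mu)); last first.
  by move=> A mA _; rewrite /m1/= /pushforward lebesgue_rV_affine.
by rewrite ge0_integral_mscale.
Qed.

End affine_rV.

Lemma cvge0_near_le (R : realType) (f : nat -> \bar R) (e : R) :
  f j @[j --> \oo] --> 0%E -> 0 < e -> \forall j \near \oo, (f j <= e%:E)%E.
Proof.
move=> /fine_cvgP[ffin fe] e0; near=> j.
rewrite -[f j]fineK; last by near: j.
by rewrite lee_fin; near: j; exact: (cvgr_le 0).
Unshelve. all: by end_near. Qed.

(** On a set of finite measure it is enough that |g| <= 1 + g^2. *)
Lemma sqr_integrable d (T : measurableType d) (R : realType)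
    (mu : {measure set T -> \bar R}) (D : set T) (g : T -> R) :
  measurable D -> (mu D < +oo)%E -> measurable_fun D g ->
  (\int[mu]_(x in D) (g x ^+ 2)%:E < +oo)%E -> mu.-integrable D (EFin \o g).
Proof.
move=> mD muD mg g2.
apply: (@le_integrable _ _ _ _ _ mD _ (fun x => (1 + g x ^+ 2)%:E)).
- exact/measurable_EFinP.
- move=> x _; rewrite lee_fin [leRHS]ger0_norm ?addr_ge0 ?sqr_ge0//.
  rewrite -(real_normK (num_real (g x))); have := normr_ge0 (g x); nra.
- under eq_fun do rewrite EFinD; apply: integrableD => //.
    apply/integrableP; split => //; under eq_integral do rewrite gee0_abs ?lee_fin//.
    by rewrite integral_cst// mul1e.
  apply/integrableP; split; first by apply/measurable_EFinP; exact: measurable_funX.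
  by under eq_integral do rewrite gee0_abs ?lee_fin ?sqr_ge0//.
Qed.

(** * Approximate identities in L^2 *)

Section approximate_identity.
Local Open Scope ereal_scope.
Context d (T : measurableType d) (R : realType).
Variable mu : {sigma_finite_measure set T -> \bar R}.
Variables (D : set T) (mD : measurable D) (muD : mu D < +oo).
(** For [x] in [D], [K j x] is a probability density in the second variable. No symmetry is assumed:
    integrated over the first variable the mass may exceed one by the factor [C j], which will
    absorb the Jacobian of the dilation. *)
Variables (K : nat -> T -> T -> R) (C : nat -> R).
Hypothesis mK : forall j, measurable_fun [set: T * T] (fun z => K j z.1 z.2).
Hypothesis K_ge0 : forall j x y, (0 <= K j x y)%R.
Hypothesis K_mass : forall j x, \int[mu]_y (K j x y)%:E = (\1_D x)%:E.
Hypothesis K_mass2 : forall j y, \int[mu]_x (K j x y)%:E <= (C j * \1_D y)%:E.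
Hypothesis C_ge1 : forall j, (1 <= C j)%R.
Hypothesis C_cvg : C j @[j --> \oo] --> (1 : R)%R.

Local Notation mm := (mu \x mu).

Let mfst (g : T -> R) : measurable_fun setT g ->
  measurable_fun [set: T * T] (fun z => g z.1).
Proof. by move=> mg; exact: measurableT_comp. Qed.

Let msnd (g : T -> R) : measurable_fun setT g ->
  measurable_fun [set: T * T] (fun z => g z.2).
Proof. by move=> mg; exact: measurableT_comp. Qed.

Let mKx j x : measurable_fun setT (fun y => (K j x y)%:E).
Proof. exact/measurable_EFinP/(measurable_fun_pair2 x (mK j)). Qed.

Let mKy j y : measurable_fun setT (fun x => (K j x y)%:E).
Proof. exact/measurable_EFinP/(measurable_fun_pair1 y (mK j)). Qed.

Let kernel_int1 j (g : T -> R) : measurable_fun setT g -> (forall x, 0 <= g x)%R ->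
  \int[mm]_z (K j z.1 z.2 * g z.1)%:E = \int[mu]_(x in D) (g x)%:E.
Proof.
move=> mg g0; rewrite fubini_tonelli1; last 2 first.
- by apply/measurable_EFinP; apply: measurable_funM => //; exact: mfst.
- by move=> z; rewrite lee_fin mulr_ge0.
rewrite [RHS]integral_mkcond; apply: eq_integral => x _; rewrite /fubini_F/=.
under eq_integral do rewrite mulrC EFinM.
rewrite ge0_integralZl_EFin//; last by move=> y _; rewrite lee_fin.
rewrite K_mass patchE indicE; case: ifPn => _; first by rewrite mule1.
by rewrite mule0.
Qed.

Let kernel_int2 j (g : T -> R) : measurable_fun setT g -> (forall x, 0 <= g x)%R ->
  \int[mm]_z (K j z.1 z.2 * g z.2)%:E <= (C j)%:E * \int[mu]_(x in D) (g x)%:E.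
Proof.
move=> mg g0; rewrite fubini_tonelli2; last 2 first.
- by apply/measurable_EFinP; apply: measurable_funM => //; exact: msnd.
- by move=> z; rewrite lee_fin mulr_ge0.
have C0 : (0 <= C j)%R by rewrite (le_trans _ (C_ge1 j)).
have mgD : measurable_fun setT ((EFin \o g) \_ D).
  by apply/(measurable_restrictT _ _).1 => //; apply/measurable_EFinP; exact: measurable_funTS.
have gD0 x : 0 <= ((EFin \o g) \_ D) x.
  by apply: erestrict_ge0 => t _; rewrite lee_fin.
rewrite [X in _ <= _ * X]integral_mkcond -ge0_integralZl_EFin//.
apply: ge0_le_integral => //.
- by move=> y _; apply: integral_ge0 => x _; rewrite lee_fin mulr_ge0.
- apply: measurable_fun_fubini_tonelli_G => [|z]; last by rewrite lee_fin mulr_ge0.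
  by apply/measurable_EFinP; apply: measurable_funM => //; exact: msnd.
- by apply: measurable_funeM.
- move=> y _; rewrite /fubini_G/=.
  under eq_integral do rewrite mulrC EFinM.
  rewrite ge0_integralZl_EFin//; last by move=> x _; rewrite lee_fin.
  apply: (@le_trans _ _ ((g y)%:E * (C j * \1_D y)%:E)).
    by apply: lee_wpmul2l; rewrite ?lee_fin.
  rewrite patchE indicE; case: ifPn => _ /=; rewrite -!EFinM lee_fin; lra.
Qed.

(** The mean squared oscillation of [g] seen by the kernel. It is subadditive up to a factor 2 and,
    for large [j], uniformly bounded by the squared L^2 norm on [D]. So the functions for which it
    tends to 0 form a space closed under L^2 limits, and it is enough to treat generators. *)
Let Q j (g : T -> R) := \int[mm]_z (K j z.1 z.2 * (g z.1 - g z.2) ^+ 2)%:E.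

Let mQ j (g : T -> R) : measurable_fun setT g ->
  measurable_fun [set: T * T] (fun z => K j z.1 z.2 * (g z.1 - g z.2) ^+ 2)%R.
Proof.
move=> mg; apply: measurable_funM => //; apply: measurable_funX.
by apply: measurable_funB; [exact: mfst|exact: msnd].
Qed.

Let QD j (g h : T -> R) : measurable_fun setT g -> measurable_fun setT h ->
  Q j (g \+ h)%R <= 2%:E * Q j g + 2%:E * Q j h.
Proof.
move=> mg mh; rewrite /Q.
have q0 f z : 0 <= (K j z.1 z.2 * (f z.1 - f z.2) ^+ 2)%:E.
  by rewrite lee_fin mulr_ge0// sqr_ge0.
rewrite -!ge0_integralZl_EFin//; try by [|apply/measurable_EFinP; exact: mQ].
rewrite -ge0_integralD//; last 4 first.
- by move=> z _; rewrite mule_ge0.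
- by apply: measurable_funeM; apply/measurable_EFinP; exact: mQ.
- by move=> z _; rewrite mule_ge0.
- by apply: measurable_funeM; apply/measurable_EFinP; exact: mQ.
apply: ge0_le_integral => //.
- by apply/measurable_EFinP; apply: mQ; exact: measurable_funD.
- by apply: emeasurable_funD; apply: measurable_funeM; apply/measurable_EFinP; exact: mQ.
- move=> z _; rewrite -!EFinM -EFinD lee_fin /=.
  rewrite -subr_ge0 [leRHS](_ : _ =
    K j z.1 z.2 * ((g z.1 - g z.2) - (h z.1 - h z.2)) ^+ 2)%R; last by ring.
  by rewrite mulr_ge0// sqr_ge0.
Qed.

Let Qbound j (g : T -> R) : measurable_fun setT g ->
  Q j g <= (2 + 2 * C j)%:E * \int[mu]_(x in D) (g x ^+ 2)%:E.
Proof.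
move=> mg.
have mg2 : measurable_fun setT (fun x => g x ^+ 2)%R by exact: measurable_funX.
have g20 x : (0 <= g x ^+ 2)%R by rewrite sqr_ge0.
have C0 : (0 <= C j)%R by rewrite (le_trans _ (C_ge1 j)).
rewrite EFinD ge0_muleDl ?lee_fin ?mulr_ge0// EFinM -muleA.
apply: (@le_trans _ _ (2%:E * \int[mm]_z (K j z.1 z.2 * g z.1 ^+ 2)%:E +
    2%:E * \int[mm]_z (K j z.1 z.2 * g z.2 ^+ 2)%:E)); last first.
  apply: leeD; first by rewrite (kernel_int1 j mg2 g20).
  by rewrite lee_pmul2l//; exact: (kernel_int2 j mg2 g20).
have m1 : measurable_fun [set: T * T] (fun z => (K j z.1 z.2 * g z.1 ^+ 2)%:E).
  by apply/measurable_EFinP; apply: measurable_funM => //; exact: (mfst mg2).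
have m2 : measurable_fun [set: T * T] (fun z => (K j z.1 z.2 * g z.2 ^+ 2)%:E).
  by apply/measurable_EFinP; apply: measurable_funM => //; exact: (msnd mg2).
rewrite -!ge0_integralZl_EFin//; try by move=> z _; rewrite lee_fin mulr_ge0.
rewrite -ge0_integralD//; last 4 first.
- by move=> z _; rewrite mule_ge0// lee_fin mulr_ge0.
- exact: measurable_funeM.
- by move=> z _; rewrite mule_ge0// lee_fin mulr_ge0.
- exact: measurable_funeM.
apply: ge0_le_integral => //.
- by move=> z _; rewrite lee_fin mulr_ge0// sqr_ge0.
- by apply/measurable_EFinP; exact: mQ.
- by apply: emeasurable_funD; exact: measurable_funeM.
- move=> z _; rewrite -!EFinM -EFinD lee_fin.
  rewrite -subr_ge0 [leRHS](_ : _ = K j z.1 z.2 * (g z.1 + g z.2) ^+ 2)%R; last by ring.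
  by rewrite mulr_ge0// sqr_ge0.
Qed.

Let Q_ge0 j (g : T -> R) : 0 <= Q j g.
Proof. by apply: integral_ge0 => z _; rewrite lee_fin mulr_ge0// sqr_ge0. Qed.

Let Qsmall (g : T -> R) :=
  forall e : R, (0 < e)%R -> \forall j \near \oo, Q j g <= e%:E.

Let C_le2 : \forall j \near \oo, (C j <= 2)%R.
Proof.
by apply: (cvgr_le (1 : R)%R) => //; lra.
Qed.

Let Qsmall_approx (g : T -> R) : measurable_fun setT g ->
  (forall e : R, (0 < e)%R -> exists g' : T -> R, [/\ measurable_fun setT g', Qsmall g' &
    \int[mu]_(x in D) ((g x - g' x) ^+ 2)%:E <= e%:E]) -> Qsmall g.
Proof.
move=> mg gP e e0.
(* Once [C j <= 2], the constant [2 + 2 * C j] of [Qbound] is at most 6 and turns e / 24 into e / 4;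
   [QD] then doubles the two quarters, one for [g'] and one for the difference, into e. *)
have [g' [mg' g's gg']] := gP (e / 24)%R (divr_gt0 e0 (ltr0Sn _ _)).
have e4 : (0 < e / 4)%R by rewrite divr_gt0.
near=> j.
have -> : g = (g' \+ (g \- g'))%R by apply/funext => x /=; rewrite addrC subrK.
apply: (le_trans (QD j mg' (measurable_funB mg mg'))).
have Q1 : Q j g' <= (e / 4)%:E by near: j; exact: g's.
have Q2 : Q j (g \- g')%R <= (e / 4)%:E.
  apply: (le_trans (Qbound j (measurable_funB mg mg'))).
  apply: (@le_trans _ _ (6%:E * (e / 24)%:E)); last by rewrite -EFinM lee_fin; lra.
  have C2 : (C j <= 2)%R by near: j; exact: C_le2.
  have := C_ge1 j => C1.
  apply: lee_pmul => //.
  - by rewrite lee_fin; lra.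
  - by apply: integral_ge0 => x _; rewrite lee_fin sqr_ge0.
  - by rewrite lee_fin; lra.
apply: (@le_trans _ _ (2%:E * (e / 4)%:E + 2%:E * (e / 4)%:E)).
  by apply: leeD; rewrite lee_pmul2l.
by rewrite -!EFinM -EFinD lee_fin; lra.
Unshelve. all: by end_near. Qed.

Let QsmallD (g h : T -> R) : measurable_fun setT g -> measurable_fun setT h ->
  Qsmall g -> Qsmall h -> Qsmall (g \+ h)%R.
Proof.
move=> mg mh gs hs e e0; have e4 : (0 < e / 4)%R by rewrite divr_gt0.
near=> j; apply: (le_trans (QD j mg mh)).
apply: (@le_trans _ _ (2%:E * (e / 4)%:E + 2%:E * (e / 4)%:E)).
  by apply: leeD; rewrite lee_pmul2l//; near: j; [exact: gs|exact: hs].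
by rewrite -!EFinM -EFinD lee_fin; lra.
Unshelve. all: by end_near. Qed.

Let QsmallZ (c : R) (g : T -> R) : measurable_fun setT g ->
  Qsmall g -> Qsmall (fun x => c * g x)%R.
Proof.
move=> mg gs e e0.
have c1 : (0 < c ^+ 2 + 1)%R by rewrite ltr_wpDl// sqr_ge0.
near=> j.
have -> : Q j (fun x => c * g x)%R = (c ^+ 2)%:E * Q j g.
  rewrite /Q -ge0_integralZl_EFin ?sqr_ge0//; last 2 first.
  - by move=> z _; rewrite lee_fin mulr_ge0// sqr_ge0.
  - by apply/measurable_EFinP; exact: mQ.
  by apply: eq_integral => z _; rewrite -EFinM; congr (_%:E); ring.
apply: (@le_trans _ _ ((c ^+ 2 + 1)%:E * (e / (c ^+ 2 + 1))%:E)).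
  apply: lee_pmul => //; rewrite ?lee_fin ?sqr_ge0 ?lerDl//.
  by near: j; apply: gs; rewrite divr_gt0.
by rewrite -EFinM mulrCA divff ?mulr1// gt_eqF.
Unshelve. all: by end_near. Qed.

Let Qsmall0 : Qsmall (cst 0%R).
Proof.
move=> e e0; near=> j; rewrite /Q (eq_integral (cst 0)) ?integral0 ?lee_fin 1?ltW//.
by move=> z _ /=; rewrite subrr expr0n mulr0.
Unshelve. all: by end_near. Qed.

Variable G : set (set T).
Hypothesis GE : @measurable _ T = <<s G >>.
Hypothesis GI : setI_closed G.
Hypothesis K_local : forall A, G A -> forall x, A x ->
  \forall j \near \oo, forall y, K j x y != 0%R -> A y.

(** Locality is available only at points of [A], so only the mass that leaves [A] tends to 0
    directly. The mass that enters from outside is controlled by balance: by [K_mass2] the total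
    mass landing in [A] is at most [C j] times the measure of the part of [A] in [D], and [C j]
    tends to 1. *)
Let Qsmall_gen A : G A -> Qsmall (\1_A).
Proof.
move=> GA e e0.
have mA : measurable A by rewrite GE; exact: sub_sigma_algebra.
have m1A : measurable_fun setT (\1_A : T -> R) by exact: measurable_indic.
have A0 x : (0 <= \1_A x :> R)%R by rewrite indicE.
have A1 x : (\1_A x <= 1 :> R)%R by rewrite indicE lern1 leq_b1.
(* The part of the kernel that starts in [A] and ends outside. *)
pose f j (z : T * T) : R := (K j z.1 z.2 * (\1_A z.1 * (1 - \1_A z.2)))%R.
have mf j : measurable_fun setT (fun z => (f j z)%:E).
  apply/measurable_EFinP; apply: measurable_funM => //.
  apply: measurable_funM; first exact: mfst.
  by apply: measurable_funB => //; exact: msnd.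
have f0 j z : 0 <= (f j z)%:E.
  by rewrite lee_fin !mulr_ge0// subr_ge0.
have fcvg : \int[mm]_z (f j z)%:E @[j --> \oo] --> 0.
  under eq_fun do rewrite fubini_tonelli1//.
  have := @dominated_convergence _ _ _ mu setT measurableT
    (fun j => fubini_F mu (fun z => (f j z)%:E)) (cst 0) (EFin \o \1_D).
  case.
  - by move=> j; exact: measurable_fun_fubini_tonelli_F.
  - exact: measurable_cst.
  - apply/aeW => x _; apply: cvg_near_cst.
    have [Ax|nAx] := pselect (A x); last first.
      apply: nearW => j; rewrite /fubini_F (eq_integral (cst 0)) ?integral0//.
      by move=> y _; rewrite /f/= indicE memNset// mul0r mulr0.
    apply: filterS (K_local GA Ax) => j Kj.
    rewrite /fubini_F (eq_integral (cst 0)) ?integral0//.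
    move=> y _; rewrite /f/=.
    have [->|K0] := eqVneq (K j x y) 0%R; first by rewrite mul0r.
    by rewrite [\1_A y]indicE mem_set ?subrr ?mulr0//; exact: Kj.
  - apply/integrableP; split; first exact/measurable_EFinP/measurable_indic.
    under eq_integral do rewrite gee0_abs ?lee_fin//.
    by rewrite integral_indic// setIT.
  - apply/aeW => x j _; rewrite gee0_abs; last by apply: integral_ge0.
    rewrite /= -(K_mass j); apply: ge0_le_integral => //.
    + exact: (measurable_fun_pair2 _ (mf j)).
    + by move=> y _; rewrite lee_fin /f/= ler_piMr// mulr_ile1// ?subr_ge0// lerBlDr lerDl.
  by rewrite integral0.
pose m : R := fine (\int[mu]_(x in D) (\1_A x)%:E).
have mE : \int[mu]_(x in D) (\1_A x)%:E = m%:E.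
  rewrite /m fineK// integral_indic// ge0_fin_numE//.
  by apply: le_lt_trans muD; apply: le_measure; rewrite ?inE//; exact: measurableI.
have m0 : (0 <= m)%R by rewrite -lee_fin -mE; apply: integral_ge0 => x _; rewrite lee_fin.
(* The pointwise identity (1_A(x) - 1_A(y))^2 + 1_A(x) = 1_A(y) + 2 1_A(x) (1 - 1_A(y)), integrated
   against the kernel. The finite term [m] stays on the left to avoid subtracting extended reals. *)
have QE j : Q j \1_A + m%:E <= (C j * m)%:E + 2%:E * \int[mm]_z (f j z)%:E.
  rewrite EFinM -mE.
  apply: le_trans; last by apply: leeD (lexx _); exact: (kernel_int2 j m1A A0).
  rewrite -(kernel_int1 j m1A A0) -ge0_integralZl_EFin// /Q.
  have m1 : measurable_fun [set: T * T] (fun z => (K j z.1 z.2 * \1_A z.1)%:E).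
    by apply/measurable_EFinP; apply: measurable_funM => //; exact: mfst.
  have m2 : measurable_fun [set: T * T] (fun z => (K j z.1 z.2 * \1_A z.2)%:E).
    by apply/measurable_EFinP; apply: measurable_funM => //; exact: msnd.
  have m3 : measurable_fun [set: T * T]
      (fun z => (K j z.1 z.2 * (\1_A z.1 - \1_A z.2) ^+ 2)%:E).
    by apply/measurable_EFinP; exact: mQ.
  have m4 : measurable_fun [set: T * T] (fun z => 2%:E * (f j z)%:E).
    exact: measurable_funeM.
  rewrite -!ge0_integralD//; try by move=> z _; rewrite ?mule_ge0// lee_fin mulr_ge0// sqr_ge0.
  rewrite le_eqVlt; apply/orP; left; apply/eqP; apply: eq_integral => z _.
  rewrite -EFinM -!EFinD; congr (_%:E); rewrite /f !indicE.
  by case: (_ \in _); case: (_ \in _) => /=; ring.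
have e8 : (0 < e / 8)%R by rewrite divr_gt0.
have m81 : (0 < e / 8 / (m + 1))%R by rewrite divr_gt0// ltr_wpDl.
near=> j.
have f8 : \int[mm]_z (f j z)%:E <= (e / 8)%:E.
  by near: j; exact: cvge0_near_le.
have C8 : (C j <= 1 + e / 8 / (m + 1))%R.
  by near: j; apply: (cvgr_le (1 : R)%R) => //; rewrite ltrDl.
have : Q j \1_A + m%:E <= (e + m)%:E.
  apply: (le_trans (QE j)); apply: (@le_trans _ _ ((C j * m)%:E + 2%:E * (e / 8)%:E)).
    by rewrite leeD2l// lee_pmul2l.
  rewrite -EFinM -EFinD lee_fin.
  have : (C j * m <= m + e / 8)%R.
    apply: (@le_trans _ _ ((1 + e / 8 / (m + 1)) * m)%R); first by rewrite ler_wpM2r.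
    rewrite mulrDl mul1r lerD2l mulrAC ler_pdivrMr ?ltr_wpDl//.
    by rewrite ler_wpM2l ?lerDl// ltW.
  lra.
by rewrite EFinD leeD2rE.
Unshelve. all: by end_near. Qed.

(** Passing to the complement only changes the sign of a difference of indicators, and a countable
    disjoint union is the L^2 limit on [D] of its finite partial unions because [D] has finite
    measure. *)
Let Qsmall_set A : measurable A -> Qsmall (\1_A).
Proof.
rewrite GE; move: A; apply: (dynkin_induction GE GI).
- rewrite indicT => e e0; near=> j; rewrite /Q (eq_integral (cst 0)) ?integral0 ?lee_fin 1?ltW//.
  by move=> z _ /=; rewrite subrr expr0n mulr0.
- exact: Qsmall_gen.
- move=> A mA As e e0; near=> j.
  rewrite /Q (eq_integral (fun z => (K j z.1 z.2 * (\1_A z.1 - \1_A z.2) ^+ 2)%:E)).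
    by near: j; exact: As.
  by move=> z _; congr (_%:E); congr (_ * _)%R; rewrite !indicE !in_setC;
     case: (_ \in _); case: (_ \in _) => /=; ring.
- move=> F mF tF Fs.
  apply: Qsmall_approx => [|e e0].
    by apply: measurable_indic; exact: bigcupT_measurable.
  pose g N : T -> R := fun x => (\sum_(k < N) \1_(F k) x)%R.
  have gS N : g N.+1 = (g N \+ \1_(F N))%R.
    by apply/funext => x; rewrite /g big_ord_recr.
  have g0 : g 0%N = cst 0%R by apply/funext => x; rewrite /g big_ord0.
  have mg N : measurable_fun setT (g N).
    elim: N => [|N IH]; first by rewrite g0; exact: measurable_cst.
    by rewrite gS; apply: measurable_funD => //; exact: measurable_indic.
  have gs N : Qsmall (g N).
    elim: N => [|N IH]; first by rewrite g0; exact: Qsmall0.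
    by rewrite gS; apply: QsmallD => //; exact: measurable_indic.
  have gE N : g N = \1_(\big[setU/set0]_(k < N) F k).
    elim: N => [|N IH]; first by rewrite g0 big_ord0 indic0.
    rewrite gS IH big_ord_recr/=; apply/funext => x /=.
    rewrite !indicE in_setU.
    have [xN|] := boolP (x \in F N); last by rewrite orbF addr0.
    suff /negbTE -> : x \notin \big[setU/set0]_(k < N) F k by rewrite add0r.
    apply/negP; rewrite inE -bigcup_mkord => -[k /= kN Fkx].
    have := tF k N I I; move/(_ (ex_intro _ x (conj Fkx (set_mem xN)))) => kE.
    by rewrite kE ltnn in kN.
  pose U := \bigcup_k F k.
  have mU : measurable U by exact: bigcupT_measurable.
  have : mu (D `&` (U `\` \big[setU/set0]_(k < N) F k)) @[N --> \oo] --> 0.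
    have -> : 0 = mu (\bigcap_N (D `&` (U `\` \big[setU/set0]_(k < N) F k))).
      rewrite (_ : \bigcap_N _ = set0) ?measure0//; apply/seteqP; split => // x /= xN.
      have [_ [[k _ Fkx] _]] := xN 0%N I.
      have [_ [_ []]] := xN k.+1 I.
      by rewrite -bigcup_mkord; exists k => /=.
    apply: nonincreasing_cvg_mu.
    - by apply: le_lt_trans muD; apply: le_measure; rewrite ?inE//; apply: measurableI => //;
        apply: measurableD => //; exact: bigsetU_measurable.
    - by move=> N; apply: measurableI => //; apply: measurableD => //; exact: bigsetU_measurable.
    - by apply: bigcapT_measurable => N; apply: measurableI => //; apply: measurableD => //;
        exact: bigsetU_measurable.
    - move=> N M NM; apply/subsetPset => x [Dx [Ux nx]]; split => //; split => //.
      apply: contra_not nx; rewrite -!bigcup_mkord => -[k /= kN Fkx]; exists k => //=.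
      exact: leq_trans kN NM.
  move=> /cvge0_near_le /(_ e0)[N _ /(_ _ (leqnn N)) /= muN].
  exists (g N); split => //.
  rewrite (eq_integral (fun x => (\1_(U `\` \big[setU/set0]_(k < N) F k) x)%:E)).
    by rewrite integral_indic 1?setIC//; apply: measurableD => //; exact: bigsetU_measurable.
  move=> x _; rewrite gE; congr (_%:E); rewrite !indicE in_setD.
  have [xN|_] := boolP (x \in \big[setU/set0]_(k < N) F k); last first.
    by rewrite andbT subr0; case: (_ \in _); rewrite ?expr1n ?expr0n.
  rewrite andbF mem_set; first by rewrite subrr expr0n.
  by move: xN; rewrite inE -bigcup_mkord => -[k _ Fkx]; exists k.
Unshelve. all: by end_near. Qed.

Import HBNNSimple.

Let Qsmall_nnsfun (f : {nnsfun T >-> R}) : Qsmall f.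
Proof.
have [s fE] : exists s : seq R,
    (f : T -> R) = (fun x => \sum_(y <- s) (y * \1_(f @^-1` [set y]) x))%R.
  by exists (finmap.enum_fset (fset_set (range f))); apply/funext => x; rewrite fimfunE fsbig_finite.
rewrite fE.
have mf y : measurable_fun setT (\1_(f @^-1` [set y]) : T -> R).
  by apply: measurable_indic; exact: measurable_sfunP.
suff : measurable_fun setT (fun x => \sum_(y <- s) (y * \1_(f @^-1` [set y]) x))%R
   /\ Qsmall (fun x => \sum_(y <- s) (y * \1_(f @^-1` [set y]) x))%R by case.
move: s {fE}; elim=> [|y s [IHm IHs]].
  rewrite (_ : (fun _ => _) = cst 0%R); last by apply/funext => x; rewrite big_nil.
  by split; [exact: measurable_cst|exact: Qsmall0].
rewrite (_ : (fun _ => _) = ((fun x => y * \1_(f @^-1` [set y]) x) \+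
   (fun x => \sum_(y <- s) (y * \1_(f @^-1` [set y]) x)))%R); last first.
  by apply/funext => x; rewrite big_cons.
have my : measurable_fun setT (fun x => y * \1_(f @^-1` [set y]) x : R)%R.
  exact: measurable_funM.
split; first exact: measurable_funD.
by apply: QsmallD => //; apply: QsmallZ => //; apply: Qsmall_set; exact: measurable_sfunP.
Qed.

(** Simple functions increase to [g], and the squared error is dominated by the integrable g^2. *)
Let Qsmall_ge0 (g : T -> R) : measurable_fun setT g -> (forall x, 0 <= g x)%R ->
  \int[mu]_(x in D) (g x ^+ 2)%:E < +oo -> Qsmall g.
Proof.
move=> mg g0 g2oo.
have mgE : measurable_fun setT (EFin \o g) by exact/measurable_EFinP.
have gE0 x : setT x -> 0 <= (EFin \o g) x by rewrite lee_fin.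
pose f := nnsfun_approx measurableT mgE.
apply: Qsmall_approx => // e e0.
have mfn n : measurable_fun setT (f n) by exact: measurable_funP.
have fg n x : (f n x <= g x)%R.
  by rewrite -lee_fin nnsfun_approxE; exact: (le_approx n gE0).
have fcvg x : f n x @[n --> \oo] --> g x.
  by have /fine_cvgP[_] := cvg_nnsfun_approx measurableT mgE gE0 (I : setT x).
have m2 n : measurable_fun setT (fun x => ((g x - f n x) ^+ 2)%:E).
  by apply/measurable_EFinP; apply: measurable_funX; exact: measurable_funB.
have [] := @dominated_convergence _ _ _ mu D mD
    (fun n x => ((g x - f n x) ^+ 2)%:E) (cst 0) (fun x => (g x ^+ 2)%:E).
- by move=> n; exact: measurable_funTS.
- exact: measurable_cst.
- apply/aeW => x _; apply: cvg_EFin; first exact: nearW.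
  have : ((g x - f n x) ^+ 2)%R @[n --> \oo] --> ((g x - g x) ^+ 2)%R.
    apply: (@cvg_comp _ _ _ (fun n => g x - f n x)%R (fun y => y ^+ 2)%R _ (nbhs (g x - g x)%R)).
      by apply: cvgB => //; exact: cvg_cst.
    exact: exprn_continuous.
  by rewrite subrr expr0n.
- apply/integrableP; split.
    by apply/measurable_EFinP; apply: measurable_funTS; exact: measurable_funX.
  by under eq_integral do rewrite gee0_abs ?lee_fin ?sqr_ge0//.
- apply/aeW => x n _ /=; rewrite lee_fin normrX ler_sqr ?nnegrE//.
  by rewrite ger0_norm ?subr_ge0// lerBlDr lerDl; exact: fun_ge0.
move=> _ _; rewrite integral0 => /cvge0_near_le /(_ e0)[N _ /(_ _ (leqnn N)) /= fN].
by exists (f N); split => //; exact: Qsmall_nnsfun.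
Qed.

Let Qsmall_L2 (g : T -> R) : measurable_fun setT g ->
  \int[mu]_(x in D) (g x ^+ 2)%:E < +oo -> Qsmall g.
Proof.
move=> mg g2oo.
have H (h : T -> R) : measurable_fun setT h -> (forall x, `|h x| <= `|g x|)%R ->
    (forall x, 0 <= h x)%R -> Qsmall h.
  move=> mh hg h0; apply: Qsmall_ge0 => //; apply: le_lt_trans g2oo.
  apply: ge0_le_integral => //.
  - by move=> x _; rewrite lee_fin sqr_ge0.
  - by apply/measurable_EFinP; apply: measurable_funTS; exact: measurable_funX.
  - by apply/measurable_EFinP; apply: measurable_funTS; exact: measurable_funX.
  - by move=> x _; rewrite lee_fin -(real_normK (num_real (h x))) -(real_normK (num_real (g x))) ler_sqr ?nnegrE.
have -> : g = ((fun x => Num.max (g x) 0) \+ (fun x => -1 * Num.max (- g x) 0))%R.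
  by apply/funext => x /=; rewrite /Order.max; case: (ltP (g x)); case: (ltP (- g x)%R); lra.
have m1 : measurable_fun setT (fun x => Num.max (g x) 0)%R by exact: measurable_maxr.
have m2 : measurable_fun setT (fun x => Num.max (- g x) 0)%R.
  by apply: measurable_maxr => //; exact: measurableT_comp.
apply: QsmallD => //; first exact: measurable_funM.
- apply: H => // x; last by rewrite le_max lexx orbT.
  by rewrite /Num.max; case: ifP => _; rewrite ?normr0.
- apply: QsmallZ => //; apply: H => // x; last by rewrite le_max lexx orbT.
  by rewrite /Num.max; case: ifP => _; rewrite ?normr0 ?normrN.
Qed.

Hypothesis K_bounded : forall j, exists M : R, forall x y, (K j x y <= M * \1_D y)%R.
Hypothesis K_supp : forall j x y, ~ D x -> K j x y = 0%R.

(** By [K_mass] both integrals become double integrals against the kernel, and their difference is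
    that of K(x,y) F(x) (g(x) - g(y)). Young's inequality separates the fixed norm of [F] from
    [Q j g], which tends to 0. Integrability for each [j] is part of the conclusion because it comes
    out of the same Fubini argument. *)
Lemma approximate_identity_pairing (F g : T -> R) :
  measurable_fun setT F -> measurable_fun setT g ->
  \int[mu]_(x in D) (F x ^+ 2)%:E < +oo ->
  \int[mu]_(x in D) (g x ^+ 2)%:E < +oo ->
  (forall j, mu.-integrable D (fun x => (F x * \int[mu]_(y in D) (K j x y * g y))%:E)%R) /\
  ((\int[mu]_(x in D) (F x * \int[mu]_(y in D) (K j x y * g y)))%R @[j --> \oo] -->
  (\int[mu]_(x in D) (F x * g x))%R).
Proof.
move=> mF mg F2 g2.
pose h j (z : T * T) : R := (K j z.1 z.2 * (F z.1 * g z.2))%R.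
pose h' j (z : T * T) : R := (K j z.1 z.2 * (F z.1 * g z.1))%R.
have mF2 : measurable_fun setT (fun x => F x ^+ 2)%R by exact: measurable_funX.
have mg2 : measurable_fun setT (fun x => g x ^+ 2)%R by exact: measurable_funX.
have F20 x : (0 <= F x ^+ 2)%R by rewrite sqr_ge0.
have g20 x : (0 <= g x ^+ 2)%R by rewrite sqr_ge0.
have iK1 j (k : T -> R) : measurable_fun setT k -> (forall x, 0 <= k x)%R ->
    \int[mu]_(x in D) (k x)%:E < +oo ->
    mm.-integrable setT (fun z => (K j z.1 z.2 * k z.1)%:E).
  move=> mk k0 koo; apply/integrableP; split.
    by apply/measurable_EFinP; apply: measurable_funM => //; exact: mfst.
  under eq_integral do rewrite gee0_abs ?lee_fin ?mulr_ge0//.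
  by rewrite (kernel_int1 j mk k0).
have iK2 j (k : T -> R) : measurable_fun setT k -> (forall x, 0 <= k x)%R ->
    \int[mu]_(x in D) (k x)%:E < +oo ->
    mm.-integrable setT (fun z => (K j z.1 z.2 * k z.2)%:E).
  move=> mk k0 koo; apply/integrableP; split.
    by apply/measurable_EFinP; apply: measurable_funM => //; exact: msnd.
  under eq_integral do rewrite gee0_abs ?lee_fin ?mulr_ge0//.
  apply: (le_lt_trans (kernel_int2 j mk k0)); apply: lte_mul_pinfty => //.
  by rewrite lee_fin (le_trans _ (C_ge1 j)).
have mh j : measurable_fun setT (h j).
  by apply: measurable_funM => //; apply: measurable_funM; [exact: mfst|exact: msnd].
have mh' j : measurable_fun setT (h' j).
  by apply: measurable_funM => //; apply: measurable_funM; exact: mfst.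
have Kr j z (r : R) : (0 <= K j z.1 z.2 * r ^+ 2)%R by rewrite mulr_ge0// sqr_ge0.
have ih j : mm.-integrable setT (fun z => (h j z)%:E).
  apply: (@le_integrable _ _ _ _ _ measurableT _
    (fun z => (K j z.1 z.2 * F z.1 ^+ 2)%:E + (K j z.1 z.2 * g z.2 ^+ 2)%:E)).
  - exact/measurable_EFinP.
  - move=> z _; rewrite -EFinD lee_fin [leRHS]ger0_norm ?addr_ge0 ?Kr//.
    rewrite /h normrM ger0_norm// -mulrDr ler_wpM2l// normrM.
    rewrite -(real_normK (num_real (F z.1))) -(real_normK (num_real (g z.2))); nra.
  - exact: (integrableD measurableT (iK1 j _ mF2 F20 F2) (iK2 j _ mg2 g20 g2)).
have ih' j : mm.-integrable setT (fun z => (h' j z)%:E).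
  apply: (@le_integrable _ _ _ _ _ measurableT _
    (fun z => (K j z.1 z.2 * F z.1 ^+ 2)%:E + (K j z.1 z.2 * g z.1 ^+ 2)%:E)).
  - exact/measurable_EFinP.
  - move=> z _; rewrite -EFinD lee_fin [leRHS]ger0_norm ?addr_ge0 ?Kr//.
    rewrite /h' normrM ger0_norm// -mulrDr ler_wpM2l// normrM.
    rewrite -(real_normK (num_real (F z.1))) -(real_normK (num_real (g z.1))); nra.
  - exact: (integrableD measurableT (iK1 j _ mF2 F20 F2) (iK1 j _ mg2 g20 g2)).
have KD j x (k : T -> R) :
    \int[mu]_y (K j x y * k y)%:E = \int[mu]_(y in D) (K j x y * k y)%:E.
  rewrite [RHS]integral_mkcond; apply: eq_integral => y _; rewrite patchE.
  case: ifPn => // yD; have [M /(_ x y)] := K_bounded j.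
  rewrite indicE (negbTE yD) mulr0 => K0.
  by rewrite (_ : K j x y = 0%R) ?mul0r//; apply/eqP; rewrite eq_le K0 K_ge0.
have ig := sqr_integrable mD muD (measurable_funTS mg) g2.
have iKg j x : mu.-integrable D (fun y => (K j x y * g y)%:E).
  have [M KM] := K_bounded j.
  apply: (@le_integrable _ _ _ _ _ mD _ (fun y => M%:E * (g y)%:E)).
  - apply/measurable_EFinP; apply: measurable_funM; last exact: measurable_funTS.
    by apply: measurable_funTS; exact: (measurable_fun_pair2 x (mK j)).
  - move=> y Dy; rewrite lee_fin !normrM ler_wpM2r// ger0_norm//.
    by rewrite (le_trans (KM x y))// indicE mem_set// mulr1 ler_norm.
  - exact: integrableZl.
have hF j : fubini_F mu (fun z => (h j z)%:E) =
    (fun x => (F x * \int[mu]_(y in D) (K j x y * g y))%:E)%R \_ D.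
  apply/funext => x; rewrite /fubini_F patchE.
  case: ifPn => xD; last first.
    rewrite notin_setE in xD.
    by rewrite (eq_integral (cst 0)) ?integral0// => y _; rewrite /h/= K_supp ?mul0r.
  rewrite EFinM /Rintegral fineK; last exact: integrable_fin_num.
  rewrite -integralZl//.
  transitivity (\int[mu]_y (K j x y * (F x * g y))%:E) => //.
  rewrite (KD j x (fun y => F x * g y)%R).
  by apply: eq_integral => y _; rewrite -EFinM; congr (_%:E); ring.
have hE j : \int[mm]_z (h j z)%:E =
    \int[mu]_(x in D) (F x * \int[mu]_(y in D) (K j x y * g y))%:E.
  by rewrite -(integral12_prod_meas1 (ih j)) [RHS]integral_mkcond -hF.
have h'E j : \int[mm]_z (h' j z)%:E = \int[mu]_(x in D) (F x * g x)%:E.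
  rewrite -(integral12_prod_meas1 (ih' j)) [RHS]integral_mkcond.
  apply: eq_integral => x _; rewrite /fubini_F patchE.
  transitivity (\int[mu]_y ((F x * g x)%:E * (K j x y)%:E)).
    by apply: eq_integral => y _; rewrite /h'/= mulrC.
  rewrite integralZl//; last first.
    apply/integrableP; split; first exact: mKx.
    by under eq_integral do rewrite gee0_abs ?lee_fin//; rewrite K_mass ltry.
  by rewrite K_mass indicE; case: ifPn => _; rewrite ?mule1 ?mule0.
rewrite (_ : (\int[mu]_(x in D) (F x * g x))%R = fine (\int[mm]_z (h' 0%N z)%:E)); last first.
  by rewrite h'E.
split.
  by move=> j; apply/integrable_mkcond => //; rewrite -hF; exact: integrable_fubini_F.
apply/cvgrPdist_le => e e0.
pose N := (fine (\int[mu]_(x in D) (F x ^+ 2)%:E) + 1)%R.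
have NE : \int[mu]_(x in D) (F x ^+ 2)%:E <= N%:E.
  rewrite /N EFinD fineK ?leeDl// ge0_fin_numE//.
  by apply: integral_ge0 => x _; rewrite lee_fin.
have N0 : (0 < N)%R.
  rewrite ltr_wpDl// fine_ge0//.
  by apply: integral_ge0 => x _; rewrite lee_fin.
(* The Young parameter: [l / 2] times the bound [N] gives e / 2, and [l^-1 / 2] times the bound
   [e * l] on [Q j g] gives the other half. *)
pose l := (e / N)%R.
have l0 : (0 < l)%R by rewrite divr_gt0.
near=> j.
have Qj : Q j g <= (e * l)%:E.
  by near: j; apply: Qsmall_L2 => //; rewrite mulr_gt0.
rewrite -lee_fin.
have -> : (\int[mu]_(x in D) (F x * \int[mu]_(y in D) (K j x y * g y)))%R =
    fine (\int[mm]_z (h j z)%:E) by rewrite hE.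
rewrite h'E -(h'E j) -fineB; [|exact: integrable_fin_num|exact: integrable_fin_num].
rewrite -integralB//=.
have ihh : mm.-integrable setT (fun z => (h' j z)%:E - (h j z)%:E) by exact: integrableB.
rewrite -abse_EFin fineK; last exact: integrable_fin_num.
apply: le_trans (le_abse_integral _ _ _) _ => //.
  by case/integrableP : ihh.
apply: (@le_trans _ _ (\int[mm]_z ((l / 2)%:E * (K j z.1 z.2 * F z.1 ^+ 2)%:E +
   (l^-1 / 2)%:E * (K j z.1 z.2 * (g z.1 - g z.2) ^+ 2)%:E))).
  apply: ge0_le_integral => //.
  - by apply: measurableT_comp => //; case/integrableP : ihh.
  - apply: emeasurable_funD; apply: measurable_funeM; apply/measurable_EFinP.
      by apply: measurable_funM => //; exact: (mfst mF2).
    exact: mQ.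
  - move=> z _; rewrite -EFinB abse_EFin -!EFinM -EFinD lee_fin.
    rewrite /h /h' -mulrBr -mulrBr normrM ger0_norm//.
    rewrite [leRHS](_ : _ = K j z.1 z.2 * (l / 2 * F z.1 ^+ 2 + l^-1 / 2 * (g z.1 - g z.2) ^+ 2))%R; last by ring.
    apply: ler_wpM2l => //; rewrite normrM.
    rewrite -(real_normK (num_real (F z.1))) -(real_normK (num_real (g z.1 - g z.2)%R)).
    set a := `|F z.1|%R; set c := `|g z.1 - g z.2|%R.
    rewrite -subr_ge0 (_ : _ - _ = (l * a - c) ^+ 2 / (2 * l))%R; last by field; rewrite gt_eqF.
    by rewrite divr_ge0// ?sqr_ge0// mulr_ge0// ltW.
rewrite ge0_integralD//; last 4 first.
- by move=> z _; rewrite mule_ge0// lee_fin ?Kr// divr_ge0// ltW.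
- by apply: measurable_funeM; apply/measurable_EFinP; apply: measurable_funM => //; exact: (mfst mF2).
- by move=> z _; rewrite mule_ge0// lee_fin ?Kr// divr_ge0// invr_ge0 ltW.
- by apply: measurable_funeM; apply/measurable_EFinP; exact: mQ.
rewrite !ge0_integralZl_EFin//; last 6 first.
- by move=> z _; rewrite lee_fin Kr.
- by apply/measurable_EFinP; exact: mQ.
- by rewrite divr_ge0// invr_ge0 ltW.
- by move=> z _; rewrite lee_fin Kr.
- by apply/measurable_EFinP; apply: measurable_funM => //; exact: (mfst mF2).
- by rewrite divr_ge0// ltW.
rewrite (kernel_int1 j mF2 F20) -/(Q j g).
apply: (@le_trans _ _ ((l / 2)%:E * N%:E + (l^-1 / 2)%:E * (e * l)%:E)).
  by apply: leeD; apply: lee_wpmul2l => //; rewrite lee_fin divr_ge0// ?invr_ge0 ltW.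
rewrite -!EFinM -EFinD lee_fin le_eqVlt; apply/orP; left; apply/eqP.
by rewrite /l; field; rewrite !gt_eqF.
Unshelve. all: by end_near. Qed.

End approximate_identity.

(** * Euclidean norm and directional derivatives *)

Section euclid.
Context (R : realType) (n : nat).
Implicit Types (x y z v : 'rV[R]_n).

Lemma dotpC x y : dotp x y = dotp y x.
Proof. by apply: eq_bigr => i _; rewrite mulrC. Qed.

Lemma dotpDl x y z : dotp (x + y) z = dotp x z + dotp y z.
Proof. by rewrite -big_split/=; apply: eq_bigr => i _; rewrite mxE mulrDl. Qed.

Lemma dotpZl c x z : dotp (c *: x) z = c * dotp x z.
Proof. by rewrite mulr_sumr; apply: eq_bigr => i _; rewrite mxE mulrA. Qed.

Lemma dotpDr x y z : dotp z (x + y) = dotp z x + dotp z y.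
Proof. by rewrite dotpC dotpDl !(dotpC z). Qed.

Lemma dotpZr c x z : dotp z (c *: x) = c * dotp z x.
Proof. by rewrite dotpC dotpZl (dotpC z). Qed.

Lemma dotpNl x z : dotp (- x) z = - dotp x z.
Proof. by rewrite -scaleN1r dotpZl mulN1r. Qed.

Lemma dotpNr x z : dotp z (- x) = - dotp z x.
Proof. by rewrite dotpC dotpNl dotpC. Qed.

Lemma dotp_ge0 x : 0 <= dotp x x.
Proof. by apply: sumr_ge0 => i _; rewrite -expr2 sqr_ge0. Qed.

Lemma enorm_ge0 x : 0 <= enorm x. Proof. exact: sqrtr_ge0. Qed.

Lemma enorm_sqr x : enorm x ^+ 2 = dotp x x.
Proof. by rewrite sqr_sqrtr// dotp_ge0. Qed.

Lemma dotp_quad x v t :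
  dotp (x + t *: v) (x + t *: v) = dotp x x + 2 * t * dotp x v + t ^+ 2 * dotp v v.
Proof. by rewrite dotpDl !dotpDr !dotpZl !dotpZr (dotpC v x); ring. Qed.

Lemma dotp_le x y : `|dotp x y| <= enorm x * enorm y.
Proof.
rewrite -ler_sqr ?nnegrE ?mulr_ge0 ?enorm_ge0// exprMn !enorm_sqr real_normK ?num_real//.
have [y0|y0] := eqVneq (dotp y y) 0.
  have yi i : y ord0 i = 0.
    apply/eqP; rewrite -sqrf_eq0 expr2; apply/eqP.
    by apply: (psumr_eq0P _ y0) => // j _; rewrite -expr2 sqr_ge0.
  rewrite (_ : dotp x y = 0); first by rewrite expr0n mulr_ge0// dotp_ge0.
  by apply: big1 => i _; rewrite yi mulr0.
have yy0 : 0 < dotp y y by rewrite lt_neqAle eq_sym y0 dotp_ge0.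
(* The vector is [x] minus its orthogonal projection on [y]. *)
have := dotp_ge0 (x + (- (dotp x y / dotp y y)) *: y).
rewrite dotp_quad (_ : _ + _ = (dotp x x * dotp y y - dotp x y ^+ 2) / dotp y y); last by field.
by rewrite pmulr_lge0 ?invr_gt0// subr_ge0.
Qed.

Lemma enormD x y : enorm (x + y) <= enorm x + enorm y.
Proof.
rewrite -ler_sqr ?nnegrE ?addr_ge0 ?enorm_ge0// sqrrD !enorm_sqr.
rewrite dotpDl !dotpDr (dotpC y x).
by have := le_trans (ler_norm _) (dotp_le x y); lra.
Qed.

Lemma enormZ c x : enorm (c *: x) = `|c| * enorm x.
Proof. by rewrite /enorm dotpZl dotpZr mulrA -expr2 sqrtrM ?sqr_ge0// sqrtr_sqr. Qed.

Lemma enormN x : enorm (- x) = enorm x.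
Proof. by rewrite -scaleN1r enormZ normrN normr1 mul1r. Qed.

Lemma enormB x y : enorm (x - y) <= enorm x + enorm y.
Proof. by rewrite -[enorm y]enormN enormD. Qed.

Lemma enormBC x y : enorm (x - y) = enorm (y - x).
Proof. by rewrite -enormN opprB. Qed.

Lemma coord_le_enorm x i : `|x ord0 i| <= enorm x.
Proof.
rewrite -ler_sqr ?nnegrE ?enorm_ge0// enorm_sqr real_normK ?num_real// /dotp (bigD1 i)//=.
by rewrite -expr2 lerDl sumr_ge0// => j _; rewrite -expr2 sqr_ge0.
Qed.

Lemma enorm_le_sum x : enorm x <= \sum_(i < n) `|x ord0 i|.
Proof.
rewrite -ler_sqr ?nnegrE ?enorm_ge0 ?sumr_ge0// enorm_sqr.
rewrite expr2 mulr_suml; apply: ler_sum => i _.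
rewrite (le_trans (ler_norm _))// normrM ler_wpM2l//.
by rewrite (bigD1 i)//= lerDl sumr_ge0.
Qed.

Lemma dotp_evec x i : dotp x (evec R i) = x ord0 i.
Proof.
rewrite /dotp (bigD1 i)//= mxE !eqxx mulr1 big1 ?addr0// => j ji.
by rewrite mxE (negbTE ji) andbF mulr0.
Qed.

Lemma enorm_eq0 x : (enorm x == 0) = (x == 0).
Proof.
apply/eqP/eqP => [x0|->]; last by rewrite /enorm /dotp big1 ?sqrtr0// => i _; rewrite mxE mulr0.
apply/rowP => i; rewrite mxE; apply/eqP; rewrite -normr_le0.
by rewrite (le_trans (coord_le_enorm x i))// x0.
Qed.

Lemma measurable_fun_dotp d (T : measurableType d) (D : set T) (f g : T -> 'rV[R]_n) :
  (forall i, measurable_fun D (fun t => f t ord0 i)) ->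
  (forall i, measurable_fun D (fun t => g t ord0 i)) ->
  measurable_fun D (fun t => dotp (f t) (g t)).
Proof. by move=> mf mg; apply: measurable_sum => i; exact: measurable_funM. Qed.

Lemma measurable_enorm : measurable_fun [set: 'rV[R]_n] (@enorm R n).
Proof.
apply: (measurableT_comp (@continuous_measurable_fun R Num.sqrt (@sqrt_continuous R))).
by apply: measurable_fun_dotp => i; exact: measurable_coord.
Qed.

Lemma measurable_eball r : measurable (@eball R n r).
Proof.
rewrite (_ : eball _ = @enorm R n @^-1` `]-oo, r[%classic); last first.
  by apply/seteqP; split => x; rewrite /eball /= in_itv.
by rewrite -[X in measurable X]setTI; exact: measurable_enorm.
Qed.

(** The ambient topology is that of the sup norm; this is the comparison on which the continuity
    arguments in the Euclidean norm rest. *)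
Lemma near_enorm x (e : R) : 0 < e -> \forall y \near x, enorm (y - x) < e.
Proof.
(* Dividing by [n.+1] instead of [n] keeps the sum over [n] coordinates strictly below [e] and
   covers n = 0. *)
move=> e0; have en : 0 < e / n.+1%:R by rewrite divr_gt0.
have H : forall i, \forall y \near x, `|(y - x) ord0 i| < e / n.+1%:R.
  move=> i; have /cvgrPdist_lt/(_ _ en) := @coord_continuous R 1 n ord0 i x.
  by apply: filterS => y; rewrite !mxE distrC.
apply: filterS (filter_forall _ H) => y yx; apply: (le_lt_trans (enorm_le_sum _)).
apply: (@le_lt_trans _ _ (\sum_(i < n) e / n.+1%:R)).
  by apply: ler_sum => i _; rewrite ltW.
rewrite sumr_const card_ord -[X in X < _]mulr_natr mulrAC ltr_pdivrMr// ltr_pM2l// ltr_nat.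
exact: ltnSn.
Qed.

End euclid.

(** * Directional derivatives with a quadratic remainder *)

Section quad.
Context (R : realType) (V : normedModType R).
Implicit Types (f g : V -> R).

(* A quadratic remainder, unlike mere differentiability, is uniform in the
   integration variable, so it passes through the convolution integral. *)
Definition quad_at f (x v : V) (l : R) :=
  exists C : R, forall t : R, `|t| <= 1 -> `|f (x + t *: v) - f x - t * l| <= C * t ^+ 2.

Lemma quad_is_derive f x v l : quad_at f x v l -> is_derive x v f l.
Proof.
move=> [C fC].
suff H : h^-1 *: (f (h *: v + x) - f x) @[h --> 0^'] --> l.
  by apply: DeriveDef; [apply/cvg_ex; exists l|exact/cvg_lim].
apply/cvgrPdist_le => e e0.
near=> h.
have h0 : h != 0 by near: h; exact: nbhs_dnbhs_neq.
have hn0 : 0 < `|h| by rewrite normr_gt0.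
have h1 : `|h| <= 1.
  by near: h; exact: dnbhs0_le.
have he : `|h| <= e / (`|C| + 1).
  by near: h; apply: dnbhs0_le; rewrite divr_gt0// ltr_wpDl.
rewrite distrC -[h^-1 *: _]/(h^-1 * _) (addrC (h *: v)).
rewrite (_ : _ - l = h^-1 * (f (x + h *: v) - f x - h * l)); last by field.
rewrite normrM normfV ler_pdivrMl//.
apply: (le_trans (fC h h1)); rewrite -(real_normK (num_real h)) expr2 mulrCA ler_pM2l//.
apply: (@le_trans _ _ ((`|C| + 1) * `|h|)).
  by rewrite ler_wpM2r// (le_trans (ler_norm _))// lerDl.
by rewrite mulrC -ler_pdivlMr// ltr_wpDl.
Unshelve. all: by end_near. Qed.

Lemma quadD f g x v l m : quad_at f x v l -> quad_at g x v m ->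
  quad_at (fun y => f y + g y) x v (l + m).
Proof.
move=> [C fC] [D gD]; exists (C + D) => t t1.
rewrite (_ : _ - _ = (f (x + t *: v) - f x - t * l) + (g (x + t *: v) - g x - t * m)); last by ring.
by rewrite (le_trans (ler_normD _ _))// mulrDl lerD ?fC ?gD.
Qed.

Lemma quad_cst c x v : quad_at (fun=> c) x v 0.
Proof. by exists 0 => t _; rewrite subrr mulr0 subr0 normr0 mul0r. Qed.

Lemma quadZ c f x v l : quad_at f x v l -> quad_at (fun y => c * f y) x v (c * l).
Proof.
move=> [C fC]; exists (`|c| * C) => t t1.
rewrite (_ : _ - _ = c * (f (x + t *: v) - f x - t * l)); last by ring.
by rewrite normrM -mulrA ler_wpM2l// fC.
Qed.

Lemma quadM f g x v l m :
  quad_at f x v l -> quad_at g x v m ->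
  quad_at (fun y => f y * g y) x v (l * g x + f x * m).
Proof.
move=> [C fC] [D gD].
exists (`|C| * (`|g x| + `|m| + `|D|) + `|f x| * `|D| + `|l| * (`|m| + `|D|)) => t t1.
have tt : t ^+ 2 <= 1 by rewrite -(real_normK (num_real t)) expr_le1.
have t20 := sqr_ge0 t.
set F := f (x + t *: v); set G := g (x + t *: v).
have hF : `|F - f x - t * l| <= `|C| * t ^+ 2.
  by rewrite (le_trans (fC t t1))// ler_wpM2r// ler_norm.
have hG : `|G - g x - t * m| <= `|D| * t ^+ 2.
  by rewrite (le_trans (gD t t1))// ler_wpM2r// ler_norm.
have hG2 : `|G| <= `|g x| + `|m| + `|D|.
  rewrite (_ : G = g x + t * m + (G - g x - t * m)); last by ring.
  rewrite (le_trans (ler_normD _ _))// lerD//.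
    by rewrite (le_trans (ler_normD _ _))// lerD2l normrM ler_piMl.
  by rewrite (le_trans hG)// ler_piMr.
have hG3 : `|t * (G - g x)| <= (`|m| + `|D|) * t ^+ 2.
  rewrite (_ : t * _ = t ^+ 2 * m + t * (G - g x - t * m)); last by ring.
  rewrite (le_trans (ler_normD _ _))// [leRHS]mulrDl lerD//.
    by rewrite normrM (ger0_norm t20) mulrC.
  by rewrite normrM (le_trans _ hG)// ler_piMl.
(* The remainder of the product splits into the two given remainders and [l * (t * (G - g x))],
   which is of second order since [G - g x] is of first order. *)
rewrite (_ : _ - _ = (F - f x - t * l) * G + f x * (G - g x - t * m) +
   l * (t * (G - g x))); last by rewrite /F /G; ring.
rewrite (le_trans (ler_normD _ _))// [leRHS]mulrDl lerD//; last first.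
  by rewrite normrM -mulrA ler_wpM2l.
rewrite (le_trans (ler_normD _ _))// [leRHS]mulrDl lerD//; last first.
  by rewrite normrM -mulrA ler_wpM2l.
by rewrite normrM mulrAC ler_pM.
Qed.

End quad.

(** * The squared positive part *)

Section pos2.
Context (R : realType).

(** The building block of all bumps and cutoffs: it vanishes on a half-line, and its first-order
    Taylor remainder has a quadratic bound with the same constant at every point. It is only C^1, as
    the two classes of test functions ask. *)
Definition pos2 (s : R) : R := (Num.max 0 s) ^+ 2.

Lemma pos2_ge0 s : 0 <= pos2 s. Proof. exact: sqr_ge0. Qed.

Lemma pos2_le0 s : s <= 0 -> pos2 s = 0.
Proof. by move=> s0; rewrite /pos2 max_l// expr0n. Qed.

Lemma pos2_quad s d : `|pos2 (s + d) - pos2 s - d * (2 * Num.max 0 s)| <= d ^+ 2.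
Proof.
have d2 := sqr_ge0 d; have sd2 := sqr_ge0 (s + d).
rewrite /pos2 /Num.max ler_norml; case: (ltP 0 (s + d)) => sd; case: (ltP 0 s) => s0.
- by apply/andP; split; lra.
- have h1 : 0 <= - s * (s + d) by rewrite mulr_ge0 ?oppr_ge0// ltW.
  have h2 : 0 <= - s * d by rewrite mulr_ge0 ?oppr_ge0//; lra.
  by apply/andP; split; lra.
- have h1 : 0 <= s * - (s + d) by rewrite mulr_ge0 ?oppr_ge0// ltW.
  have h2 : 0 <= s * - d by rewrite mulr_ge0 ?oppr_ge0// ?ltW//; lra.
  by apply/andP; split; lra.
- by rewrite expr0n/=; apply/andP; split; lra.
Qed.

Lemma max0_lip (s t : R) : `|Num.max 0 s - Num.max 0 t| <= `|s - t|.
Proof.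
have h1 := ler_norm (s - t); have h2 := ler_norm (t - s); rewrite (distrC t s) in h2.
have h3 := normr_ge0 (s - t).
by rewrite /Num.max; case: (ltP 0 s) => s0; case: (ltP 0 t) => t0;
  rewrite ler_norml; apply/andP; split; lra.
Qed.

Lemma pos2_lip (M s t : R) : s <= M -> t <= M -> 0 <= M ->
  `|pos2 s - pos2 t| <= 2 * M * `|s - t|.
Proof.
move=> sM tM M0; rewrite /pos2 subr_sqr normrM mulrC.
apply: ler_pM => //; last exact: max0_lip.
rewrite ger0_norm ?addr_ge0 ?le_max ?lexx//.
have -> : 2 * M = M + M by ring.
by apply: lerD; rewrite ge_max M0.
Qed.

Lemma quad_pos2 (V : normedModType R) (f : V -> R) x v l : quad_at f x v l ->
  quad_at (pos2 \o f) x v (2 * Num.max 0 (f x) * l).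
Proof.
move=> [C fC]; pose A := `|l| + `|C|.
exists (A ^+ 2 + 2 * Num.max 0 (f x) * `|C|) => t t1 /=.
set d := f (x + t *: v) - f x.
have -> : f (x + t *: v) = f x + d by rewrite /d [RHS]addrC subrK.
have m0 : 0 <= Num.max 0 (f x) by rewrite le_max lexx.
have fCt : `|d - t * l| <= `|C| * t ^+ 2.
  by apply: (le_trans (fC t t1)); rewrite ler_wpM2r ?sqr_ge0// ler_norm.
have dA : `|d| <= A * `|t|.
  rewrite -(subrK (t * l) d) (le_trans (ler_normD _ _))// /A addrC mulrDl lerD//.
    by rewrite normrM mulrC.
  apply: (le_trans fCt); rewrite ler_wpM2l// -(real_normK (num_real t)) expr2.
  by rewrite ler_piMl.
rewrite (_ : _ - _ = (pos2 (f x + d) - pos2 (f x) - d * (2 * Num.max 0 (f x))) +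
   2 * Num.max 0 (f x) * (d - t * l)); last by ring.
rewrite (le_trans (ler_normD _ _))// [leRHS]mulrDl lerD//.
  rewrite (le_trans (pos2_quad _ _))// -(real_normK (num_real d)) -(real_normK (num_real t)) -exprMn.
  by rewrite ler_sqr ?nnegrE// mulr_ge0// addr_ge0.
by rewrite normrM (@ger0_norm _ (2 * _)) ?mulr_ge0// -[leRHS]mulrA ler_wpM2l// mulr_ge0.
Qed.

End pos2.

(** * Mollification on a ball *)

Section bump.
Context (R : realType) (n : nat).
Implicit Types (x y z v : 'rV[R]_n).
Local Notation mu := (lebesgue_rV R n).

(** For h > 0, a radial C^1 bump supported in the closed ball of radius [h]. It is left
    unnormalised; [moll] divides by its mass. *)
Definition bump (h : R) y : R := pos2 (h ^+ 2 - dotp y y).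

Definition dbump (h : R) v y : R := - 4 * (Num.max 0 (h ^+ 2 - dotp y y) * dotp y v).

Lemma bump_ge0 h y : 0 <= bump h y. Proof. exact: pos2_ge0. Qed.

Lemma bump_le h y : bump h y <= (h ^+ 2) ^+ 2.
Proof.
rewrite /bump /pos2 ler_sqr ?nnegrE ?sqr_ge0// ?le_max ?lexx//.
by rewrite ge_max sqr_ge0/= lerBlDr lerDl dotp_ge0.
Qed.

Lemma bumpN h y : bump h (- y) = bump h y.
Proof. by rewrite /bump dotpNl dotpNr opprK. Qed.

Lemma bump_neq0 h y : 0 < h -> bump h y != 0 -> enorm y < h.
Proof.
move=> h0; apply: contra_neqT; rewrite -leNgt => hy; apply: pos2_le0.
by rewrite subr_le0 -enorm_sqr ler_sqr ?nnegrE ?enorm_ge0// ltW.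
Qed.

Lemma max0_sqr_le h y : `|Num.max 0 (h ^+ 2 - dotp y y)| <= h ^+ 2.
Proof.
rewrite ger0_norm ?le_max ?lexx// ge_max sqr_ge0/=.
by rewrite lerBlDr lerDl dotp_ge0.
Qed.

(** The constant is the same for all [y] in the ball of radius [rho]; this uniformity lets the
    remainder be integrated in [conv_bump_quad]. *)
Lemma bump_quad h v rho : exists C : R, forall y t, enorm y <= rho -> `|t| <= 1 ->
  `|bump h (y + t *: v) - bump h y - t * dbump h v y| <= C * t ^+ 2.
Proof.
(* [A] times |t| bounds the increment [d] of h^2 - |y|^2 along the line. The other summand of the
   constant comes from the t^2 term of that increment, which is not part of the derivative. *)
pose A := 2 * (rho * enorm v) + dotp v v.
exists (A ^+ 2 + 2 * h ^+ 2 * dotp v v) => y t yr t1.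
have v0 := dotp_ge0 v.
have ryv : `|dotp y v| <= rho * enorm v.
  by rewrite (le_trans (dotp_le y v))// ler_wpM2r// enorm_ge0.
pose d := - (2 * t * dotp y v + t ^+ 2 * dotp v v).
have t2 : t ^+ 2 = `|t| ^+ 2 by rewrite real_normK// num_real.
rewrite /bump dotp_quad.
rewrite (_ : h ^+ 2 - _ = (h ^+ 2 - dotp y y) + d); last by rewrite /d; ring.
rewrite (_ : _ - _ = (pos2 (h ^+ 2 - dotp y y + d) - pos2 (h ^+ 2 - dotp y y) -
     d * (2 * Num.max 0 (h ^+ 2 - dotp y y))) -
   2 * t ^+ 2 * dotp v v * Num.max 0 (h ^+ 2 - dotp y y)); last first.
  by rewrite /dbump /d; ring.
rewrite (le_trans (ler_normB _ _))// [leRHS]mulrDl lerD//.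
  rewrite (le_trans (pos2_quad _ _))// -(real_normK (num_real d)) t2 -exprMn.
  have A0 : 0 <= A by rewrite addr_ge0// mulr_ge0// (le_trans _ ryv).
  rewrite ler_sqr ?nnegrE ?mulr_ge0//.
  rewrite /d normrN (le_trans (ler_normD _ _))// /A [leRHS]mulrDl lerD//.
    rewrite !normrM ger0_norm// (_ : 2 * (rho * _) * _ = 2 * `|t| * (rho * enorm v)); last by ring.
    by rewrite ler_wpM2l// mulr_ge0.
  rewrite normrM (ger0_norm v0) mulrC ler_wpM2l// t2 normrX normr_id expr2.
  by rewrite ler_piMl.
rewrite normrM ger0_norm; last by rewrite mulr_ge0// mulr_ge0// sqr_ge0.
rewrite (_ : 2 * h ^+ 2 * dotp v v * t ^+ 2 = 2 * t ^+ 2 * dotp v v * h ^+ 2); last by ring.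
by rewrite ler_wpM2l ?max0_sqr_le// mulr_ge0// mulr_ge0// sqr_ge0.
Qed.

Lemma bump_quad_at h x v : quad_at (bump h) x v (dbump h v x).
Proof. by have [C hC] := bump_quad h v (enorm x); exists C => t t1; exact: hC. Qed.

Definition loc_lipschitz (k : 'rV[R]_n -> R) := forall rho, exists L : R, forall y z,
  enorm y <= rho -> enorm z <= rho -> `|k y - k z| <= L * enorm (y - z).

Lemma dotp_lip rho y z : enorm y <= rho -> enorm z <= rho ->
  `|dotp y y - dotp z z| <= 2 * rho * enorm (y - z).
Proof.
move=> yr zr; have -> : dotp y y - dotp z z = dotp (y - z) (y + z).
  by rewrite dotpDl !dotpDr !dotpNl (dotpC z y); ring.
rewrite (le_trans (dotp_le _ _))// mulrC ler_wpM2r ?enorm_ge0//.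
by rewrite (le_trans (enormD _ _))//; lra.
Qed.

Lemma bump_lip h : loc_lipschitz (bump h).
Proof.
move=> rho; exists (2 * h ^+ 2 * (2 * rho)) => y z yr zr.
rewrite /bump (le_trans (pos2_lip (M := h ^+ 2) _ _ _)) ?sqr_ge0//.
- by rewrite lerBlDr lerDl dotp_ge0.
- by rewrite lerBlDr lerDl dotp_ge0.
rewrite -[leRHS]mulrA ler_wpM2l//; first by apply: mulr_ge0 => //; exact: sqr_ge0.
rewrite (_ : _ - _ = - (dotp y y - dotp z z)); last by ring.
by rewrite normrN dotp_lip.
Qed.

Lemma dbump_lip h v : loc_lipschitz (dbump h v).
Proof.
move=> rho; exists (4 * (2 * rho * (rho * enorm v) + h ^+ 2 * enorm v)) => y z yr zr.
rewrite /dbump -mulrBr normrM normrN (@ger0_norm _ 4)// -[leRHS]mulrA ler_wpM2l//.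
set a := Num.max _ _; set b := Num.max _ _.
rewrite (_ : _ - _ = (a - b) * dotp y v + b * dotp (y - z) v); last first.
  by rewrite dotpDl dotpNl; ring.
rewrite (le_trans (ler_normD _ _))// [leRHS]mulrDl lerD// normrM.
  rewrite mulrAC; apply: ler_pM => //.
    rewrite (le_trans (max0_lip _ _))//.
    rewrite (_ : _ - _ = - (dotp y y - dotp z z)); last by ring.
    by rewrite normrN dotp_lip.
  by rewrite (le_trans (dotp_le _ _))// ler_wpM2r// enorm_ge0.
rewrite -[leRHS]mulrA; apply: ler_pM => //; first exact: max0_sqr_le.
by rewrite mulrC dotp_le.
Qed.

Lemma loc_lipschitz_bounded (k : 'rV[R]_n -> R) : loc_lipschitz k ->
  forall rho, exists M : R, forall y, enorm y <= rho -> `|k y| <= M.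
Proof.
move=> lk rho; have [L kL] := lk rho; exists (`|k 0| + `|L| * rho) => y yr.
have rho0 : 0 <= rho by rewrite (le_trans (enorm_ge0 y)).
have e0 : enorm (0 : 'rV[R]_n) = 0 by apply/eqP; rewrite enorm_eq0.
rewrite -(subrK (k 0) (k y)) (le_trans (ler_normD _ _))// addrC lerD//.
have := kL y 0 yr; rewrite e0 subr0 => /(_ rho0) /le_trans; apply.
by apply: (@le_trans _ _ (`|L| * enorm y)); rewrite ?ler_wpM2r ?enorm_ge0 ?ler_norm ?ler_wpM2l.
Qed.

Lemma measurable_dotp2 d (T : measurableType d) (g : T -> 'rV[R]_n) :
  measurable_fun setT g -> measurable_fun setT (fun t => dotp (g t) (g t)).
Proof.
by move=> mg; apply: measurable_fun_dotp => i; exact: (measurableT_comp (measurable_coord i) mg).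
Qed.

Lemma measurable_max0 d (T : measurableType d) (g : T -> R) (h : R) :
  measurable_fun setT g -> measurable_fun setT (fun t => Num.max 0 (h - g t)).
Proof.
by move=> mg; apply: measurable_maxr => //; exact: measurable_funB.
Qed.

Lemma measurable_bump h : measurable_fun setT (bump h).
Proof. by apply: measurable_funX; apply: measurable_max0; exact: measurable_dotp2. Qed.

Lemma measurable_dbump h v : measurable_fun setT (dbump h v).
Proof.
apply: measurable_funM => //; apply: measurable_funM.
  by apply: measurable_max0; exact: measurable_dotp2.
by apply: measurable_fun_dotp => // i; exact: measurable_coord.
Qed.

Lemma box_cube_lty (M : R) : (mu (box (fun=> `[(- M)%R, M]%classic)) < +oo)%E.
Proof.
rewrite lebesgue_rV_box// ltey_eq; apply/orP; left.
apply: (big_ind (fun x : \bar R => x \is a fin_num)) => //; first by move=> x y; exact: fin_numM.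
by move=> i _; rewrite lebesgue_measure_itv/=; case: ifP.
Qed.

Lemma eball_lty r : (mu (eball r) < +oo)%E.
Proof.
apply: le_lt_trans (box_cube_lty r).
apply: le_measure; rewrite ?inE; [exact: measurable_eball|exact: measurable_box|].
move=> x xr i; rewrite /= in_itv/= -ler_norml.
by rewrite (le_trans (coord_le_enorm x i))// ltW.
Qed.

Definition bump_mass h : R := fine (\int[mu]_x (bump h x)%:E).

Lemma bump_massE h : 0 < h -> (\int[mu]_x (bump h x)%:E)%E = (bump_mass h)%:E.
Proof.
move=> h0; rewrite /bump_mass fineK// ge0_fin_numE; last first.
  by apply: integral_ge0 => x _; rewrite lee_fin bump_ge0.
rewrite (_ : (fun x => (bump h x)%:E) = ((EFin \o bump h) \_ (eball h))); last first.
  apply/funext => x; rewrite patchE; case: ifPn => // xh.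
  rewrite notin_setE in xh; apply/eqP; rewrite eqe; apply: contra_notT xh => x0.
  exact: bump_neq0.
rewrite -integral_mkcond.
apply: (@le_lt_trans _ _ (\int[mu]_(x in eball h) ((h ^+ 2) ^+ 2)%:E)%E).
  apply: ge0_le_integral => //.
  - exact: measurable_eball.
  - by move=> x _; rewrite lee_fin bump_ge0.
  - by apply/measurable_EFinP; apply: measurable_funTS; exact: measurable_bump.
  - by move=> x _; rewrite lee_fin bump_le.
rewrite integral_cst; last exact: measurable_eball.
by rewrite lte_mul_pinfty// ?lee_fin ?sqr_ge0// eball_lty.
Qed.

Lemma bump_mass_gt0 h : 0 < h -> 0 < bump_mass h.
Proof.
move=> h0; rewrite -lte_fin -bump_massE//.
(* The cube of half-side [e] lies in the ball of radius h / 2, where the bump is at least (h^2 /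
   2)^2; its volume (2e)^n is positive, also for n = 0. *)
pose e := h / (2 * n.+1%:R).
have e0 : 0 < e by rewrite divr_gt0// mulr_gt0.
pose Q := box (fun=> `[(- e)%R, e]%classic) : set 'rV[R]_n.
have mQ : measurable Q by exact: measurable_box.
have Qh x : Q x -> (h ^+ 2 / 2) ^+ 2 <= bump h x.
  move=> Qx; rewrite /bump /pos2 ler_sqr ?nnegrE ?le_max ?lexx//; last first.
    by rewrite divr_ge0// sqr_ge0.
  apply/orP; right; rewrite -enorm_sqr.
  have : enorm x <= h / 2.
    rewrite (le_trans (enorm_le_sum x))//.
    apply: (@le_trans _ _ (\sum_(i < n) e)).
      by apply: ler_sum => i _; rewrite ler_norml; have := Qx i; rewrite /= in_itv.
    rewrite sumr_const card_ord -[leLHS]mulr_natr /e.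
    rewrite (_ : _ * _ = h / 2 * (n%:R / n.+1%:R)); last by field.
    by rewrite ler_piMr ?divr_ge0 1?ltW// ltr_pdivrMr// mul1r ltr_nat.
  by have := enorm_ge0 x; nra.
apply: (@lt_le_trans _ _ (\int[mu]_(x in Q) ((h ^+ 2 / 2) ^+ 2)%:E)%E).
  rewrite integral_cst// mule_gt0//.
    by rewrite lte_fin exprn_gt0// divr_gt0// exprn_gt0.
  rewrite [X in (_ < X)%E](_ : _ = \prod_(i < n) lebesgue_measure (`[(- e)%R, e]%classic : set R))%E; last first.
    by apply: (lebesgue_rV_box (A := fun=> `[(- e)%R, e]%classic)) => i.
  rewrite (eq_bigr (fun=> (2 * e)%:E)).
    by rewrite -(big_morph EFin (@EFinM R) erefl) lte_fin prodr_gt0// => i _; rewrite mulr_gt0.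
  move=> i _; rewrite lebesgue_measure_itv/= lte_fin ifT; last by lra.
  by rewrite -EFinB; congr (_%:E); ring.
apply: (@le_trans _ _ (\int[mu]_(x in Q) (bump h x)%:E)%E).
  apply: ge0_le_integral => //.
  - by move=> x _; rewrite lee_fin sqr_ge0.
  - by apply/measurable_EFinP; apply: measurable_funTS; exact: measurable_bump.
apply: ge0_subset_integral => //.
- by apply/measurable_EFinP; exact: measurable_bump.
- by move=> x _; rewrite lee_fin bump_ge0.
Qed.

End bump.

(** * Convolution on a ball, evaluated at dilated points *)

Section conv.
Context (R : realType) (n : nat) (r : R).
Implicit Types (x y z v : 'rV[R]_n) (g k : 'rV[R]_n -> R).
Local Notation mu := (lebesgue_rV R n).
Local Notation B := (@eball R n r).

Let mB : measurable B := measurable_eball r.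

Definition conv k (s : R) g x : R := \int[mu]_(y in B) (k (s *: x - y) * g y).

Lemma measurable_shift k s x : measurable_fun setT k ->
  measurable_fun setT (fun y => k (s *: x - y)).
Proof.
move=> mk; apply: (measurableT_comp mk); apply: measurable_fun_rV => i.
rewrite [X in measurable_fun _ X](_ : _ = fun y => s * x ord0 i - y ord0 i); last first.
  by apply/funext => y; rewrite !mxE.
by apply: measurable_funB => //; exact: measurable_coord.
Qed.

Lemma bounded_integrable k g (M : R) : measurable_fun setT k ->
  (forall y, B y -> `|k y| <= M) ->
  mu.-integrable B (EFin \o g) -> mu.-integrable B (EFin \o (fun y => k y * g y)).
Proof.
move=> mk kM ig.
apply: (@le_integrable _ _ _ _ _ mB _ (fun y => M%:E * (g y)%:E)%E).
- apply/measurable_EFinP; apply: measurable_funM; first exact: measurable_funTS.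
  by case/integrableP : ig => /measurable_EFinP.
- move=> y By; rewrite lee_fin !normrM ler_wpM2r// (le_trans (kM y By))//.
  exact: ler_norm.
- exact: integrableZl.
Qed.

Lemma enorm_shift_le s x y : `|s| <= 1 -> B y -> enorm (s *: x - y) <= enorm x + r.
Proof.
move=> s1 By; rewrite (le_trans (enormB _ _))// lerD//; last exact: ltW.
by rewrite enormZ ler_piMl// enorm_ge0.
Qed.

Lemma conv_integrable k s g x : measurable_fun setT k -> loc_lipschitz k -> `|s| <= 1 ->
  mu.-integrable B (EFin \o g) ->
  mu.-integrable B (EFin \o (fun y => k (s *: x - y) * g y)).
Proof.
move=> mk lk s1 ig.
have [M kM] := loc_lipschitz_bounded lk (enorm x + r).
apply: (@bounded_integrable _ _ M) => //; first exact: measurable_shift.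
by move=> y By; apply: kM; exact: enorm_shift_le.
Qed.

Lemma Rintegral_norm_le k g (M : R) : measurable_fun setT k ->
  (forall y, B y -> `|k y| <= M) -> mu.-integrable B (EFin \o g) ->
  `|\int[mu]_(y in B) (k y * g y)| <= M * \int[mu]_(y in B) `|g y|.
Proof.
move=> mk kM ig.
have ikg := bounded_integrable mk kM ig.
rewrite (le_trans (le_normr_Rintegral mB ikg))// -RintegralZl//; last exact: integrable_norm.
apply: le_Rintegral => //.
- exact: integrable_norm.
- by apply: (@bounded_integrable (cst M) _ `|M|) => //; exact: integrable_norm.
- by move=> y By; rewrite normrM ler_wpM2r// kM.
Qed.

Lemma conv_continuous k s g : measurable_fun setT k -> loc_lipschitz k -> `|s| <= 1 ->
  mu.-integrable B (EFin \o g) -> continuous (conv k s g).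
Proof.
move=> mk lk s1 ig x.
apply/(@cvgrPdist_le _ _ _ _ (nbhs_filter x)) => e e0.
have [L kL] := lk (enorm x + 1 + r).
pose I := \int[mu]_(y in B) `|g y|.
have I0 : 0 <= I by apply: Rintegral_ge0.
pose A := `|L| * I + 1.
have A0 : 0 < A by rewrite ltr_wpDl// mulr_ge0.
near=> z.
have zx1 : enorm (z - x) < 1 by near: z; exact: near_enorm.
have zxe : enorm (z - x) < e / A by near: z; apply: near_enorm; rewrite divr_gt0.
rewrite /conv -RintegralB//; [|exact: conv_integrable..].
under eq_Rintegral do rewrite -mulrBl.
apply: (@le_trans _ _ (`|L| * enorm (x - z) * I)).
  apply: Rintegral_norm_le => //.
    by apply: measurable_funB; exact: measurable_shift.
  move=> y By.
  apply: (@le_trans _ _ (L * enorm (s *: x - y - (s *: z - y)))).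
    apply: kL; rewrite (le_trans (enorm_shift_le _ _ By))// lerD2r ?lerDl//.
    rewrite -[z](subrK x) addrC (le_trans (enormD _ _))// lerD2l//.
    by rewrite ltW.
  rewrite (_ : s *: x - y - _ = s *: (x - z)); last by rewrite scalerBr opprB addrA subrK.
  rewrite enormZ; apply: (@le_trans _ _ (`|L| * (`|s| * enorm (x - z)))).
    by rewrite ler_wpM2r ?ler_norm// mulr_ge0// enorm_ge0.
  by rewrite ler_wpM2l// ler_piMl// enorm_ge0.
rewrite enormBC mulrAC; apply: (@le_trans _ _ (A * enorm (z - x))).
  by rewrite ler_wpM2r ?enorm_ge0// lerDl.
by rewrite mulrC -ler_pdivlMr// ltW.
Unshelve. all: by end_near. Qed.

(** Moving [x] by [t *: v] moves the argument of the bump by [t *: (s *: v)], whence the factor [s].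
    Integrating the uniform remainder of [bump_quad] against |g| differentiates under the integral
    sign. *)
Lemma conv_bump_quad h s g x v : `|s| <= 1 -> mu.-integrable B (EFin \o g) ->
  quad_at (conv (bump h) s g) x v (s * conv (dbump h v) s g x).
Proof.
move=> s1 ig; have [C hC] := bump_quad h (s *: v) (enorm x + r).
exists (C * \int[mu]_(y in B) `|g y|) => t t1.
have mbs z : measurable_fun setT (fun y => bump h (s *: z - y)).
  exact: measurable_shift (measurable_bump h).
have mds : measurable_fun setT (fun y => dbump h v (s *: x - y)).
  exact: measurable_shift (measurable_dbump h v).
have ib z : mu.-integrable B (EFin \o (fun y => bump h (s *: z - y) * g y)).
  by apply: conv_integrable => //; [exact: measurable_bump|exact: bump_lip].
have id : mu.-integrable B (EFin \o (fun y => dbump h v (s *: x - y) * g y)).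
  by apply: conv_integrable => //; [exact: measurable_dbump|exact: dbump_lip].
have itd : mu.-integrable B (EFin \o (fun y => t * s * (dbump h v (s *: x - y) * g y))).
  exact: (@bounded_integrable (cst (t * s)) _ `|t * s|).
rewrite /conv mulrA -RintegralZl// -!RintegralB//; last first.
  by apply: (@eq_integrable _ _ _ _ _ mB _ _ _ (integrableB mB (ib (x + t *: v)) (ib x))) => y _.
rewrite mulrAC.
under eq_Rintegral do rewrite mulrA -!mulrBl.
apply: Rintegral_norm_le => //.
  by apply: measurable_funB; [exact: measurable_funB|exact: measurable_funM].
move=> y By.
rewrite (_ : s *: (x + t *: v) - y = (s *: x - y) + t *: (s *: v)); last first.
  by rewrite scalerDr !scalerA (mulrC s t) addrAC.
rewrite (_ : t * s * dbump h v (s *: x - y) = t * dbump h (s *: v) (s *: x - y)); last first.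
  by rewrite /dbump dotpZr; ring.
by apply: hC => //; exact: enorm_shift_le.
Qed.

End conv.

Section mollifier.
Context (R : realType) (n : nat) (r : R) (r0 : 0 < r).
Implicit Types (x y z v : 'rV[R]_n) (g : 'rV[R]_n -> R).
Local Notation mu := (lebesgue_rV R n).
Local Notation B := (@eball R n r).

Let mB : measurable B := measurable_eball r.

(** Starting at 1/4 keeps [dil] at least 1/2, so the dilation at most halves the norm of a point. *)
Definition step (j : nat) : R := (j.+4)%:R^-1.

Let step_gt0 j : 0 < step j. Proof. by rewrite invr_gt0. Qed.

Let step_le j : step j <= 4^-1.
Proof. by rewrite lef_pV2 ?posrE// ler_nat. Qed.

Lemma step_cvg0 : step j @[j --> \oo] --> (0 : R).
Proof.
have := @cvg_harmonic R; rewrite -(cvg_shiftn 3).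
by apply: cvg_trans; apply: near_eq_cvg; near=> j; rewrite /step /= addn3.
Unshelve. all: by end_near. Qed.

(** The relative shrinking is twice the relative width: for |x| <= r, the support around
    [dil j *: x] stays within radius r (1 - step j) < r. *)
Definition dil j : R := 1 - 2 * step j.

Definition width j : R := r * step j.

Lemma width_gt0 j : 0 < width j. Proof. exact: mulr_gt0. Qed.

Lemma dil_gt0 j : 0 < dil j.
Proof. by rewrite /dil; have := step_le j; lra. Qed.

Lemma dil_le1 j : dil j <= 1.
Proof. by rewrite /dil; have := step_gt0 j; lra. Qed.

Lemma dil_norm_le1 j : `|dil j| <= 1.
Proof. by rewrite gtr0_norm ?dil_gt0// dil_le1. Qed.

Lemma dil_ge j : 2^-1 <= dil j.
Proof. by rewrite /dil; have := step_le j; lra. Qed.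

Lemma dil_cvg1 : dil j @[j --> \oo] --> (1 : R).
Proof.
rewrite -[X in _ --> X](subr0 1) -[X in _ - X](mulr0 2).
by apply: cvgB; [exact: cvg_cst|apply: cvgMr; exact: step_cvg0].
Qed.

Lemma width_cvg0 : width j @[j --> \oo] --> (0 : R).
Proof. by rewrite -[X in _ --> X](mulr0 r); apply: cvgMr; exact: step_cvg0. Qed.

(* Evaluating at [dil j *: x] instead of [x] keeps the support of the kernel
   inside the ball for every [x] of the ball, up to the boundary. *)
Definition moll j g x : R := (bump_mass n (width j))^-1 * conv r (bump (width j)) (dil j) g x.

Definition dmoll j v g x : R :=
  (bump_mass n (width j))^-1 * (dil j * conv r (dbump (width j) v) (dil j) g x).

Lemma supp_close j x y : enorm x <= r -> bump (width j) (dil j *: x - y) != 0 ->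
  enorm (y - x) < 3 * width j.
Proof.
move=> xr /(bump_neq0 (width_gt0 j)) xy.
rewrite enormBC (_ : x - y = (dil j *: x - y) + (2 * step j) *: x); last first.
  by rewrite /dil scalerBl scale1r addrAC subrK.
rewrite (le_lt_trans (enormD _ _))// (_ : 3 * width j = width j + 2 * width j); last by ring.
rewrite ltr_leD// enormZ ger0_norm ?mulr_ge0// ?(ltW (step_gt0 j))//.
by rewrite -mulrA ler_wpM2l// mulrC /width ler_wpM2r// ltW.
Qed.

Lemma supp_ball j x y : enorm x <= r -> bump (width j) (dil j *: x - y) != 0 -> B y.
Proof.
move=> xr /(bump_neq0 (width_gt0 j)) xy; rewrite /eball /=.
rewrite (_ : y = dil j *: x - (dil j *: x - y)); last by rewrite opprB addrC subrK.
rewrite (le_lt_trans (enormB _ _))// enormZ gtr0_norm ?dil_gt0//.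
have : dil j * enorm x <= dil j * r by rewrite ler_wpM2l// ltW// dil_gt0.
have := mulr_gt0 r0 (step_gt0 j).
move: xy; rewrite /width /dil; lra.
Qed.

End mollifier.

Section moll_pairing.
Context (R : realType) (n : nat) (r : R) (r0 : 0 < r).
Implicit Types (x y z v : 'rV[R]_n) (g : 'rV[R]_n -> R).
Local Notation E := 'rV[R]_n.
Local Notation mu := (lebesgue_rV R n).
Local Notation B := (@eball R n r).

Let mB : measurable B := measurable_eball r.

(** The indicator confines the first variable to the ball; for the second variable [supp_ball] does
    so. *)
Let kern j (x y : E) : R :=
  \1_B x * ((bump_mass n (width r j))^-1 * bump (width r j) (dil R j *: x - y)).

Let m_gt0 j : 0 < bump_mass n (width r j).
Proof. by apply: bump_mass_gt0; exact: width_gt0. Qed.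

Let measurable_kern j : measurable_fun [set: E * E] (fun z : E * E => kern j z.1 z.2).
Proof.
have m1 : measurable_fun setT (\1_B : E -> R) by exact: measurable_indic.
apply: measurable_funM; first exact: (measurableT_comp m1 measurable_fst).
apply: measurable_funM => //; apply: (measurableT_comp (measurable_bump _)).
apply: measurable_fun_rV => i.
rewrite [X in measurable_fun _ X](_ : _ =
  fun z : E * E => dil R j * z.1 ord0 i - z.2 ord0 i); last first.
  by apply/funext => z; rewrite !mxE.
apply: measurable_funB; last exact: (measurableT_comp (measurable_coord i) measurable_snd).
by apply: measurable_funM => //; exact: (measurableT_comp (measurable_coord i) measurable_fst).
Qed.

Let kern_ge0 j x y : 0 <= kern j x y.
Proof.
by rewrite /kern indicE mulr_ge0// mulr_ge0 ?bump_ge0// invr_ge0 ltW// m_gt0.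
Qed.

Let bumpE h s x y : bump h (s *: x - y) = bump h (1 *: y + - (s *: x)).
Proof. by rewrite -bumpN opprB scale1r. Qed.

Let kern_mass j x : (\int[mu]_y (kern j x y)%:E = (\1_B x)%:E)%E.
Proof.
have mb : measurable_fun setT (EFin \o bump (width r j) : E -> _).
  by apply/measurable_EFinP; exact: measurable_bump.
transitivity (\int[mu]_y ((\1_B x / bump_mass n (width r j))%:E *
    (bump (width r j) (1 *: y + - (dil R j *: x)))%:E))%E.
  by apply: eq_integral => y _; rewrite -EFinM -bumpE /kern mulrA.
rewrite ge0_integralZl_EFin//; last 3 first.
- by move=> y _; rewrite lee_fin bump_ge0.
- exact: (measurableT_comp mb (measurable_affine 1 _)).
- by rewrite divr_ge0// ltW.
rewrite (ge0_integral_rV_affine _ ltr01 mb) => [|y]; last by rewrite lee_fin bump_ge0.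
rewrite expr1n invr1 mul1e bump_massE; last exact: width_gt0.
by rewrite -EFinM mulfVK// gt_eqF.
Qed.

Let kern_supp j x y : kern j x y != 0 -> [/\ B x, B y & enorm (y - x) < 3 * width r j].
Proof.
rewrite /kern indicE; have [/set_mem Bx|] := boolP (x \in B); last by rewrite mul0r eqxx.
rewrite mul1r mulf_eq0 negb_or => /andP[_ b0].
have xr : enorm x <= r by exact: ltW.
by split => //; [exact: supp_ball b0|exact: supp_close b0].
Qed.

(** The substitution of [dil j *: x - y] for [x] contributes the factor [dil j ^- n], the price of
    the dilation. It is only an inequality because the indicator of the ball in [x] is dropped. *)
Let kern_mass2 j y : (\int[mu]_x (kern j x y)%:E <= (dil R j ^- n * \1_B y)%:E)%E.
Proof.
have s0 := dil_gt0 R j.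
rewrite indicE; have [yB|] := boolP (y \in B); last first.
  rewrite notin_setE => yB.
  rewrite (eq_integral (cst 0%E)) ?integral0 ?mulr0// => x _; congr (_%:E).
  by apply/eqP; apply: contra_notT yB => /kern_supp[].
rewrite mulr1.
have mb : measurable_fun setT (EFin \o bump (width r j) : E -> _).
  by apply/measurable_EFinP; exact: measurable_bump.
apply: (@le_trans _ _ (\int[mu]_x ((bump_mass n (width r j))^-1%:E *
    (bump (width r j) (dil R j *: x + - y))%:E))%E).
  apply: ge0_le_integral => //.
  - by move=> x _; rewrite lee_fin.
  - apply/measurable_EFinP; exact: (measurable_fun_pair1 y (measurable_kern j)).
  - apply: measurable_funeM; exact: (measurableT_comp mb (measurable_affine _ _)).
  - move=> x _; rewrite -EFinM lee_fin /kern indicE; case: (_ \in _); rewrite ?mul1r// mul0r.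
    by rewrite mulr_ge0 ?bump_ge0// invr_ge0 ltW.
rewrite ge0_integralZl_EFin//; last 3 first.
- by move=> x _; rewrite lee_fin bump_ge0.
- exact: (measurableT_comp mb (measurable_affine _ _)).
- by rewrite invr_ge0 ltW.
rewrite (ge0_integral_rV_affine _ s0 mb) => [|x]; last by rewrite lee_fin bump_ge0.
rewrite bump_massE; last exact: width_gt0.
by rewrite -!EFinM lee_fin mulrCA mulVf ?mulr1// gt_eqF.
Qed.

(** The support lies within [3 * width r j] of [x], which becomes smaller than a radius that works
    for all the open factors at once. *)
Let kern_local A : open_boxes A -> forall x, A x ->
  \forall j \near \oo, forall y, kern j x y != 0 -> A y.
Proof.
move=> [W oW ->] x Wx.
have H i : \forall e \near 0^'+, forall t : R, `|t - x ord0 i| < e -> W i t.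
  have /nbhs_ballP[e/= e0 eO] := open_nbhs_nbhs (conj (oW i) (Wx i)).
  near=> w; move=> t xt; apply: eO; rewrite /ball/= distrC (lt_le_trans xt)//.
  by near: w; exact: nbhs_right_le.
have [e e0 eO] : exists2 e : R, 0 < e & forall i t, `|t - x ord0 i| < e -> W i t.
  have : \forall e \near 0^'+, 0 < e /\ forall i t, `|t - x ord0 i| < e -> W i t.
    near=> e; split; first by near: e; exact: nbhs_right_gt.
    by move=> i; move: i; near: e; exact: filter_forall.
  by move=> /filter_ex[e [e0 eO]]; exists e.
have e3 : 0 < e / 3 by rewrite divr_gt0.
near=> j; move=> y /kern_supp[_ _ yx] i; apply: (eO i).
have := coord_le_enorm (y - x) i; rewrite !mxE => /le_lt_trans; apply.
apply: (lt_le_trans yx); rewrite mulrC -ler_pdivlMr//.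
by near: j; exact: (cvgr_le (0 : R) (width_cvg0 r)).
Unshelve. all: by end_near. Qed.

Lemma moll_pairing_integrable (F g : E -> R) :
  measurable_fun setT F -> measurable_fun setT g ->
  (\int[mu]_(x in B) (F x ^+ 2)%:E < +oo)%E ->
  (\int[mu]_(x in B) (g x ^+ 2)%:E < +oo)%E ->
  (forall j, mu.-integrable B (EFin \o (fun x => F x * moll r j g x))) /\
  (\int[mu]_(x in B) (F x * moll r j g x) @[j --> \oo] --> \int[mu]_(x in B) (F x * g x)).
Proof.
move=> mF mg F2 g2.
have C1 j : 1 <= dil R j ^- n.
  by rewrite invf_ge1 ?exprn_gt0 ?dil_gt0// exprn_ile1 ?dil_le1// ltW// dil_gt0.
have Ccvg : dil R j ^- n @[j --> \oo] --> (1 : R).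
  have : dil R j ^+ n @[j --> \oo] --> (1 : R) ^+ n.
    exact: (cvg_comp (dil R) (fun x : R => x ^+ n) (@dil_cvg1 R) (@exprn_continuous R n 1)).
  by rewrite expr1n => /(cvgV (oner_neq0 _)); rewrite invr1.
have Kb j : exists M : R, forall x y, kern j x y <= M * \1_B y.
  exists ((bump_mass n (width r j))^-1 * ((width r j) ^+ 2) ^+ 2) => x y.
  rewrite [\1_B y]indicE; have [yB|] := boolP (y \in B).
    rewrite mulr1 /kern indicE; case: (_ \in _).
      by rewrite mul1r ler_wpM2l ?bump_le// invr_ge0 ltW// m_gt0.
    by rewrite mul0r mulr_ge0 ?sqr_ge0// invr_ge0 ltW// m_gt0.
  rewrite notin_setE mulr0 => yB.
  by rewrite (_ : kern j x y = 0)//; apply/eqP; apply: contra_notT yB => /kern_supp[].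
have Ks j x y : ~ B x -> kern j x y = 0.
  by move=> xB; apply/eqP; apply: contra_notT xB => /kern_supp[].
have := approximate_identity_pairing mB (eball_lty n r) measurable_kern kern_ge0
  kern_mass kern_mass2 C1 Ccvg (@measurable_open_boxes R n) (@open_boxesI R n)
  kern_local Kb Ks mF mg F2 g2.
have kernE j x : B x -> \int[mu]_(y in B) (kern j x y * g y) = moll r j g x.
  move=> Bx; rewrite /moll /conv -RintegralZl//.
    by apply: eq_Rintegral => y _; rewrite /kern indicE mem_set// mul1r mulrA.
  apply: conv_integrable; [exact: measurable_bump|exact: bump_lip|exact: dil_norm_le1|].
  apply: sqr_integrable => //; [exact: eball_lty|exact: measurable_funTS].
move=> [iK cK]; split=> [j|].
  by apply: eq_integrable (iK j) => // x /set_mem Bx; rewrite /= kernE.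
move: cK; apply: cvg_trans; apply: near_eq_cvg; apply: nearW => j.
by apply: eq_Rintegral => x /set_mem Bx; rewrite kernE.
Qed.

Lemma moll_integrable (F g : E -> R) j :
  measurable_fun setT F -> measurable_fun setT g ->
  (\int[mu]_(x in B) (F x ^+ 2)%:E < +oo)%E ->
  (\int[mu]_(x in B) (g x ^+ 2)%:E < +oo)%E ->
  mu.-integrable B (EFin \o (fun x => F x * moll r j g x)).
Proof.
by move=> mF mg F2 g2; have [iFg _] := moll_pairing_integrable mF mg F2 g2; exact: iFg.
Qed.

Lemma moll_pairing (F g : E -> R) :
  measurable_fun setT F -> measurable_fun setT g ->
  (\int[mu]_(x in B) (F x ^+ 2)%:E < +oo)%E ->
  (\int[mu]_(x in B) (g x ^+ 2)%:E < +oo)%E ->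
  \int[mu]_(x in B) (F x * moll r j g x) @[j --> \oo] --> \int[mu]_(x in B) (F x * g x).
Proof.
by move=> mF mg F2 g2; have [] := moll_pairing_integrable mF mg F2 g2.
Qed.


End moll_pairing.

(** * Cutoff functions and test functions *)

Section continuity.
Context (R : realType) (n : nat).
Implicit Types (x y z v : 'rV[R]_n).

Lemma loc_lipschitz_continuous (k : 'rV[R]_n -> R) : loc_lipschitz k -> continuous k.
Proof.
move=> lk x; apply/(@cvgrPdist_le _ _ _ _ (nbhs_filter x)) => e e0.
have [L kL] := lk (enorm x + 1).
near=> z.
have zx1 : enorm (z - x) < 1 by near: z; exact: near_enorm.
have zxe : enorm (z - x) < e / (`|L| + 1).
  by near: z; apply: near_enorm; rewrite divr_gt0// ltr_wpDl.
apply: (le_trans (kL x z _ _)); first by rewrite lerDl.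
  rewrite -[z](subrK x) addrC (le_trans (enormD _ _))// lerD2l//.
  by rewrite ltW.
rewrite enormBC; apply: (@le_trans _ _ ((`|L| + 1) * enorm (z - x))).
  by rewrite ler_wpM2r ?enorm_ge0// (le_trans (ler_norm _))// lerDl.
by rewrite mulrC -ler_pdivlMr ?ltr_wpDl// ltW.
Unshelve. all: by end_near. Qed.

Lemma row_continuous (f : 'rV[R]_n -> 'rV[R]_n) :
  (forall i, continuous (fun x => f x ord0 i)) -> continuous f.
Proof.
move=> cf x A [P Px PA].
have H i : \forall y \near x, P ord0 i (f y ord0 i) by apply: (cf i x); exact: Px.
apply: (@filterS _ _ (nbhs_filter x)) (filter_forall _ H) => y Hy.
by apply: PA => i j; rewrite (ord1 i).
Qed.

Lemma lipschitz_continuous1 (f : R -> R) :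
  (forall s t, `|f s - f t| <= `|s - t|) -> continuous f.
Proof.
move=> fl x; apply/cvgrPdist_le => e e0; near=> z.
by rewrite (le_trans (fl _ _))//; near: z; exact: cvgr_dist_le.
Unshelve. all: by end_near. Qed.

Lemma max0_continuous : continuous (fun s : R => Num.max 0 s).
Proof. by apply: lipschitz_continuous1 => s t; exact: max0_lip. Qed.

Lemma pos2_continuous : continuous (@pos2 R).
Proof.
move=> x; apply: (@continuous_comp _ _ _ (fun s : R => Num.max 0 s) (fun s => s ^+ 2)).
  exact: max0_continuous.
exact: exprn_continuous.
Qed.

Lemma dotp_continuous : continuous (fun x => dotp x x).
Proof.
apply: loc_lipschitz_continuous => rho; exists (2 * rho) => y z; exact: dotp_lip.
Qed.

Lemma dotpl_continuous v : continuous (fun x => dotp x v).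
Proof.
apply: loc_lipschitz_continuous => rho; exists (enorm v) => y z _ _.
by rewrite -dotpNl -dotpDl mulrC dotp_le.
Qed.

Lemma comp_pos2_continuous (T : topologicalType) (f : T -> R) :
  continuous f -> continuous (fun t => pos2 (f t)).
Proof.
move=> cf t; exact: (@continuous_comp _ _ _ f (@pos2 R) t (cf t) (@pos2_continuous (f t))).
Qed.

Lemma comp_max0_continuous (T : topologicalType) (f : T -> R) :
  continuous f -> continuous (fun t => Num.max 0 (f t)).
Proof.
move=> cf t.
exact: (@continuous_comp _ _ _ f (fun s => Num.max 0 s) t (cf t) (@max0_continuous (f t))).
Qed.

Lemma cst_sub_continuous (T : topologicalType) (c : R) (f : T -> R) :
  continuous f -> continuous (fun t => c - f t).
Proof. by move=> cf t; apply: cvgB; [exact: cvg_cst|exact: cf]. Qed.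

Lemma cstM_continuous (T : topologicalType) (c : R) (f : T -> R) :
  continuous f -> continuous (fun t => c * f t).
Proof. by move=> cf t; apply: cvgMr; exact: cf. Qed.

Lemma funM_continuous (T : topologicalType) (f g : T -> R) :
  continuous f -> continuous g -> continuous (fun t => f t * g t).
Proof. by move=> cf cg t; apply: cvgM; [exact: cf|exact: cg]. Qed.

Lemma funD_continuous (T : topologicalType) (f g : T -> R) :
  continuous f -> continuous g -> continuous (fun t => f t + g t).
Proof. by move=> cf cg t; apply: cvgD; [exact: cf|exact: cg]. Qed.

End continuity.

Section cutoff.
Context (R : realType) (n : nat) (rho : R) (rho0 : 0 < rho).
Implicit Types (x y z v : 'rV[R]_n).

(** The inner [pos2] vanishes for |x| <= rho and is at least 1 once |x|^2 >= 2 rho^2; the outer one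
    turns this into a function rising from 0 to 1. Composing [pos2] with itself gives both plateaus
    and still a quadratic remainder. *)
Definition cut x : R := 1 - pos2 (1 - pos2 (dotp x x / rho ^+ 2 - 1)).

Definition dcut v x : R :=
  8 * (Num.max 0 (1 - pos2 (dotp x x / rho ^+ 2 - 1)) *
   (Num.max 0 (dotp x x / rho ^+ 2 - 1) * (dotp x v / rho ^+ 2))).

Let rho2 : 0 < rho ^+ 2. Proof. exact: exprn_gt0. Qed.

Lemma cut_quad x v : quad_at cut x v (dcut v x).
Proof.
have h1 : quad_at (fun y => dotp y y) x v (2 * dotp x v).
  exists (dotp v v) => t t1; rewrite dotp_quad.
  rewrite (_ : _ - _ = dotp v v * t ^+ 2); last by ring.
  by rewrite ger0_norm// mulr_ge0 ?sqr_ge0// dotp_ge0.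
have h2 := quadD (quadZ (rho ^+ 2)^-1 h1) (quad_cst (-1) x v).
have h3 := quadD (quadZ (-1) (quad_pos2 h2)) (quad_cst 1 x v).
have h4 := quadD (quadZ (-1) (quad_pos2 h3)) (quad_cst 1 x v).
have [C hC] := h4; exists C => t t1; have := hC t t1.
rewrite /cut /dcut /= ![(rho ^+ 2)^-1 * _]mulrC.
have e1 (s : R) : -1 * s + 1 = 1 - s by ring.
rewrite !e1.
congr (`|_| <= _); congr (_ - _); last by ring.
Qed.

Lemma cut0 x : enorm x <= rho -> cut x = 0.
Proof.
move=> xr; rewrite /cut [pos2 (_ - 1)]pos2_le0 ?subr0.
  by rewrite /pos2 max_r// expr1n subrr.
by rewrite subr_le0 ler_pdivrMr// mul1r -enorm_sqr ler_sqr ?nnegrE ?enorm_ge0// ltW.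
Qed.

Lemma pos2_ge1 (s : R) : 1 <= s -> 1 <= pos2 s.
Proof. by move=> s1; rewrite /pos2 max_r ?(le_trans _ s1)// exprn_ege1. Qed.

Lemma cut1 x : 2 * rho <= enorm x -> cut x = 1.
Proof.
move=> xr; rewrite /cut pos2_le0 ?subr0// subr_le0 pos2_ge1//.
rewrite lerBrDr ler_pdivlMr// -enorm_sqr.
have : (2 * rho) ^+ 2 <= enorm x ^+ 2.
  by rewrite ler_sqr ?nnegrE ?enorm_ge0// mulr_ge0// ltW.
by have := rho2; rewrite exprMn; lra.
Qed.

Lemma cut_ge0 x : 0 <= cut x.
Proof.
rewrite subr_ge0 /pos2 expr_le1 ?le_max ?lexx// ge_max ler01/=.
by rewrite lerBlDr lerDl pos2_ge0.
Qed.

Lemma cut_le1 x : cut x <= 1.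
Proof. by rewrite lerBlDr lerDl pos2_ge0. Qed.

Lemma dcut0 v x : enorm x <= rho -> dcut v x = 0.
Proof.
move=> xr; rewrite /dcut [Num.max 0 (dotp x x / _ - 1)]max_l ?mul0r ?mulr0//.
by rewrite subr_le0 ler_pdivrMr// mul1r -enorm_sqr ler_sqr ?nnegrE ?enorm_ge0// ltW.
Qed.

Lemma dcut1 v x : 2 * rho <= enorm x -> dcut v x = 0.
Proof.
move=> xr; rewrite /dcut max_l ?mul0r ?mulr0// subr_le0 pos2_ge1//.
rewrite lerBrDr ler_pdivlMr// -enorm_sqr.
have : (2 * rho) ^+ 2 <= enorm x ^+ 2.
  by rewrite ler_sqr ?nnegrE ?enorm_ge0// mulr_ge0// ltW.
by have := rho2; rewrite exprMn; lra.
Qed.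

Lemma dcut_le v x : `|dcut v x| <= 16 / rho * enorm v.
Proof.
have [xr|xr] := leP (2 * rho) (enorm x).
  by rewrite dcut1// normr0 mulr_ge0 ?enorm_ge0// divr_ge0// ltW.
(* In [p] the first factor vanishes for s >= 1, and otherwise both factors are in [0, 1]. The
   constant 16 is 8 times the 2 coming from |x| < 2 rho. *)
set s := dotp x x / rho ^+ 2 - 1; pose p := Num.max 0 (1 - pos2 s) * Num.max 0 s.
have h1 : `|p| <= 1.
  rewrite ger0_norm ?mulr_ge0 ?le_max ?lexx//.
  have [s1|s1] := leP 1 s.
    by rewrite /p max_l ?mul0r// subr_le0 pos2_ge1.
  rewrite mulr_ile1 ?le_max ?lexx ?ge_max ?ler01 ?(ltW s1)//=.
  by rewrite lerBlDr lerDl pos2_ge0.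
have h2 : `|dotp x v / rho ^+ 2| <= 2 / rho * enorm v.
  rewrite normrM normfV (gtr0_norm rho2) ler_pdivrMr// (le_trans (dotp_le _ _))//.
  rewrite (_ : 2 / rho * _ * _ = 2 * rho * enorm v); last by field; rewrite gt_eqF.
  by rewrite ler_wpM2r ?enorm_ge0// ltW.
rewrite (_ : dcut v x = 8 * (p * (dotp x v / rho ^+ 2))); last first.
  by rewrite /dcut -/s /p; ring.
rewrite !normrM (@ger0_norm _ 8)// -!normrM normrM.
rewrite (_ : 16 / rho * _ = 8 * (1 * (2 / rho * enorm v))); last by ring.
by rewrite ler_wpM2l// ler_pM.
Qed.

Let w_continuous : continuous (fun x => dotp x x / rho ^+ 2 - 1 : R).
Proof.
rewrite (_ : (fun _ => _) = (fun x => (rho ^+ 2)^-1 * dotp x x + (-1))); last first.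
  by apply/funext => x; rewrite mulrC.
apply: funD_continuous; last exact: cst_continuous.
by apply: cstM_continuous; exact: dotp_continuous.
Qed.

Lemma cut_continuous : continuous cut.
Proof.
by do 2 (apply: cst_sub_continuous; apply: comp_pos2_continuous).
Qed.

Lemma dcut_continuous v : continuous (dcut v).
Proof.
apply: cstM_continuous; apply: funM_continuous.
  apply: comp_max0_continuous; apply: cst_sub_continuous.
  exact: comp_pos2_continuous.
apply: funM_continuous; first exact: comp_max0_continuous.
rewrite (_ : (fun _ => _) = (fun x => (rho ^+ 2)^-1 * dotp x v)); last first.
  by apply/funext => x; rewrite mulrC.
by apply: cstM_continuous; exact: dotpl_continuous.
Qed.

End cutoff.

Section test_functions.
Context (R : realType) (n : nat) (r : R) (r0 : 0 < r).
Implicit Types (x y z v : 'rV[R]_n).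
Local Notation E := 'rV[R]_n.
Local Notation mu := (lebesgue_rV R n).
Local Notation B := (@eball R n r).

Lemma quad_line (f : E -> R) (g : E -> E) x v w l : quad_at f (g x) w l ->
  (forall t, g (x + t *: v) = g x + t *: w) -> quad_at (fun y => f (g y)) x v l.
Proof. by move=> [C fC] gE; exists C => t t1; rewrite gE; exact: fC. Qed.

Lemma mx_norm_le_enorm x : `|x| <= enorm x.
Proof.
rewrite -[leLHS]/(mx_norm x) mx_normrE; apply: bigmax_le; first exact: enorm_ge0.
by move=> [i j] _ /=; rewrite (ord1 i) coord_le_enorm.
Qed.

Lemma enorm_shift_lip c : loc_lipschitz (fun y => enorm (c - y)).
Proof.
move=> rho; exists 1 => y z _ _; rewrite mul1r ler_norml; apply/andP; split.
  rewrite lerBrDr addrC lerBlDr (_ : c - z = (c - y) + (y - z)) ?enormD//.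
  by rewrite addrA subrK.
rewrite lerBlDr (enormBC y) [leRHS]addrC (_ : c - y = (c - z) + (z - y)) ?enormD//.
by rewrite addrA subrK.
Qed.

Lemma enorm_lip : loc_lipschitz (@enorm R n).
Proof.
move=> rho; have [L H] := enorm_shift_lip 0 rho; exists L => y z yr zr.
by have := H y z yr zr; rewrite !sub0r !enormN.
Qed.

Lemma dbumpN h v y : dbump h (- v) y = - dbump h v y.
Proof. by rewrite /dbump dotpNr !mulrN. Qed.

Definition shell (c : E) (h rho : R) : set E := [set y | enorm (c - y) <= h /\ rho <= enorm y].

Lemma compact_shell c h rho : 0 <= h -> 0 <= rho -> compact (shell c h rho).
Proof.
move=> h0 rho0; apply: bounded_closed_compact.
  exists (enorm c + h); split; first exact: num_real.
  move=> N cN y [yc _]; apply: (le_trans (mx_norm_le_enorm y)).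
  rewrite (_ : y = c - (c - y)); last by rewrite opprB addrC subrK.
  by rewrite (le_trans (enormB _ _))// (le_trans _ (ltW cN))// lerD2l.
rewrite (_ : shell c h rho =
    (fun y => enorm (c - y)) @^-1` [set t | t <= h] `&` (@enorm R n) @^-1` [set t | rho <= t]) //.
apply: closedI; apply: closed_comp.
- by move=> y _; exact: (loc_lipschitz_continuous (enorm_shift_lip c)).
- exact: closed_le.
- by move=> y _; exact: (loc_lipschitz_continuous enorm_lip).
- exact: closed_ge.
Qed.

(** The bump around [dil j *: x] does not reach the boundary of the ball and the cutoff removes a
    neighbourhood of 0, so the product is admissible in the definition of the weak gradient. The
    minus sign comes from differentiating in [y]. *)
Lemma test_bump_cut j rho x : 0 < rho -> B x ->
  C1_compact_support (B `\ 0)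
    (fun y => bump (width r j) (dil R j *: x - y) * cut rho y)
    (fun y => \row_i (- dbump (width r j) (evec R i) (dil R j *: x - y) * cut rho y +
                      bump (width r j) (dil R j *: x - y) * dcut rho (evec R i) y)).
Proof.
move=> rho0 Bx; have h0 := width_gt0 r0 j.
have cx : continuous (fun y => dil R j *: x - y).
  apply: row_continuous => i.
  rewrite (_ : (fun _ => _) = (fun y => dil R j * x ord0 i - y ord0 i)); last first.
    by apply/funext => y; rewrite !mxE.
  by apply: cst_sub_continuous; exact: coord_continuous.
have comp_c (k : E -> R) : loc_lipschitz k -> continuous (fun y => k (dil R j *: x - y)).
  move=> lk y; apply: (@continuous_comp _ _ _ (fun y => dil R j *: x - y) k); first exact: cx.
  exact: loc_lipschitz_continuous.
split.
- move=> y i; rewrite mxE; apply: quad_is_derive; apply: quadM; last exact: cut_quad.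
  apply: (quad_line (g := fun y => dil R j *: x - y) (w := - evec R i)).
    by rewrite -dbumpN; exact: bump_quad_at.
  by move=> t; rewrite scalerN opprD addrA.
- apply: row_continuous => i.
  rewrite (_ : (fun _ => _) = (fun y => -1 * (dbump (width r j) (evec R i) (dil R j *: x - y) * cut rho y) +
                      bump (width r j) (dil R j *: x - y) * dcut rho (evec R i) y)); last first.
    by apply/funext => y; rewrite mxE mulN1r mulNr.
  apply: funD_continuous; first apply: cstM_continuous; apply: funM_continuous.
  + exact: (comp_c _ (@dbump_lip _ _ _ _)).
  + exact: cut_continuous.
  + exact: (comp_c _ (@bump_lip _ _ _)).
  + exact: dcut_continuous.
- exists (shell (dil R j *: x) (width r j) rho); split.
  + by apply: compact_shell; exact: ltW.
  + move=> y [yx yr]; split.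
      rewrite /eball /= (_ : y = dil R j *: x - (dil R j *: x - y)); last first.
        by rewrite opprB addrC subrK.
      rewrite (le_lt_trans (enormB _ _))// enormZ gtr0_norm ?dil_gt0//.
      have : dil R j * enorm x <= dil R j * r by rewrite ler_wpM2l// ltW// dil_gt0.
      have : 0 < r * step R j by rewrite mulr_gt0// invr_gt0.
      move: yx; rewrite /width /dil; lra.
    by move=> y0; move: yr; rewrite y0 (_ : enorm 0 = 0) ?leNgt ?rho0//; apply/eqP; rewrite enorm_eq0.
  + move=> y /not_andP[|] /negP; rewrite -ltNge => yx.
      rewrite /bump pos2_le0 ?mul0r// subr_le0 -enorm_sqr ler_sqr ?nnegrE ?enorm_ge0 ?(ltW h0)//.
      exact: ltW.
    by rewrite cut0 ?mulr0// ltW.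
Qed.

End test_functions.

(** * The energy of a weak solution *)

Definition weight (R : realType) (n : nat) (a : R) (x : 'rV[R]_n) : R := enorm x `^ (- (2 * a)).

Section energy.
Context (R : realType) (n : nat) (r : R) (r0 : 0 < r).
Implicit Types (x y z v : 'rV[R]_n).
Local Notation E := 'rV[R]_n.
Local Notation mu := (lebesgue_rV R n).
Local Notation B := (@eball R n r).
Let mB : measurable B := measurable_eball r.

Variables (u : E -> R) (Du : E -> E) (M : R).
Hypothesis meas_u : measurable_fun setT u.
Hypothesis u_bound : forall x, `|u x| <= M.
Hypothesis mDu : forall i, measurable_fun setT (fun x => Du x ord0 i).
Hypothesis u_grad : forall phi Dphi, C1_compact_support (B `\ 0) phi Dphi ->
  forall i : 'I_n, \int[mu]_(x in B) (u x * Dphi x ord0 i) =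
    - \int[mu]_(x in B) (Du x ord0 i * phi x).

Lemma bounded_sqr_lty (g : E -> R) (C : R) : measurable_fun setT g ->
  (forall x, B x -> `|g x| <= C) -> (\int[mu]_(x in B) (g x ^+ 2)%:E < +oo)%E.
Proof.
move=> mg gC; apply: (@le_lt_trans _ _ (\int[mu]_(x in B) (C ^+ 2)%:E)%E).
  apply: ge0_le_integral => //.
  - by move=> x _; rewrite lee_fin sqr_ge0.
  - by apply/measurable_EFinP; apply: measurable_funTS; exact: measurable_funX.
  - move=> x Bx; rewrite lee_fin -(real_normK (num_real (g x))).
    by rewrite ler_sqr ?nnegrE ?gC// (le_trans _ (gC x Bx)).
by rewrite integral_cst// lte_mul_pinfty ?lee_fin ?sqr_ge0 ?eball_lty.
Qed.

Let u2 : (\int[mu]_(x in B) (u x ^+ 2)%:E < +oo)%E.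
Proof. exact: (@bounded_sqr_lty _ M). Qed.

Let iu : mu.-integrable B (EFin \o u).
Proof. by apply: sqr_integrable => //; [exact: eball_lty|exact: measurable_funTS]. Qed.

Let bump0_dbump0 h v y : bump h y = 0 -> dbump h v y = 0.
Proof. by move=> /eqP; rewrite /bump /pos2 sqrf_eq0 => /eqP h0; rewrite /dbump h0 mul0r mulr0. Qed.

Definition far (rho : R) : set E := [set x | rho <= enorm x].

Lemma measurable_far rho : measurable (far rho).
Proof.
rewrite (_ : far rho = @enorm R n @^-1` `[rho, +oo[%classic); last first.
  by apply/seteqP; split => x; rewrite /far /= in_itv/= andbT.
by rewrite -[X in measurable X]setTI; exact: measurable_enorm.
Qed.

(** Near the origin [Du] need not be in L^2 without the weight, or even integrable. The truncation
    gives an L^2 function to mollify, and its mollification is compared with derivatives only far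
    from 0. *)
Definition far_grad (rho : R) i x : R := \1_(far rho) x * Du x ord0 i.

Lemma measurable_far_grad rho i : measurable_fun setT (far_grad rho i).
Proof.
apply: measurable_funM => //; apply: measurable_indic; exact: measurable_far.
Qed.

(** Since [dil j >= 1/2], for |x| >= 4 rho and width at most [rho] the bump around [dil j *: x] is
    supported where |y| >= rho. There the cutoff of scale [rho / 2] equals 1, so the weak gradient
    identity for the product is the one for the bump alone. The factor [dil j] is the chain rule. *)
Lemma dmoll_far_grad rho : 0 < rho -> \forall j \near \oo, forall x, B x -> 4 * rho <= enorm x ->
  forall i, dmoll r j (evec R i) u x = dil R j * moll r j (far_grad rho i) x.
Proof.
move=> rho0; near=> j; move=> x Bx xr i.
have hr : width r j <= rho by near: j; exact: (cvgr_le (0 : R) (width_cvg0 r)).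
have rho2 : 0 < rho / 2 by rewrite divr_gt0.
rewrite /dmoll /moll mulrCA; congr (_ * (_ * _)).
have supp y : bump (width r j) (dil R j *: x - y) != 0 -> rho <= enorm y.
  move=> /(bump_neq0 (width_gt0 r0 j)) yx.
  have : enorm (dil R j *: x) <= enorm (dil R j *: x - y) + enorm y.
    by rewrite -{1}[dil R j *: x](subrK y) enormD.
  rewrite enormZ gtr0_norm ?dil_gt0//; have := dil_ge R j => sj.
  have : 2^-1 * enorm x <= dil R j * enorm x by rewrite ler_wpM2r// enorm_ge0.
  lra.
have := u_grad (test_bump_cut r0 j rho2 Bx) i.
rewrite (@eq_Rintegral _ _ _ mu B (fun y => -1 * (dbump (width r j) (evec R i) (dil R j *: x - y) * u y))); last first.
  move=> y _; rewrite mxE.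
  have [b0|b0] := eqVneq (bump (width r j) (dil R j *: x - y)) 0.
    by rewrite b0 (bump0_dbump0 _ b0) !(mul0r, mulr0, oppr0, addr0).
  rewrite cut1 ?dcut1//; [ring|..]; by rewrite mulrC divfK// supp.
rewrite RintegralZl//; last first.
  by apply: conv_integrable => //; [exact: measurable_dbump|exact: dbump_lip|exact: dil_norm_le1].
rewrite mulN1r => /oppr_inj; rewrite /conv => ->; apply: eq_Rintegral => y _.
rewrite /far_grad.
have [b0|b0] := eqVneq (bump (width r j) (dil R j *: x - y)) 0.
  by rewrite b0 !(mul0r, mulr0).
rewrite cut1 ?mulr1; last by rewrite mulrC divfK// supp.
by rewrite indicE mem_set ?mul1r 1?mulrC//; exact: supp.
Unshelve. all: by end_near. Qed.

Variable a : R.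
Local Notation w := (weight a).
Hypothesis finite_energy : (\int[mu]_(x in B) (w x * dotp (Du x) (Du x))%:E < +oo)%E.

Lemma weight_ge0 x : 0 <= w x. Proof. exact: powR_ge0. Qed.

Lemma measurable_weight : measurable_fun [set: E] w.
Proof. exact: (measurableT_comp (measurable_powR (- (2 * a))) (@measurable_enorm R n)). Qed.

Let mDD : measurable_fun setT (fun x => dotp (Du x) (Du x)).
Proof. exact: measurable_fun_dotp. Qed.

Lemma powR_between (p s t x : R) : 0 < s -> s <= x -> x <= t ->
  Num.min (s `^ p) (t `^ p) <= x `^ p <= Num.max (s `^ p) (t `^ p).
Proof.
move=> s0 sx xt; have x0 : 0 < x by exact: lt_le_trans sx.
have t0 : 0 < t by exact: lt_le_trans xt.
have mono (q y z : R) : 0 <= q -> 0 < y -> y <= z -> y `^ q <= z `^ q.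
  by move=> q0 y0 yz; rewrite ge0_ler_powR ?nnegrE// ?(ltW y0)// (le_trans (ltW y0)).
have [p0|p0] := leP 0 p.
  by rewrite ge_min le_max (mono p s x)// (mono p x t)// orbT.
have anti (y z : R) : 0 < y -> y <= z -> z `^ p <= y `^ p.
  move=> y0 yz; have z0 : 0 < z by exact: lt_le_trans yz.
  rewrite -[p]opprK powRN [leRHS]powRN lef_pV2 ?posrE ?powR_gt0//.
  by apply: mono => //; rewrite oppr_ge0 ltW.
by rewrite ge_min le_max (anti s x)// (anti x t)// orbT.
Qed.

(** Between the radii [rho] and [r] a power of the norm lies between its values at the two radii,
    whatever the sign of the exponent. One constant bounds both the weight and its inverse, which
    trades weighted for plain L^2 bounds away from 0. *)
Lemma weight_far rho : 0 < rho -> exists C : R, 0 < C /\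
  forall x, B x -> rho <= enorm x -> w x <= C /\ 1 <= C * w x.
Proof.
move=> rho0; pose p := - (2 * a).
pose c1 := Num.min (rho `^ p) (r `^ p); pose c2 := Num.max (rho `^ p) (r `^ p).
have c10 : 0 < c1 by rewrite lt_min !powR_gt0.
have c20 : 0 < c2 by rewrite lt_max !powR_gt0.
exists (c2 + c1^-1); split; first by rewrite addr_gt0// invr_gt0.
move=> x Bx xr; have /andP[h1 h2] := powR_between p rho0 xr (ltW Bx).
split; first by rewrite (le_trans h2)// lerDl invr_ge0 ltW.
apply: (@le_trans _ _ (c1^-1 * w x)); first by rewrite ler_pdivlMl// mulr1.
by rewrite ler_wpM2r ?weight_ge0// lerDr ltW.
Qed.

Lemma energy_sqr_lty (g : E -> R) (C : R) : measurable_fun setT g -> 0 <= C ->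
  (forall x, B x -> g x ^+ 2 <= C * (w x * dotp (Du x) (Du x))) ->
  (\int[mu]_(x in B) (g x ^+ 2)%:E < +oo)%E.
Proof.
move=> mg C0 gC.
apply: (@le_lt_trans _ _ (\int[mu]_(x in B) (C%:E * (w x * dotp (Du x) (Du x))%:E))%E).
  apply: ge0_le_integral => //.
  - by move=> x _; rewrite lee_fin sqr_ge0.
  - by apply/measurable_EFinP; apply: measurable_funTS; exact: measurable_funX.
  - apply: measurable_funeM; apply/measurable_EFinP; apply: measurable_funTS.
    by apply: measurable_funM => //; exact: measurable_weight.
rewrite ge0_integralZl_EFin//.
- by rewrite lte_mul_pinfty.
- by move=> x _; rewrite lee_fin mulr_ge0 ?weight_ge0 ?dotp_ge0.
- by apply/measurable_EFinP; apply: measurable_funTS; apply: measurable_funM => //; exact: measurable_weight.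
Qed.

Lemma coord_sqr_le x i : (Du x ord0 i) ^+ 2 <= dotp (Du x) (Du x).
Proof.
rewrite -(real_normK (num_real (Du x ord0 i))) -enorm_sqr ler_sqr ?nnegrE ?enorm_ge0//.
exact: coord_le_enorm.
Qed.

Lemma far_grad_sqr_lty rho i : 0 < rho -> (\int[mu]_(x in B) (far_grad rho i x ^+ 2)%:E < +oo)%E.
Proof.
move=> rho0; have [C [C0 wC]] := weight_far rho0.
apply: (@energy_sqr_lty _ C); [exact: measurable_far_grad|exact: ltW|].
move=> x Bx; rewrite /far_grad indicE; have [xr|xr] := leP rho (enorm x).
  rewrite mem_set// mul1r (le_trans (coord_sqr_le x i))// mulrA ler_peMl ?dotp_ge0//.
  by have [] := wC x Bx xr.
rewrite memNset; last by move=> /= /(lt_le_trans xr); rewrite ltxx.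
by rewrite mul0r expr0n/= !mulr_ge0 ?dotp_ge0 ?(ltW C0) ?weight_ge0.
Qed.

End energy.

(** * Testing the equation with the mollified solution *)

Section energy_inequality.
Context (R : realType) (n : nat) (r : R) (r0 : 0 < r).
Implicit Types (x y z v : 'rV[R]_n).
Local Notation E := 'rV[R]_n.
Local Notation mu := (lebesgue_rV R n).
Local Notation B := (@eball R n r).
Let mB : measurable B := measurable_eball r.

Lemma moll_quad j (g : E -> R) x v : mu.-integrable B (EFin \o g) ->
  quad_at (moll r j g) x v (dmoll r j v g x).
Proof. by move=> ig; apply: quadZ; apply: conv_bump_quad => //; exact: dil_norm_le1. Qed.

Lemma moll_continuous j (g : E -> R) : mu.-integrable B (EFin \o g) -> continuous (moll r j g).
Proof.
move=> ig; apply: cstM_continuous; apply: conv_continuous => //.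
- exact: measurable_bump.
- exact: bump_lip.
- exact: dil_norm_le1.
Qed.

Lemma dmoll_continuous j v (g : E -> R) : mu.-integrable B (EFin \o g) ->
  continuous (dmoll r j v g).
Proof.
move=> ig; apply: cstM_continuous; apply: cstM_continuous; apply: conv_continuous => //.
- exact: measurable_dbump.
- exact: dbump_lip.
- exact: dil_norm_le1.
Qed.

Lemma test_moll_cut j rho (g : E -> R) (m : R) : 0 < rho -> mu.-integrable B (EFin \o g) ->
  C1_closure B (fun x => cut rho x * (moll r j g x - m))
    (fun x => \row_i (dcut rho (evec R i) x * (moll r j g x - m) +
                      cut rho x * dmoll r j (evec R i) g x)).
Proof.
move=> rho0 ig.
have mE x : moll r j g x - m = moll r j g x + - m by [].
split.
- apply: continuous_subspaceT; apply: funM_continuous; first exact: cut_continuous.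
  by apply: funD_continuous; [exact: moll_continuous|exact: cst_continuous].
- apply: continuous_subspaceT; apply: row_continuous => i.
  rewrite (_ : (fun _ => _) = (fun x => dcut rho (evec R i) x * (moll r j g x - m) +
      cut rho x * dmoll r j (evec R i) g x)); last by apply/funext => y; rewrite mxE.
  apply: funD_continuous; apply: funM_continuous.
  + exact: dcut_continuous.
  + by apply: funD_continuous; [exact: moll_continuous|exact: cst_continuous].
  + exact: cut_continuous.
  + exact: dmoll_continuous.
- move=> x _ i; rewrite mxE; apply: quad_is_derive; apply: quadM; first exact: cut_quad.
  by rewrite -[dmoll _ _ _ _ _]addr0; apply: quadD; [exact: moll_quad|exact: quad_cst].
Qed.

Lemma dcut_sum rho x v : \sum_(i < n) v ord0 i * dcut rho (evec R i) x = dcut rho v x.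
Proof.
rewrite /dcut [dotp x v]/dotp !mulr_suml !mulr_sumr; apply: eq_bigr => i _.
by rewrite dotp_evec; ring.
Qed.

Lemma measurable_cut rho : measurable_fun [set: E] (cut rho).
Proof.
apply: measurable_funB => //; apply: measurable_funX; apply: measurable_maxr => //.
apply: measurable_funB => //; apply: measurable_funX; apply: measurable_maxr => //.
by apply: measurable_funB => //; apply: measurable_funM => //; apply: measurable_fun_dotp => i; exact: measurable_coord.
Qed.

Lemma measurable_dcut rho (v : E -> E) : (forall i, measurable_fun setT (fun x => v x ord0 i)) ->
  measurable_fun [set: E] (fun x => dcut rho (v x) x).
Proof.
move=> mv; have mq : measurable_fun [set: E] (fun x => dotp x x / rho ^+ 2 - 1).
  by apply: measurable_funB => //; apply: measurable_funM => //; apply: measurable_fun_dotp => i; exact: measurable_coord.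
apply: measurable_funM => //; apply: measurable_funM.
  apply: measurable_maxr => //.
  by apply: measurable_funB => //; apply: measurable_funX; apply: measurable_maxr.
apply: measurable_funM; first exact: measurable_maxr.
by apply: measurable_funM => //; apply: measurable_fun_dotp => // i; exact: measurable_coord.
Qed.

Lemma sqr_mul_integrable (f g : E -> R) : measurable_fun setT f -> measurable_fun setT g ->
  (\int[mu]_(x in B) (f x ^+ 2)%:E < +oo)%E -> (\int[mu]_(x in B) (g x ^+ 2)%:E < +oo)%E ->
  mu.-integrable B (EFin \o (fun x => f x * g x)).
Proof.
move=> mf mg f2 g2.
have sq (h : E -> R) : measurable_fun setT h -> (\int[mu]_(x in B) (h x ^+ 2)%:E < +oo)%E ->
    mu.-integrable B (fun x => (h x ^+ 2)%:E).
  move=> mh h2; apply/integrableP; split.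
    by apply/measurable_EFinP; apply: measurable_funTS; exact: measurable_funX.
  by under eq_integral do rewrite gee0_abs ?lee_fin ?sqr_ge0//.
apply: (@le_integrable _ _ _ _ _ mB _ (fun x => (f x ^+ 2)%:E + (g x ^+ 2)%:E)%E).
- by apply/measurable_EFinP; apply: measurable_funTS; exact: measurable_funM.
- move=> x Bx; rewrite -EFinD lee_fin [leRHS]ger0_norm ?addr_ge0 ?sqr_ge0//.
  rewrite -(real_normK (num_real (f x))) -(real_normK (num_real (g x))) normrM.
  have := normr_ge0 (f x); have := normr_ge0 (g x); nra.
- by apply: integrableD => //; exact: sq.
Qed.

Lemma Rintegral_sum (I : Type) (s : seq I) (g : I -> E -> R) :
  (forall i, mu.-integrable B (EFin \o g i)) ->
  mu.-integrable B (EFin \o (fun x => \sum_(i <- s) g i x)) /\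
  \int[mu]_(x in B) (\sum_(i <- s) g i x) = \sum_(i <- s) \int[mu]_(x in B) g i x.
Proof.
move=> ig; elim: s => [|i s [iS IH]].
  under [X in _.-integrable _ X]eq_fun do rewrite /= big_nil.
  rewrite big_nil (@eq_Rintegral _ _ _ mu B (cst 0)); last by move=> x _; rewrite big_nil.
  by rewrite Rintegral_cst// mul0r; split => //; exact: integrable0.
under [X in _.-integrable _ X]eq_fun do rewrite /= big_cons EFinD.
split; first exact: (integrableD mB (ig i) iS).
rewrite big_cons -IH -RintegralD//.
by apply: eq_Rintegral => x _; rewrite big_cons.
Qed.

Variables (u : E -> R) (Du : E -> E) (M : R).
Hypothesis meas_u : measurable_fun setT u.
Hypothesis u_bound : forall x, `|u x| <= M.
Hypothesis mDu : forall i, measurable_fun setT (fun x => Du x ord0 i).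
Hypothesis u_grad : forall phi Dphi, C1_compact_support (B `\ 0) phi Dphi ->
  forall i : 'I_n, \int[mu]_(x in B) (u x * Dphi x ord0 i) =
    - \int[mu]_(x in B) (Du x ord0 i * phi x).
Variable a : R.
Local Notation w := (weight a).
Hypothesis finite_energy : (\int[mu]_(x in B) (w x * dotp (Du x) (Du x))%:E < +oo)%E.

(** [F] stands for the source |x|^(-bq) f(u), kept abstract: it enters through its bound away from 0
    and its sign against [u - m]. *)
Variables (F : E -> R) (m : R).
Hypothesis mF : measurable_fun setT F.
Hypothesis F_far : forall rho, 0 < rho -> exists C, forall x, B x -> far rho x -> `|F x| <= C.
Hypothesis F_sign : forall x, B x -> F x * (u x - m) <= 0.
Hypothesis u_eq : forall psi Dpsi, C1_closure B psi Dpsi ->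
  \int[mu]_(x in B) (w x * dotp (Du x) (Dpsi x)) = \int[mu]_(x in B) (F x * psi x).

Let u2 : (\int[mu]_(x in B) (u x ^+ 2)%:E < +oo)%E.
Proof. exact: (@bounded_sqr_lty _ _ _ _ M). Qed.

Let iu : mu.-integrable B (EFin \o u).
Proof. by apply: sqr_integrable => //; [exact: eball_lty|exact: measurable_funTS]. Qed.

(* Test with [cut rho * (moll r j u - m)] and let [j] tend to infinity; the source
   term then contributes the integral of [cut rho * F * (u - m) <= 0]. *)
Lemma cut_energy_le rho : 0 < rho ->
  \int[mu]_(x in B) (cut rho x * (w x * dotp (Du x) (Du x))) <=
  - \int[mu]_(x in B) (w x * dcut rho (Du x) x * (u x - m)).
Proof.
(* With [rho / 4], [dmoll_far_grad] covers |x| >= rho, hence all points where the cutoff of scale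
   [rho] is nonzero. *)
move=> rho0; have rho4 : 0 < rho / 4 by rewrite divr_gt0.
(* The fixed factors of the pairings: [A1] from the gradient of the cutoff, [A2] from that of the
   mollification, [G] from the source. All vanish for |x| <= rho, which puts them in L^2. *)
pose A1 x := w x * dcut rho (Du x) x.
pose A2 i x := w x * Du x ord0 i * cut rho x.
pose G x := F x * cut rho x.
have mA1 : measurable_fun setT A1.
  by apply: measurable_funM; [exact: measurable_weight|exact: measurable_dcut].
have mA2 i : measurable_fun setT (A2 i).
  apply: measurable_funM; last exact: measurable_cut.
  by apply: measurable_funM => //; exact: measurable_weight.
have mG : measurable_fun setT G by apply: measurable_funM => //; exact: measurable_cut.
have [K [K0 wK]] := @weight_far R n r r0 a rho rho0.
have A12 : (\int[mu]_(x in B) (A1 x ^+ 2)%:E < +oo)%E.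
  apply: (energy_sqr_lty mDu finite_energy mA1 (C := K * (16 / rho) ^+ 2)).
    by rewrite mulr_ge0 ?sqr_ge0// ltW.
  move=> x Bx; rewrite /A1; have [xr|xr] := leP (enorm x) rho.
    by rewrite dcut0// mulr0 expr0n/=; apply: mulr_ge0; apply: mulr_ge0;
       rewrite ?weight_ge0 ?dotp_ge0 ?sqr_ge0 ?(ltW K0).
  have [wK1 _] := wK x Bx (ltW xr).
  have d2 : dcut rho (Du x) x ^+ 2 <= (16 / rho) ^+ 2 * dotp (Du x) (Du x).
    rewrite -enorm_sqr -exprMn -(real_normK (num_real (dcut _ _ _))).
    have r16 : 0 <= 16 / rho by rewrite divr_ge0// ltW.
    rewrite ler_sqr ?nnegrE ?dcut_le//.
    by apply: mulr_ge0 => //; exact: enorm_ge0.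
  rewrite exprMn expr2 -mulrA [leRHS](_ : _ =
    K * (w x * ((16 / rho) ^+ 2 * dotp (Du x) (Du x)))); last by ring.
  apply: ler_pM => //; [exact: weight_ge0| |by rewrite ler_wpM2l ?weight_ge0].
  by apply: mulr_ge0; [exact: weight_ge0|exact: sqr_ge0].
have A22 i : (\int[mu]_(x in B) (A2 i x ^+ 2)%:E < +oo)%E.
  apply: (energy_sqr_lty mDu finite_energy (mA2 i) (ltW K0)).
  move=> x Bx; rewrite /A2; have [xr|xr] := leP (enorm x) rho.
    by rewrite cut0// mulr0 expr0n/= !mulr_ge0 ?weight_ge0 ?dotp_ge0 ?(ltW K0).
  have [wK1 _] := wK x Bx (ltW xr).
  rewrite [leLHS](_ : _ = w x * (w x * (Du x ord0 i ^+ 2 * cut rho x ^+ 2))); last by ring.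
  apply: ler_pM => //; [exact: weight_ge0| |].
    apply: mulr_ge0; first exact: weight_ge0.
    by apply: mulr_ge0; exact: sqr_ge0.
  rewrite ler_wpM2l ?weight_ge0// (le_trans _ (coord_sqr_le Du x i))// ler_piMr ?sqr_ge0//.
  by rewrite exprn_ile1 ?cut_ge0 ?cut_le1.
have G2 : (\int[mu]_(x in B) (G x ^+ 2)%:E < +oo)%E.
  have [C FC] := F_far rho0.
  apply: (@bounded_sqr_lty _ _ _ _ (Num.max 0 C)) => // x Bx.
  rewrite /G le_max; have [xr|xr] := leP (enorm x) rho.
    by rewrite cut0// mulr0 normr0 lexx.
  rewrite normrM (ger0_norm (cut_ge0 rho x)); apply/orP; right.
  by rewrite (le_trans _ (FC x Bx (ltW xr)))// ler_piMr// cut_le1.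
have gr2 i := far_grad_sqr_lty r0 mDu finite_energy i rho4.
have mgr i := measurable_far_grad mDu (rho / 4) i.
have iL2 (g : E -> R) : measurable_fun setT g -> (\int[mu]_(x in B) (g x ^+ 2)%:E < +oo)%E ->
    mu.-integrable B (EFin \o g).
  by move=> mg g2; apply: sqr_integrable => //; [exact: eball_lty|exact: measurable_funTS].
have iA1u j := moll_integrable r0 j mA1 meas_u A12 u2.
have iGu j := moll_integrable r0 j mG meas_u G2 u2.
have iA2 j i := moll_integrable r0 j (mA2 i) (mgr i) (A22 i) (gr2 i).
have iA1 := iL2 _ mA1 A12.
have iG := iL2 _ mG G2.
have iZ c (g : E -> R) : mu.-integrable B (EFin \o g) ->
    mu.-integrable B (EFin \o (fun x => c * g x)) by move=> ig; exact: (integrableZl mB c ig).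
have iB (f g : E -> R) : mu.-integrable B (EFin \o f) -> mu.-integrable B (EFin \o g) ->
    mu.-integrable B (EFin \o (fun x => f x - g x)).
  by move=> fi gi; exact: (integrableB mB fi gi).
have lhs : \int[mu]_(x in B) (A1 x * moll r j u x) - m * \int[mu]_(x in B) A1 x +
    dil R j * \sum_(i < n) \int[mu]_(x in B) (A2 i x * moll r j (far_grad Du (rho / 4) i) x)
    @[j --> \oo] --> \int[mu]_(x in B) (A1 x * u x) - m * \int[mu]_(x in B) A1 x +
    1 * \sum_(i < n) \int[mu]_(x in B) (A2 i x * far_grad Du (rho / 4) i x).
  apply: cvgD; first by apply: cvgB; [exact: moll_pairing|exact: cvg_cst].
  apply: cvgM; first exact: dil_cvg1.
  apply: cvg_big; first exact: add_continuous.
  by move=> i _; apply: moll_pairing.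
have rhs : \int[mu]_(x in B) (G x * moll r j u x) - m * \int[mu]_(x in B) G x
    @[j --> \oo] --> \int[mu]_(x in B) (G x * u x) - m * \int[mu]_(x in B) G x.
  by apply: cvgB; [exact: moll_pairing|exact: cvg_cst].
(* The tested equation, in this form only for large [j] because [dmoll_far_grad] requires a small
   width. *)
have lr : \forall j \near \oo,
    \int[mu]_(x in B) (A1 x * moll r j u x) - m * \int[mu]_(x in B) A1 x +
    dil R j * \sum_(i < n) \int[mu]_(x in B) (A2 i x * moll r j (far_grad Du (rho / 4) i) x) =
    \int[mu]_(x in B) (G x * moll r j u x) - m * \int[mu]_(x in B) G x.
  have := dmoll_far_grad r0 meas_u u_bound u_grad rho4; apply: filterS => j dE.
  have [iS <-] := Rintegral_sum (index_enum 'I_n) (iA2 j).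
  rewrite -!RintegralZl// -!RintegralB//; [|exact: iZ..].
  rewrite -RintegralD//; last 2 first.
  - by apply: iB => //; exact: iZ.
  - exact: iZ.
  transitivity (\int[mu]_(x in B) (F x * (cut rho x * (moll r j u x - m)))); last first.
    by apply: eq_Rintegral => x _; rewrite /G; ring.
  rewrite -(u_eq (test_moll_cut j m rho0 iu)); apply: eq_Rintegral => x /set_mem Bx.
  rewrite [dotp _ (\row__ _)](_ : _ = dcut rho (Du x) x * (moll r j u x - m) +
     dil R j * \sum_(i < n) Du x ord0 i * cut rho x * moll r j (far_grad Du (rho / 4) i) x).
    rewrite [X in _ + _ * X = _](_ : _ =
      w x * \sum_(i < n) Du x ord0 i * cut rho x * moll r j (far_grad Du (rho / 4) i) x).
      by rewrite /A1; ring.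
    by rewrite mulr_sumr; apply: eq_bigr => i _; rewrite /A2 !mulrA.
  rewrite /dotp -dcut_sum mulr_suml mulr_sumr -big_split/=; apply: eq_bigr => i _.
  rewrite mxE mulrDr mulrA; congr (_ + _).
  have [xr|xr] := leP (enorm x) rho; first by rewrite cut0// !(mul0r, mulr0).
  by rewrite dE//; [ring|rewrite mulrC divfK// ltW].
have eql : \int[mu]_(x in B) (A1 x * u x) - m * \int[mu]_(x in B) A1 x +
    1 * \sum_(i < n) \int[mu]_(x in B) (A2 i x * far_grad Du (rho / 4) i x) =
   \int[mu]_(x in B) (G x * u x) - m * \int[mu]_(x in B) G x.
  apply: (cvg_unique (@Rhausdorff R) lhs); apply: cvg_trans rhs.
  by apply: near_eq_cvg; apply: filterS lr => j ->.
have -> : \int[mu]_(x in B) (cut rho x * (w x * dotp (Du x) (Du x))) =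
    \sum_(i < n) \int[mu]_(x in B) (A2 i x * far_grad Du (rho / 4) i x).
  have [_ <-] := Rintegral_sum (index_enum 'I_n)
    (fun i => sqr_mul_integrable (mA2 i) (mgr i) (A22 i) (gr2 i)).
  apply: eq_Rintegral => x Bx; rewrite /dotp !mulr_sumr; apply: eq_bigr => i _.
  rewrite /A2 /far_grad indicE.
  have [xr|xr] := leP (enorm x) rho; first by rewrite cut0// !(mul0r, mulr0).
  by rewrite mem_set /far/=; [ring|move: rho0 xr; lra].
have -> : \int[mu]_(x in B) (w x * dcut rho (Du x) x * (u x - m)) =
    \int[mu]_(x in B) (A1 x * u x) - m * \int[mu]_(x in B) A1 x.
  rewrite -RintegralZl// -RintegralB//; last 2 first.
  - exact: sqr_mul_integrable.
  - exact: iZ.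
  by apply: eq_Rintegral => x _; rewrite /A1; ring.
suff : \int[mu]_(x in B) (G x * u x) - m * \int[mu]_(x in B) G x <= 0 by lra.
rewrite -RintegralZl// -RintegralB//; last 2 first.
- exact: sqr_mul_integrable.
- exact: iZ.
rewrite -oppr_ge0 -mulN1r -RintegralZl//; last first.
  by apply: iB; [exact: sqr_mul_integrable|exact: iZ].
apply: Rintegral_ge0 => x Bx; rewrite /G [leRHS](_ : _ = cut rho x * - (F x * (u x - m))); last by ring.
by rewrite mulr_ge0 ?cut_ge0// oppr_ge0 F_sign.
Qed.

End energy_inequality.

(** * Volumes of small balls *)

Section small_balls.
Context (R : realType) (n : nat).
Implicit Types (x y z v : 'rV[R]_n).
Local Notation E := 'rV[R]_n.
Local Notation mu := (lebesgue_rV R n).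

Lemma eball_vol (h : R) : 0 < h -> mu (eball h) = (h ^+ n * fine (mu (eball 1)))%:E.
Proof.
move=> h0; have := @lebesgue_rV_affine R n h 0 _ h0 (measurable_eball h).
rewrite [X in mu X = _](_ : _ = @eball R n 1); last first.
  have hx x : (enorm (h *: x + 0) < h) = (enorm x < 1).
    by rewrite addr0 enormZ gtr0_norm// -ltr_pdivlMl// mulVf ?gt_eqF.
  by apply/seteqP; split => x /=; rewrite /eball /= hx.
move=> V; rewrite EFinM fineK ?ge0_fin_numE ?eball_lty// V muleA -EFinM divff ?mul1e//.
by rewrite gt_eqF// exprn_gt0.
Qed.

Lemma lebesgue_rV0 : (0 < n)%N -> mu [set 0] = 0%E.
Proof.
case: n => // k _.
have := @lebesgue_rV_box R k.+1 (fun=> [set 0]) (fun=> measurable_set1 0).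
rewrite big_ord_recl lebesgue_measure_set1 mul0e => <-; congr (_ _).
apply/seteqP; split => x /=; first by move=> -> i; rewrite mxE.
by move=> x0; apply/rowP => i; rewrite x0 mxE.
Qed.

Lemma measurable_rV0 : measurable [set 0 : E].
Proof.
rewrite (_ : [set 0] = @enorm R n @^-1` [set 0]).
  by rewrite -[X in measurable X]setTI; exact: measurable_enorm.
apply/seteqP; split => x /= => [->|/eqP]; first by apply/eqP; rewrite enorm_eq0.
by rewrite enorm_eq0 => /eqP.
Qed.

Lemma Rintegral_indic_eball (D : set E) (h : R) : measurable D -> 0 < h ->
  \int[mu]_(x in D) \1_(eball h) x <= h ^+ n * fine (mu (eball 1)).
Proof.
move=> mD h0; have mS : measurable (@eball R n h) by exact: measurable_eball.
rewrite -lee_fin -eball_vol// /Rintegral integral_indic//.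
have SB : (mu (eball h `&` D) <= mu (eball h))%E.
  by apply: le_measure; rewrite ?inE//; exact: measurableI.
by rewrite fineK// ge0_fin_numE// (le_lt_trans SB)// eball_lty.
Qed.

End small_balls.

(** * Vanishing of the energy as the cutoff shrinks to the origin *)

Section energy_vanishes.
Context (R : realType) (n : nat) (r : R).
Implicit Types (x y z v : 'rV[R]_n).
Local Notation E := 'rV[R]_n.
Local Notation mu := (lebesgue_rV R n).
Local Notation B := (@eball R n r).
Let mB : measurable B := measurable_eball r.
Variables (u : E -> R) (Du : E -> E) (M : R).
Hypothesis meas_u : measurable_fun setT u.
Hypothesis mDu : forall i, measurable_fun setT (fun x => Du x ord0 i).
Variable a : R.
Local Notation w := (weight a).
Hypothesis finite_energy : (\int[mu]_(x in B) (w x * dotp (Du x) (Du x))%:E < +oo)%E.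
Variable m : R.
Hypothesis um_bound : forall x, `|u x - m| <= M.
Hypothesis cut_le : forall rho, 0 < rho ->
  \int[mu]_(x in B) (cut rho x * (w x * dotp (Du x) (Du x))) <=
  - \int[mu]_(x in B) (w x * dcut rho (Du x) x * (u x - m)).
Hypothesis n0 : (0 < n)%N.
Hypothesis a_lt : 0 < n%:R - 2 - 2 * a.

Let e x : R := w x * dotp (Du x) (Du x).

Let e_ge0 x : 0 <= e x. Proof. by rewrite mulr_ge0 ?weight_ge0 ?dotp_ge0. Qed.

Let me : measurable_fun setT e.
Proof. by apply: measurable_funM; [exact: measurable_weight|exact: measurable_fun_dotp]. Qed.

Let ie : mu.-integrable B (EFin \o e).
Proof.
apply/integrableP; split; first by apply/measurable_EFinP; exact: measurable_funTS.
by under eq_integral do rewrite gee0_abs ?lee_fin ?e_ge0//.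
Qed.

Let mI rho : measurable_fun setT (\1_(@eball R n rho) : E -> R).
Proof. by apply: measurable_indic; exact: measurable_eball. Qed.

(** Absolute continuity of the energy: the indicators of the shrinking balls tend to 0 off the
    origin, a null set, with the integrable [e] as majorant. *)
Let T_small (d : R) : 0 < d ->
  \forall k \near \oo, \int[mu]_(x in B) (\1_(eball (2 * step R k)) x * e x) <= d.
Proof.
move=> d0.
have : (\int[mu]_(x in B) (\1_(eball (2 * step R k)) x * e x)%:E @[k --> \oo] --> 0)%E.
  have [] := @dominated_convergence _ _ _ mu B mB
    (fun k x => (\1_(eball (2 * step R k)) x * e x)%:E) (cst 0%E) (EFin \o e).
  - by move=> k; apply/measurable_EFinP; apply: measurable_funTS; exact: measurable_funM.
  - exact: measurable_cst.
  - exists [set 0]; split; [exact: measurable_rV0|exact: lebesgue_rV0|].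
    move=> x /= nx; apply: contrapT => x0; apply: nx => _.
    apply: cvg_near_cst.
    have ex : 0 < enorm x by rewrite lt_def enorm_ge0 enorm_eq0 andbT; exact/eqP.
    have ex2 : 0 < enorm x / 2 by rewrite divr_gt0.
    have : \forall k \near \oo, step R k <= enorm x / 2.
      by exact: (cvgr_le (0 : R) (@step_cvg0 R)).
    apply: filterS => k sk; rewrite indicE memNset ?mul0r// /eball /= => h.
    by move: sk h; lra.
  - exact: ie.
  - apply/aeW => x k _; rewrite gee0_abs; rewrite lee_fin; last by apply: mulr_ge0.
    by rewrite ler_piMl ?e_ge0// indicE lern1 leq_b1.
  by move=> _ _; rewrite integral0.
move=> /cvge0_near_le /(_ d0); apply: filterS => k kd.
rewrite -lee_fin /Rintegral fineK// ge0_fin_numE ?(le_lt_trans kd) ?ltry//.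
by apply: integral_ge0 => x _; rewrite lee_fin; apply: mulr_ge0.
Qed.

Let p := - (2 * a).
(** What remains of [K rho] times the volume of the ball of radius [2 * rho] once the powers of
    [rho] are split off. *)
Let C0 := 2^-1 * (16 * M) ^+ 2 * Num.max 1 (2 `^ p) * (2 ^+ n * fine (mu (@eball R n 1))).

Let M_ge0 : 0 <= M.
Proof. by rewrite (le_trans _ (um_bound 0)). Qed.

Let K rho := 2^-1 * (16 * M / rho) ^+ 2 * (Num.max 1 (2 `^ p) * rho `^ p).

Let max_ge0 : 0 <= Num.max 1 (2 `^ p).
Proof. by rewrite le_max ler01. Qed.

Let K_ge0 rho : 0 <= K rho.
Proof.
apply: mulr_ge0; first by apply: mulr_ge0; [by []|exact: sqr_ge0].
by apply: mulr_ge0 => //; exact: powR_ge0.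
Qed.

(** Young's inequality c D <= D^2 / 2 + c^2 / 2, with [D] the norm of the gradient and c = 16 M /
    rho from the bounds on the cutoff gradient and on [u - m]. Where rho < |x| < 2 rho the weight is
    at most max(1, 2^p) rho^p, for either sign of [p]. *)
Let pointwise rho x : 0 < rho ->
  `|w x * dcut rho (Du x) x * (u x - m)| <= 2^-1 * (\1_(eball (2 * rho)) x * e x) +
   K rho * \1_(eball (2 * rho)) x.
Proof.
move=> rho0.
have rhs0 : 0 <= 2^-1 * (\1_(eball (2 * rho)) x * e x) + K rho * \1_(eball (2 * rho)) x.
  by apply: addr_ge0; apply: mulr_ge0 => //; apply: mulr_ge0.
have [x1|x1] := leP (enorm x) rho.
  by rewrite dcut0// mulr0 mul0r normr0.
have [x2|x2] := leP (2 * rho) (enorm x).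
  by rewrite dcut1// mulr0 mul0r normr0.
have -> : \1_(eball (2 * rho)) x = 1 :> R by rewrite indicE mem_set.
have wW : w x <= Num.max 1 (2 `^ p) * rho `^ p.
  have /andP[_] := powR_between p rho0 (ltW x1) (ltW x2).
  rewrite (powRM _ (ler0n R 2) (ltW rho0)) => h; rewrite (le_trans h)// ge_max; apply/andP; split.
    by rewrite ler_peMl ?powR_ge0// le_max lexx.
  by rewrite ler_wpM2r ?powR_ge0// le_max lexx orbT.
have dD := dcut_le rho0 (Du x) x.
rewrite mul1r mulr1 -mulrA normrM (ger0_norm (weight_ge0 a x)) normrM.
pose D := enorm (Du x); pose c := 16 * M / rho.
apply: (@le_trans _ _ (w x * (c * D))).
  rewrite ler_wpM2l ?weight_ge0// [leRHS](_ : _ = 16 / rho * D * M).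
    exact: (ler_pM (normr_ge0 _) (normr_ge0 _) dD (um_bound x)).
  by rewrite /c; ring.
apply: (@le_trans _ _ (2^-1 * e x + 2^-1 * c ^+ 2 * w x)).
  rewrite /e -enorm_sqr -/D -subr_ge0 (_ : _ - _ = w x * (2^-1 * (D - c) ^+ 2)); last by field.
  by apply: mulr_ge0; [exact: weight_ge0|apply: mulr_ge0 => //; exact: sqr_ge0].
rewrite lerD2l /K -/c ler_wpM2l//.
by apply: mulr_ge0 => //; exact: sqr_ge0.
Qed.

(** The energy is at most the cut energy plus the energy [T] of the small ball, and the cut energy
    is at most [T / 2] plus a volume term. This gives 3/2 in front of [T], rounded up to 2. *)
Let cut_bound rho : 0 < rho ->
  \int[mu]_(x in B) e x <= 2 * \int[mu]_(x in B) (\1_(eball (2 * rho)) x * e x) +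
    C0 * rho `^ (n%:R - 2 - 2 * a).
Proof.
move=> rho0.
pose T := \int[mu]_(x in B) (\1_(eball (2 * rho)) x * e x).
have T0 : 0 <= T by apply: Rintegral_ge0 => x _; apply: mulr_ge0.
have ind1 x : (\1_(eball (2 * rho)) x : R) <= 1 by rewrite indicE lern1 leq_b1.
have i1e : mu.-integrable B (EFin \o (fun x => \1_(eball (2 * rho)) x * e x)).
  by apply: (@bounded_integrable _ _ _ _ _ 1) => // x _; rewrite ger0_norm.
have ice : mu.-integrable B (EFin \o (fun x => cut rho x * e x)).
  apply: (@bounded_integrable _ _ _ _ _ 1) => //; first exact: measurable_cut.
  by move=> x _; rewrite ger0_norm ?cut_ge0 ?cut_le1.
have i1 : mu.-integrable B (EFin \o (\1_(@eball R n (2 * rho)) : E -> R)).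
  apply: sqr_integrable => //; [exact: eball_lty|exact: measurable_funTS|].
  by apply: (@bounded_sqr_lty _ _ _ _ 1) => // x _; rewrite ger0_norm.
have iZ c (g : E -> R) : mu.-integrable B (EFin \o g) ->
    mu.-integrable B (EFin \o (fun x => c * g x)) by move=> ig; exact: (integrableZl mB c ig).
have iR : mu.-integrable B (EFin \o (fun x => 2^-1 * (\1_(eball (2 * rho)) x * e x) +
    K rho * \1_(eball (2 * rho)) x)).
  exact: (integrableD mB (iZ _ _ i1e) (iZ _ _ i1)).
have iA : mu.-integrable B (EFin \o (fun x => w x * dcut rho (Du x) x * (u x - m))).
  apply: le_integrable iR => //.
    apply/measurable_EFinP; apply: measurable_funTS; apply: measurable_funM.
      by apply: measurable_funM; [exact: measurable_weight|exact: measurable_dcut].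
    exact: measurable_funB.
  by move=> x _; rewrite lee_fin (le_trans (pointwise x rho0))// ler_norm.
have h1 : \int[mu]_(x in B) e x <= \int[mu]_(x in B) (cut rho x * e x) + T.
  rewrite -RintegralD//; apply: le_Rintegral => //; first exact: (integrableD mB ice i1e).
  move=> x _; rewrite -mulrDl ler_peMl// indicE.
  have [x2|x2] := leP (2 * rho) (enorm x); first by rewrite cut1// lerDl.
  by rewrite mem_set// lerDr cut_ge0.
have h2 : (- \int[mu]_(x in B) (w x * dcut rho (Du x) x * (u x - m))) <=
    2^-1 * T + K rho * \int[mu]_(x in B) \1_(eball (2 * rho)) x.
  apply: le_trans (ler_norm _) _; rewrite normrN.
  apply: le_trans (le_normr_Rintegral mB iA) _.
  rewrite -!RintegralZl// -RintegralD//; [|exact: iZ..].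
  apply: le_Rintegral => //; first exact: integrable_norm.
  by move=> x _; exact: pointwise.
have h3 : K rho * \int[mu]_(x in B) \1_(eball (2 * rho)) x <= C0 * rho `^ (n%:R - 2 - 2 * a).
  apply: (@le_trans _ _ (K rho * ((2 * rho) ^+ n * fine (mu (@eball R n 1))))).
    by rewrite ler_wpM2l//; apply: Rintegral_indic_eball; rewrite ?mulr_gt0.
  rewrite le_eqVlt; apply/orP; left; apply/eqP.
  have rhoN0 : rho != 0 by rewrite gt_eqF.
  have -> : rho `^ (n%:R - 2 - 2 * a) = rho ^+ n * ((rho ^+ 2)^-1 * rho `^ p).
    rewrite (_ : _ - _ = n%:R + (- 2%:R + p)); last by rewrite /p; ring.
    rewrite powRD ?rhoN0 ?implybT// (powRD (r := - 2%:R)) ?rhoN0 ?implybT//.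
    by rewrite powRN !powR_mulrn ?ltW.
  rewrite /K /C0 [(2 * rho) ^+ n]exprMn.
  by move: (2 ^+ n) (rho ^+ n) (rho `^ p) (Num.max _ _) => A1 A2 A3 A4; field.
have h4 : \int[mu]_(x in B) (cut rho x * e x) <=
    2^-1 * T + K rho * \int[mu]_(x in B) \1_(eball (2 * rho)) x.
  exact: le_trans (cut_le rho0) h2.
by rewrite -/T; move: h1 h3 h4 T0; lra.
Qed.

Let energy0 : \int[mu]_(x in B) e x = 0.
Proof.
apply/eqP; rewrite eq_le; apply/andP; split; last by apply: Rintegral_ge0.
apply/ler_addgt0Pl => d d0; rewrite addr0.
have s0 : 0 < (n%:R - 2 - 2 * a) by [].
(* The radius [step k] will be at most [d1] to the power 1 / (n - 2 - 2a), so the volume term is at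
   most [C0 * d1 <= d / 2]; the threshold d / 6 for the small ball contributes d / 3. *)
pose d1 := d / 2 / (C0 + 1).
have C00 : 0 <= C0.
  by rewrite !mulr_ge0 ?sqr_ge0 ?invr_ge0 ?exprn_ge0 ?fine_ge0 ?le_max ?ler01.
have d10 : 0 < d1 by rewrite !divr_gt0// ltr_wpDl.
have d1p : 0 < d1 `^ (n%:R - 2 - 2 * a)^-1 by rewrite powR_gt0.
have d6 : 0 < d / 6 by rewrite divr_gt0.
have [k _ /(_ k (leqnn k))[/= k1 k2]] : \forall k \near \oo,
   \int[mu]_(x in B) (\1_(eball (2 * step R k)) x * e x) <= d / 6 /\
   step R k <= d1 `^ (n%:R - 2 - 2 * a)^-1.
  near=> k; split; near: k; first exact: T_small.
  exact: (cvgr_le (0 : R) (@step_cvg0 R)).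
have sk0 : 0 < step R k by rewrite invr_gt0.
have := cut_bound sk0.
have : C0 * step R k `^ (n%:R - 2 - 2 * a) <= d / 2.
  apply: (@le_trans _ _ (C0 * d1)).
    rewrite ler_wpM2l//.
    rewrite (@le_trans _ _ ((d1 `^ (n%:R - 2 - 2 * a)^-1) `^ (n%:R - 2 - 2 * a)))//.
      by rewrite ge0_ler_powR ?nnegrE// ?(ltW s0) ?(ltW sk0) ?(ltW d1p).
    by rewrite -powRrM mulVf ?gt_eqF// powRr1// ltW.
  rewrite /d1 mulrCA ler_piMr ?divr_ge0 ?(ltW d0)//.
  by rewrite ler_pdivrMr ?mul1r ?lerDl ?ltr_wpDl.
lra.
Unshelve. all: by end_near. Qed.

Lemma gradient_ae0 : {ae mu, forall x, B x -> Du x = 0}.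
Proof.
have : ae_eq mu B (EFin \o e) (cst 0%E).
  apply/(ae_eq_integral_abs mu mB); first by apply/measurable_EFinP; exact: measurable_funTS.
  under eq_integral do rewrite gee0_abs ?lee_fin ?e_ge0//.
  have := integrable_fin_num mB ie; have := energy0; rewrite /Rintegral.
  by case: (integral _ _ _) => //= s ->.
(* For a != 0 the weight at the origin is 0 by the convention for [powR], and nothing follows there
   about [Du]; the point is discarded. *)
have : {ae mu, forall x, x != 0}.
  exists [set 0]; split; [exact: measurable_rV0|exact: lebesgue_rV0|].
  by move=> x /= /negP; rewrite negbK => /eqP.
apply: filterS2 => x x0 ex0 Bx.
have := ex0 Bx; rewrite /= => -[] /eqP.
rewrite /e mulf_eq0 => /orP[|].
  rewrite /weight gt_eqF// powR_gt0// lt_def enorm_ge0 andbT enorm_eq0//.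
by rewrite -enorm_sqr sqrf_eq0 enorm_eq0 => /eqP.
Qed.

End energy_vanishes.

(** * Functions with vanishing weak gradient *)

Section constancy.
Context (R : realType) (n : nat) (r : R) (r0 : 0 < r).
Implicit Types (x y z v : 'rV[R]_n).
Local Notation E := 'rV[R]_n.
Local Notation mu := (lebesgue_rV R n).
Local Notation B := (@eball R n r).
Let mB : measurable B := measurable_eball r.
Variables (u : E -> R) (Du : E -> E) (M : R).
Hypothesis meas_u : measurable_fun setT u.
Hypothesis u_bound : forall x, `|u x| <= M.
Hypothesis mDu : forall i, measurable_fun setT (fun x => Du x ord0 i).
Hypothesis u_grad : forall phi Dphi, C1_compact_support (B `\ 0) phi Dphi ->
  forall i : 'I_n, \int[mu]_(x in B) (u x * Dphi x ord0 i) =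
    - \int[mu]_(x in B) (Du x ord0 i * phi x).
Hypothesis Du0 : {ae mu, forall x, B x -> Du x = 0}.
Hypothesis n2 : (2 <= n)%N.

Let M_ge0 : 0 <= M.
Proof. by rewrite (le_trans _ (u_bound 0)). Qed.

Let u2 : (\int[mu]_(x in B) (u x ^+ 2)%:E < +oo)%E.
Proof. exact: (@bounded_sqr_lty _ _ _ _ M). Qed.

Let iu : mu.-integrable B (EFin \o u).
Proof. by apply: sqr_integrable => //; [exact: eball_lty|exact: measurable_funTS]. Qed.

Let bumpx j x y := bump (width r j) (dil R j *: x - y).
Let dbumpx j x i y := dbump (width r j) (evec R i) (dil R j *: x - y).

Let mbx j x : measurable_fun setT (bumpx j x).
Proof. by apply: measurable_shift; exact: measurable_bump. Qed.

Let mdbx j x i : measurable_fun setT (dbumpx j x i).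
Proof. by apply: measurable_shift; exact: measurable_dbump. Qed.

Let weak0 j x i rho : B x -> 0 < rho ->
  \int[mu]_(y in B) (u y * (- dbumpx j x i y * cut rho y + bumpx j x y * dcut rho (evec R i) y)) = 0.
Proof.
move=> Bx rho0; have := u_grad (test_bump_cut r0 j rho0 Bx) i.
under eq_Rintegral do rewrite mxE.
move=> ->; apply/eqP; rewrite oppr_eq0; apply/eqP.
rewrite /Rintegral (@ae_eq_integral _ _ _ mu B (cst 0%E)) ?integral0//.
  apply/measurable_EFinP; apply: measurable_funTS; apply: measurable_funM => //.
  by apply: measurable_funM; [exact: mbx|exact: measurable_cut].
by apply: filterS Du0 => y Dy0 By; rewrite /= Dy0// mxE mul0r.
Qed.

(** Removability of the origin for Du = 0: replacing the cutoff by 1 in [weak0] changes the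
    integrand only in the ball of radius [2 * rho], by O(1 / rho), while the volume is O(rho^n) with
    n >= 2. *)
Let dbump_int0 j x i : B x -> \int[mu]_(y in B) (dbumpx j x i y * u y) = 0.
Proof.
move=> Bx.
have [L dL] := loc_lipschitz_bounded (@dbump_lip R n (width r j) (evec R i)) (enorm x + r).
pose V := fine (mu (@eball R n 1)).
pose h4 := (width r j ^+ 2) ^+ 2.
(* [M] bounds [u], [L] the derivative of the bump and [h4] the bump itself; 16 is the constant of
   [dcut_le], whose 1 / rho uses up one of two powers of [rho]. *)
pose C := 2 ^+ n * V * (M * (L + h4 * 16)).
have L0 : 0 <= L.
  apply: le_trans (normr_ge0 _) (dL 0 _).
  by rewrite (_ : enorm 0 = 0) ?addr_ge0 ?enorm_ge0 ?ltW//; apply/eqP; rewrite enorm_eq0.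
have h40 : 0 <= h4 by exact: sqr_ge0.
have V0 : 0 <= V by exact: fine_ge0.
have C0 : 0 <= C.
  have A0 : 0 <= L + h4 * 16 by apply: addr_ge0 => //; exact: mulr_ge0.
  by apply: mulr_ge0; apply: mulr_ge0 => //; exact: exprn_ge0.
have bound rho : 0 < rho -> rho <= 1 -> `|\int[mu]_(y in B) (dbumpx j x i y * u y)| <= C * rho.
  move=> rho0 rho1.
  pose k y := - dbumpx j x i y * cut rho y + bumpx j x y * dcut rho (evec R i) y.
  pose K := M * (L + h4 * (16 / rho)).
  have bL y : B y -> `|dbumpx j x i y| <= L.
    by move=> By; apply: dL; apply: enorm_shift_le => //; exact: dil_norm_le1.
  have bh y : `|bumpx j x y| <= h4 by rewrite ger0_norm ?bump_ge0 ?bump_le.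
  have bd y : `|dcut rho (evec R i) y| <= 16 / rho.
    rewrite (le_trans (dcut_le rho0 _ _))// [enorm _](_ : _ = 1) ?mulr1//.
    by apply/eqP; rewrite -sqrp_eq1 ?enorm_ge0// enorm_sqr dotp_evec mxE !eqxx.
  have bc y : `|cut rho y| <= 1 by rewrite ger0_norm ?cut_ge0 ?cut_le1.
  have mk : measurable_fun setT k.
    apply: measurable_funD; apply: measurable_funM.
    - exact: (measurableT_comp (@oppr_measurable R setT) (mdbx j x i)).
    - exact: measurable_cut.
    - exact: mbx.
    - by apply: measurable_dcut => i'; exact: measurable_cst.
  have ik : mu.-integrable B (EFin \o (fun y => k y * u y)).
    apply: (@bounded_integrable _ _ _ _ _ (L * 1 + h4 * (16 / rho))) => // y By.
    rewrite (le_trans (ler_normD _ _))// lerD// normrM ?normrN ler_pM// ?bL//.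
  have idb : mu.-integrable B (EFin \o (fun y => dbumpx j x i y * u y)).
    by apply: (@bounded_integrable _ _ _ _ _ L) => //; exact: mdbx.
  have ik0 : \int[mu]_(y in B) (k y * u y) = 0.
    rewrite -(weak0 j i Bx rho0); apply: eq_Rintegral => y _.
    by rewrite mulrC.
  have -> : \int[mu]_(y in B) (dbumpx j x i y * u y) =
      \int[mu]_(y in B) (dbumpx j x i y * u y + k y * u y).
    by rewrite RintegralD// ik0 addr0.
  have i1 : mu.-integrable B (EFin \o (\1_(@eball R n (2 * rho)) : E -> R)).
    have m1 : measurable_fun setT (\1_(@eball R n (2 * rho)) : E -> R).
      by apply: measurable_indic; exact: measurable_eball.
    apply: sqr_integrable => //; [exact: eball_lty|exact: measurable_funTS|].
    by apply: (@bounded_sqr_lty _ _ _ _ 1) => // y _; rewrite ger0_norm// indicE lern1 leq_b1.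
  apply: (@le_trans _ _ (\int[mu]_(y in B) (K * \1_(eball (2 * rho)) y))).
    have iD := integrableD mB idb ik.
    apply: le_trans (le_normr_Rintegral mB iD) _.
    apply: le_Rintegral => //.
    - exact: integrable_norm.
    - exact: (integrableZl mB K i1).
    move=> y By /=; rewrite -mulrDl normrM mulrC.
    have -> : dbumpx j x i y + k y = dbumpx j x i y * (1 - cut rho y) +
        bumpx j x y * dcut rho (evec R i) y by rewrite /k; ring.
    rewrite indicE; have [y2|y2] := leP (2 * rho) (enorm y).
      rewrite cut1// dcut1// subrr !mulr0 addr0 normr0 mulr0.
      by rewrite /K !mulr_ge0 ?addr_ge0 ?mulr_ge0 ?invr_ge0// ltW.
    rewrite mem_set// mulr1 /K ler_pM// (le_trans (ler_normD _ _))// lerD//.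
      apply: le_trans (bL y By); rewrite normrM ler_piMr//.
      by rewrite ger0_norm ?subr_ge0 ?cut_le1// lerBlDr lerDl cut_ge0.
    by rewrite normrM ler_pM.
  rewrite RintegralZl//.
  have K0 : 0 <= K by rewrite /K !mulr_ge0 ?addr_ge0 ?mulr_ge0 ?invr_ge0// ltW.
  apply: (@le_trans _ _ (K * ((2 * rho) ^+ n * V))).
    by rewrite ler_wpM2l//; apply: Rintegral_indic_eball; rewrite ?mulr_gt0.
  (* This relies on [rho <= 1], hence the minimum with 1 in the final choice of [rho]. *)
  have rn : rho ^+ n <= rho ^+ 2 by apply: ler_wiXn2l => //; exact: ltW.
  apply: (@le_trans _ _ (K * ((2 ^+ n * rho ^+ 2) * V))).
    rewrite ler_wpM2l// ler_wpM2r// exprMn ler_wpM2l ?exprn_ge0//.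
  rewrite [leLHS](_ : _ = 2 ^+ n * V * (M * (L * rho + h4 * 16)) * rho); last first.
    by rewrite /K; move: (2 ^+ n) => A; field; rewrite gt_eqF.
  rewrite ler_wpM2r ?(ltW rho0)// /C ler_wpM2l ?mulr_ge0 ?exprn_ge0// ler_wpM2l// lerD2r.
  by rewrite ler_piMr.
apply/eqP; rewrite -normr_le0; apply/ler_addgt0Pl => d d0; rewrite addr0.
have d1 : 0 < d / (C + 1) by rewrite divr_gt0// ltr_wpDl.
apply: (le_trans (bound (Num.min 1 (d / (C + 1))) _ _)).
- by rewrite lt_min ltr01.
- by rewrite ge_min lexx.
- apply: (@le_trans _ _ (C * (d / (C + 1)))).
    by rewrite ler_wpM2l// ge_min lexx orbT.
  by rewrite mulrCA ler_piMr ?(ltW d0)// ler_pdivrMr ?mul1r ?lerDl ?ltr_wpDl.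
Qed.

Let dmoll0 j x v : B x -> dmoll r j v u x = 0.
Proof.
move=> Bx; rewrite /dmoll.
suff -> : conv r (dbump (width r j) v) (dil R j) u x = 0 by rewrite !mulr0.
have idb i : mu.-integrable B (EFin \o (fun y => dbumpx j x i y * u y)).
  by apply: conv_integrable; [exact: measurable_dbump|exact: dbump_lip|exact: dil_norm_le1|].
have di i : mu.-integrable B (EFin \o (fun y => v ord0 i * (dbumpx j x i y * u y))).
  exact: (integrableZl mB _ (idb i)).
have [_ iE] := Rintegral_sum (index_enum 'I_n) di.
rewrite /conv; transitivity (\int[mu]_(y in B) (\sum_i v ord0 i * (dbumpx j x i y * u y))).
  apply: eq_Rintegral => y _; rewrite /dbumpx /dbump [dotp _ v]/dotp.
  rewrite !mulr_sumr mulr_suml; apply: eq_bigr => i _; rewrite dotp_evec; ring.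
by rewrite iE big1// => i _; rewrite RintegralZl// dbump_int0// mulr0.
Qed.

(** The segment from 0 to [x] stays in the ball, where by [dmoll0] the derivative along [x]
    vanishes. It may start at 0, since the mollification is regular there although the weak gradient
    is given only off 0. *)
Let moll_cst j x : B x -> moll r j u x = moll r j u 0.
Proof.
move=> Bx; pose f (t : R) := moll r j u (t *: x).
have inB (t : R) : t \in `]0, 1[%R -> B (t *: x).
  rewrite in_itv /= => /andP[t0 t1]; rewrite /eball /= enormZ gtr0_norm//.
  by rewrite (le_lt_trans _ Bx)// ler_piMl ?enorm_ge0// ltW.
have df (t : R) : t \in `]0, 1[%R -> is_derive t (1 : R) f 0.
  move=> /inB tB; apply: quad_is_derive.
  have [C hC] := moll_quad j (t *: x) x iu.
  exists C => s s1; have := hC s s1; rewrite dmoll0// /f scalerDl.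
  by rewrite [s *: 1]mulr1.
have cf : {within `[(0 : R), 1], continuous f}.
  apply: continuous_subspaceT => t; apply: (@continuous_comp _ _ _ (fun t : R => t *: x) (moll r j u)).
    exact: scalel_continuous.
  exact: moll_continuous.
have [c _] := MVT ltr01 df cf.
by rewrite mul0r /f scale1r scale0r => /eqP; rewrite subr_eq0 => /eqP.
Qed.

(** Let g = u - c with [c] the mean. Each mollification of [u] is constant on the ball, so its
    pairing with [g] is a multiple of the integral of [g], which is 0. In the limit [g] is
    orthogonal to [u], and as it is orthogonal to constants too, its L^2 norm is 0. *)
Lemma constant_ae : exists c, {ae mu, forall x, B x -> u x = c}.
Proof.
pose V := fine (mu B).
have VE : mu B = V%:E by rewrite /V fineK// ge0_fin_numE// eball_lty.
have [V00|V0] := eqVneq V 0.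
  by exists 0, B; split; rewrite ?VE ?V00// => x /= /not_implyP[].
pose c := V^-1 * \int[mu]_(x in B) u x.
pose g x := u x - c.
have mg : measurable_fun setT g by exact: measurable_funB.
have g2 : (\int[mu]_(x in B) (g x ^+ 2)%:E < +oo)%E.
  apply: (@bounded_sqr_lty _ _ _ _ (M + `|c|)) => // x _.
  by rewrite (le_trans (ler_normB _ _))// lerD2r.
have ig : mu.-integrable B (EFin \o g).
  by apply: sqr_integrable => //; [exact: eball_lty|exact: measurable_funTS].
have ic : mu.-integrable B (EFin \o (cst c : E -> R)).
  apply: sqr_integrable => //; first exact: eball_lty.
  exact: (@bounded_sqr_lty _ _ _ _ `|c|).
have g0 : \int[mu]_(x in B) g x = 0.
  rewrite RintegralB// Rintegral_cst//= -/V.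
  by rewrite /c mulrAC mulVf// mul1r subrr.
have gu : \int[mu]_(x in B) (g x * u x) = 0.
  apply: (cvg_unique (@Rhausdorff R) (moll_pairing r0 mg meas_u g2 u2)).
  apply: cvg_near_cst; apply: nearW => j.
  rewrite (@eq_Rintegral _ _ _ mu B (fun x => moll r j u 0 * g x)).
    by rewrite RintegralZl// g0 mulr0.
  by move=> x /set_mem Bx; rewrite moll_cst// mulrC.
have gg : \int[mu]_(x in B) (g x ^+ 2) = 0.
  rewrite (@eq_Rintegral _ _ _ mu B (fun x => g x * u x - c * g x)); last first.
    by move=> x _; rewrite /g; ring.
  rewrite RintegralB//; last 2 first.
  - exact: sqr_mul_integrable.
  - exact: (integrableZl mB c ig).
  by rewrite gu RintegralZl// g0 mulr0 subrr.
exists c.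
have : ae_eq mu B (EFin \o (fun x => g x ^+ 2)) (cst 0%E).
  apply/(ae_eq_integral_abs mu mB).
    by apply/measurable_EFinP; apply: measurable_funTS; exact: measurable_funX.
  under eq_integral do rewrite gee0_abs ?lee_fin ?sqr_ge0//.
  have g2f : (\int[mu]_(x in B) (g x ^+ 2)%:E)%E \is a fin_num.
    by rewrite ge0_fin_numE//; apply: integral_ge0 => x _; rewrite lee_fin sqr_ge0.
  by move: gg g2f; rewrite /Rintegral; case: (integral _ _ _) => //= s ->.
apply: filterS => x gx Bx; have := gx Bx; rewrite /= => -[] /eqP.
by rewrite sqrf_eq0 subr_eq0 => /eqP.
Qed.

End constancy.

(** * The source term *)

Section source_term.
Context (R : realType).

Lemma sign_change (f : R -> R) (k M : R) :
  (forall s t : R, 0 < s -> s <= t -> f t / t `^ k <= f s / s `^ k) ->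
  exists m, forall t, 0 < t -> t <= M -> f t * (t - m) <= 0.
Proof.
move=> fk.
have pos s t : 0 < s -> s <= t -> 0 < f t -> 0 < f s.
  move=> s0 st ft; have t0 : 0 < t by exact: lt_le_trans st.
  have : 0 < f s / s `^ k by rewrite (lt_le_trans _ (fk s t s0 st))// divr_gt0 ?powR_gt0.
  by rewrite pmulr_lgt0// invr_gt0 powR_gt0.
(* The threshold [m] is the supremum of the points up to [M] where [f] is positive; 0 is added so
   that the set is never empty. *)
pose A := [set t | t = 0 \/ [/\ 0 < t, t <= M & 0 < f t]].
have A0 : A !=set0 by exists 0; left.
exists (sup A) => t t0 tM; have [ft|ft] := ltP 0 (f t).
  rewrite pmulr_rle0// subr_le0; apply: ub_le_sup; last by right.
  exists (Num.max 0 M) => s [->|[_ sM _]]; first by rewrite le_max lexx.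
  by rewrite le_max sM orbT.
rewrite mulr_le0_ge0// subr_ge0; apply: ge_sup => // s [->|[s0 _ fs]]; first exact: ltW.
by rewrite leNgt; apply/negP => /ltW ts; have := pos t s t0 ts fs; rewrite ltNge ft.
Qed.

Variables (f : R -> R).
Hypothesis f1 : C1_halfline f.

Lemma C1_halfline_continuous t : 0 < t -> {for t, continuous f}.
Proof.
move=> t0; have [f' [df _ _]] := f1.
by apply: differentiable_continuous; apply/derivable1_diffP; have [] := df t t0.
Qed.

(** The interval is split: near 0 the one-sided difference quotient is bounded by [|f' 0| + 1], and
    on a compact interval away from 0 [f] is continuous. *)
Lemma C1_halfline_bounded M : 0 < M -> exists C, forall t, 0 < t -> t <= M -> `|f t| <= C.
Proof.
move=> M0; have [f' [_ f0 _]] := f1.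
pose b := `|f' 0| + 1.
have [d d0 fd] : exists2 d, 0 < d & forall h, 0 < h -> h < d -> `|f h| <= `|f 0| + b * d.
  have : \forall h \near 0^'+, `|h^-1 * (f h - f 0)| <= b.
    have : \forall h \near 0^'+, `|f' 0 - h^-1 * (f h - f 0)| <= 1.
      by move/cvgrPdist_le : f0; apply.
    apply: filterS => h; rewrite /b -lerBlDl; apply: le_trans.
    by rewrite distrC; exact: lerB_dist.
  move=> [d /= d0 fd]; exists d => // h h0 hd.
  have := fd h _ h0; rewrite /ball/= sub0r normrN gtr0_norm// => /(_ hd).
  rewrite normrM ger0_norm ?invr_ge0 ?(ltW h0)// ler_pdivrMl// => fh.
  rewrite -[f h](subrK (f 0)) addrC (le_trans (ler_normD _ _))// lerD2l (le_trans fh)//.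
  by rewrite mulrC ler_wpM2l ?(ltW hd)// addr_ge0.
(* Half of [d] makes the compact interval overlap the range h < d of [fd]. *)
have d2 : 0 < d / 2 by rewrite divr_gt0.
have [dM|dM] := leP (d / 2) M; last first.
  exists (`|f 0| + b * d) => t t0 tM; apply: fd => //.
  by move: dM; lra.
have cf : {within `[d / 2, M], continuous f}.
  apply: continuous_in_subspaceT => t; rewrite inE/= in_itv/= => /andP[dt _].
  by apply: C1_halfline_continuous; exact: lt_le_trans dt.
have [c1 _ fc1] := EVT_max dM cf.
have [c2 _ fc2] := EVT_min dM cf.
exists (Num.max (`|f 0| + b * d) (`|f c1| + `|f c2|)) => t t0 tM; rewrite le_max.
have [td|td] := ltP t (d / 2).
  by rewrite fd//; move: td; lra.
have tI : t \in `[d / 2, M] by rewrite in_itv/= td.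
apply/orP; right; rewrite ler_norml.
have := fc1 t tI; have := fc2 t tI.
have := ler_norm (f c1); have := ler_norm (- f c2); rewrite normrN.
by have := normr_ge0 (f c1); have := normr_ge0 (f c2); move=> *; apply/andP; split; lra.
Qed.

Lemma measurable_C1_halfline : measurable_fun (`]0, +oo[%classic : set R) f.
Proof.
apply: open_continuous_measurable_fun; first exact: interval_open.
by move=> t; rewrite inE/= in_itv/= andbT; exact: C1_halfline_continuous.
Qed.

End source_term.

(** * Integrals of functions that agree off a null set *)

Section almost_everywhere.
Local Open Scope ereal_scope.
Context d (T : measurableType d) (R : realType) (mu : {measure set T -> \bar R}).
Import HBNNSimple.

(** The integral of an arbitrary nonnegative function is a supremum over simple functions below it.
    Setting such a simple function to 0 on [N] keeps its integral and puts it below [g]. *)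
Let ge0_integral_offnull_le (N : set T) (f g : T -> \bar R) : measurable N -> mu N = 0 ->
  (forall x, 0 <= f x) -> (forall x, 0 <= g x) -> (forall x, ~ N x -> f x = g x) ->
  \int[mu]_x f x <= \int[mu]_x g x.
Proof.
move=> mN N0 f0 g0 fg; rewrite [leLHS]ge0_integralTE// [leRHS]ge0_integralTE//.
apply: ge_ereal_sup => _ [h hf <-].
pose h' := proj_nnsfun h (measurableC mN).
have -> : sintegral mu h = sintegral mu h'.
  rewrite -!integralT_nnsfun; apply: ge0_ae_eq_integral => //.
  - exact/measurable_EFinP.
  - exact/measurable_EFinP.
  - by move=> x _; rewrite lee_fin.
  - by move=> x _; rewrite lee_fin.
  exists N; split => // x /= nx; apply: contrapT => xN; apply: nx => _.
  by rewrite mindicE mem_set// mulr1.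
apply: ereal_sup_ubound; exists h' => // x; rewrite /= mindicE.
have [xN|xN] := pselect (N x).
  by rewrite memNset ?mulr0//=; exact.
by rewrite mem_set//= mulr1 -fg.
Qed.

(* The absence of measurability hypotheses matters: [f (u x)] is arbitrary on the
   null set where [u <= 0]. *)
Lemma ae_eq_integral_any (D : set T) (f g : T -> \bar R) :
  {ae mu, forall x, D x -> f x = g x} -> \int[mu]_(x in D) f x = \int[mu]_(x in D) g x.
Proof.
move=> [N [mN N0 fgN]]; rewrite integral_mkcond [RHS]integral_mkcond.
have fg x : ~ N x -> (f \_ D) x = (g \_ D) x.
  move=> xN; rewrite !patchE; case: ifPn => // /set_mem Dx.
  by apply: contrapT => nfg; apply: xN; apply: fgN => /= /(_ Dx).
rewrite integralE [RHS]integralE; congr (_ - _); apply/eqP; rewrite eq_le; apply/andP; split;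
  apply: (ge0_integral_offnull_le mN N0) => // x xN;
  by rewrite ?funeposE ?funenegE fg.
Qed.

Lemma ae_eq_Rintegral (D : set T) (f g : T -> R) :
  {ae mu, forall x, D x -> f x = g x} ->
  (\int[mu]_(x in D) f x = \int[mu]_(x in D) g x)%R.
Proof.
move=> fg; rewrite /Rintegral; congr fine; apply: ae_eq_integral_any.
by apply: filterS fg => x fx Dx; rewrite fx.
Qed.

End almost_everywhere.

(** * The theorem, through a representative that is positive and bounded everywhere *)

Theorem theorem1p1 (R : realType) (d : nat) (a b r : R) (f : R -> R) :
  (3 <= d)%N ->
  a <= b -> b < a + 1 -> a < (d%:R - 2) / 2 ->
  0 < r ->
  C1_halfline f ->
  (let n := n_dim d a b in
   let Phi := fun t : R => f t / t `^ ((n + 2) / (n - 2)) in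
   forall s t : R, 0 < s -> s <= t -> Phi t <= Phi s) ->
  alpha_par d a b <= Num.sqrt ((d%:R - 1) / (n_dim d a b - 1)) ->
  forall u : 'rV[R]_d -> R,
    weak_solution a (b * q_exp d a b) f (@eball R d r) u ->
    ae_positive (@eball R d r) u ->
    ae_bounded (@eball R d r) u ->
    ae_constant (@eball R d r) u.
Proof.
move=> d3 _ _ ad r0 f1 Phi_dec _ u.
set s := b * _; set B := eball r; set mu := lebesgue_rV R d.
move=> [Du [meas_u mDu [_ _ u_grad] _ finite_energy] u_eq] u_pos [M' uM'].
(* The maximum with 1 makes [M] positive, so that it can serve as the value of [v] off [G]. *)
pose M := Num.max 1 M'.
have M0 : 0 < M by rewrite lt_max ltr01.
have [m f_sign] := sign_change M Phi_dec.
have [Cf f_bound] := C1_halfline_bounded f1 M0.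
have mB : measurable B by exact: measurable_eball.
pose G := B `&` u @^-1` `]0, M].
have mG : measurable G by apply: meas_u => //; exact: measurable_itv.
(* The changes affect [u] on a null set of [B] only; they make the bounds and the
   measurability global. *)
pose v x := if x \in G then u x else M.
pose Dv x := if x \in B then Du x else 0.
have v_gt0 x : 0 < v x.
  rewrite /v; case: ifPn => // /set_mem[_]; rewrite /= in_itv/= => /andP[]//.
have v_le x : v x <= M.
  rewrite /v; case: ifPn => // /set_mem[_]; rewrite /= in_itv/= => /andP[]//.
have v_bound x : `|v x| <= M by rewrite gtr0_norm.
have uv : {ae mu, forall x, B x -> u x = v x}.
  apply: filterS2 u_pos uM' => x px bx Bx.
  rewrite /v mem_set//; split => //; rewrite /= in_itv/= px//= le_max.
  by rewrite (le_trans (ler_norm _) (bx Bx)) orbT.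
have DvE x : B x -> Dv x = Du x by move=> Bx; rewrite /Dv mem_set.
have mv : measurable_fun setT v.
  rewrite (_ : v = (fun x => (u \_ G) x + \1_(~` G) x * M)).
    apply: measurable_funD.
      apply/(measurable_restrictT _ _).1 => //.
      by apply: measurable_funS meas_u => // x [].
    by apply: measurable_funM => //; apply: measurable_indic; exact: measurableC.
  apply/funext => x; rewrite /v patchE indicE in_setC; case: ifPn => _ /=.
    by rewrite mul0r addr0.
  by rewrite mul1r add0r.
have mDv i : measurable_fun setT (fun x => Dv x ord0 i).
  rewrite (_ : (fun _ => _) = (fun x => Du x ord0 i) \_ B).
    by apply/(measurable_restrictT _ _).1.
  by apply/funext => x; rewrite /Dv patchE; case: ifPn => // _; rewrite mxE.
have x0 : {ae mu, forall x : 'rV[R]_d, x != 0}.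
  exists [set 0]; split; [exact: measurable_rV0|apply: lebesgue_rV0|].
    exact: leq_trans d3.
  by move=> x /= /negP; rewrite negbK => /eqP.
(* The weak gradient lives on the punctured ball and the equation on the full one; the origin is a
   null set, so the integrals agree for any [g]. *)
have punctured (g : 'rV[R]_d -> R) : fine (\int[mu]_(x in B `\ (0 : 'rV[R]_d)%R) (g x)%:E)%E =
    \int[mu]_(x in B) g x.
  rewrite /Rintegral [in LHS]integral_mkcond [in RHS]integral_mkcond; congr fine.
  apply: ae_eq_integral_any; apply: filterS x0 => x x0 _; rewrite !patchE.
  by congr (if _ then _ else _); apply/idP/idP => /set_mem; [case=> ? _|move=> ?];
    apply/mem_set => //; split => //; exact/eqP.
have v_grad phi Dphi : C1_compact_support (B `\ 0) phi Dphi -> forall i : 'I_d,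
    \int[mu]_(x in B) (v x * Dphi x ord0 i) = - \int[mu]_(x in B) (Dv x ord0 i * phi x).
  move=> tphi i; have := congr1 fine (u_grad phi Dphi tphi i).
  rewrite fineN !punctured => uE.
  rewrite (_ : \int[mu]_(x in B) (v x * _) = \int[mu]_(x in B) (u x * Dphi x ord0 i)).
    by rewrite uE; congr (- _); apply: eq_Rintegral => x /set_mem Bx; rewrite DvE.
  by apply: ae_eq_Rintegral; apply: filterS uv => x vx Bx; rewrite vx.
have energy_lty : (\int[mu]_(x in B) (weight a x * dotp (Dv x) (Dv x))%:E < +oo)%E.
  rewrite (eq_integral (fun x => (enorm x `^ (- (2 * a)) * dotp (Du x) (Du x))%:E))//.
  by move=> x /set_mem Bx; rewrite DvE.
pose F (x : 'rV[R]_d) := enorm x `^ (- s) * f (v x).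
have mF : measurable_fun setT F.
  apply: measurable_funM.
    exact: (measurableT_comp (measurable_powR (- s)) (@measurable_enorm R d)).
  apply: (@measurable_comp _ _ _ _ _ _ (`]0, +oo[%classic : set R)) => //.
  - by move=> _ [x _ <-]; rewrite /= in_itv/= andbT.
  - exact: measurable_C1_halfline.
have F_sign x : B x -> F x * (v x - m) <= 0.
  by move=> _; rewrite -mulrA mulr_ge0_le0 ?powR_ge0// f_sign.
have F_far rho : 0 < rho -> exists C, forall x, B x -> far rho x -> `|F x| <= C.
  (* In [weight_far] the exponent is minus twice the parameter, so [s / 2] yields the weight of the
     source term. *)
  move=> rho0; have [K [K0 wK]] := @weight_far R d r r0 (s / 2) rho rho0.
  exists (K * Cf) => x Bx xr; rewrite normrM ger0_norm ?powR_ge0// ler_pM ?powR_ge0//.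
    by have [] := wK x Bx xr; rewrite /weight mulrC divfK.
  by apply: f_bound.
have v_eq psi Dpsi : C1_closure B psi Dpsi ->
    \int[mu]_(x in B) (weight a x * dotp (Dv x) (Dpsi x)) = \int[mu]_(x in B) (F x * psi x).
  move=> tpsi; have := congr1 fine (u_eq psi Dpsi tpsi).
  rewrite -!/(Rintegral _ _ _) => uE.
  rewrite (@eq_Rintegral _ _ _ mu B (fun x => enorm x `^ (- (2 * a)) * dotp (Du x) (Dpsi x))).
    rewrite uE; apply: ae_eq_Rintegral; apply: filterS uv => x vx Bx.
    by rewrite /F vx.
  by move=> x /set_mem Bx; rewrite DvE.
have vm_bound x : `|v x - m| <= M + `|m| by rewrite (le_trans (ler_normB _ _))// lerD2r.
have a_lt : 0 < d%:R - 2 - 2 * a :> R by move: ad; rewrite ltr_pdivlMr//; lra.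
have d0 : (0 < d)%N by exact: leq_trans d3.
have d2 : (2 <= d)%N by exact: leq_trans d3.
have Dv0 := gradient_ae0 mv mDv energy_lty vm_bound
  (cut_energy_le r0 mv v_bound mDv v_grad energy_lty mF F_far F_sign v_eq) d0 a_lt.
have [c vc] := constant_ae r0 mv v_bound mDv v_grad Dv0 d2.
by exists c; apply: filterS2 uv vc => x ux vx Bx; rewrite ux// vx.
Qed.
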